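(* Let $\Bbbk$ be a field, $q\in\Bbbk^*$ not a root of unity, $m\le n$ positive integers and $\gamma\in\Pi_{m,n}$. Then the quantum Schubert cell $S^o(\gamma)$ is isomorphic, as a $\Bbbk$-algebra, to a partition subalgebra of $\mathcal{O}_{q^{-1}}(M_{m,n-m}(\Bbbk))$.
   Context: For a nonzero parameter $p\in\Bbbk$ and integers $a\ge1$, $b\ge0$, $\mathcal{O}_p(M_{a,b}(\Bbbk))$ is the $\Bbbk$-algebra generated by $x_{ij}$ ($1\le i\le a$, $1\le j\le b$) subject to the relations: $x_{ij}x_{il}=px_{il}x_{ij}$ for $j<l$; $x_{ij}x_{kj}=px_{kj}x_{ij}$ for $i<k$; $x_{ij}x_{kl}=x_{kl}x_{ij}$ for $k<i$ and $j<l$; $x_{ij}x_{kl}-x_{kl}x_{ij}=(p-p^{-1})x_{il}x_{kj}$ for $i<k$ and $j<l$. (For $b=0$ it is $\Bbbk$.) For a partition $\lambda=(\lambda_1,\dots,\lambda_a)$ with $b\ge\lambda_1\ge\dots\ge\lambda_a\ge0$, the partition subalgebra of $\mathcal{O}_p(M_{a,b}(\Bbbk))$ associated with $\lambda$ is the subalgebra generated by the $x_{ij}$ with $j\le\lambda_i$. For $I=\{i_1<\dots<i_m\}\subseteq\{1,\dots,n\}$ the maximal quantum minor of $\mathcal{O}_q(M_{m,n}(\Bbbk))$ is $[I]=\sum_{\sigma\in\mathfrak{S}_m}(-q)^{\ell(\sigma)}x_{\sigma(1)i_1}\cdots x_{\sigma(m)i_m}$. The quantum grassmannian $\mathcal{O}_q(G_{m,n}(\Bbbk))$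 is the subalgebra of $\mathcal{O}_q(M_{m,n}(\Bbbk))$ generated by all maximal quantum minors, $\mathbb{N}$-graded with each $[I]$ of degree one. $\Pi_{m,n}$ denotes the set of $m$-element subsets of $\{1,\dots,n\}$, identified with the set of maximal quantum minors; $\{i_1<\dots<i_m\}\le_{\mathrm{st}}\{j_1<\dots<j_m\}$ means $i_s\le j_s$ for all $s$. For $\gamma\in\Pi_{m,n}$, $\Pi_{m,n}^\gamma=\{\alpha\in\Pi_{m,n}\mid\alpha\not\ge_{\mathrm{st}}\gamma\}$; the quantum Schubert variety is $S(\gamma)=\mathcal{O}_q(G_{m,n}(\Bbbk))/\langle\Pi_{m,n}^\gamma\rangle$. The image $\overline{\gamma}$ of $\gamma$ in $S(\gamma)$ is a homogeneous regular normal element of degree one, and the quantum Schubert cell $S^o(\gamma)$ is the degree zero subalgebra of the $\mathbb{Z}$-graded algebra $S(\gamma)[\overline{\gamma}^{-1}]$. *)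

(* Defs.v *)
From HB Require Import structures.
From mathcomp Require Import all_boot all_order all_algebra perm.
From mathcomp Require Import boolp.
From mathcomp Require Import monalg.

Set Implicit Arguments.
Unset Strict Implicit.
Unset Printing Implicit Defensive.

Import GRing.Theory.

Local Open Scope ring_scope.
Local Open Scope quotient_scope.

Definition alg_isomorphic (k : fieldType) (A B : algType k) : Prop :=
  exists f : {lrmorphism A -> B}, bijective f.

(* The operations below are locked for efficiency only: this stops unification
   from unfolding them. *)
Fact alg_key : unit. Proof. exact: tt. Qed.

Section FreeAlgebra.
Variables (k : fieldType) (X : choiceType).

Local Notation M := {malg k[{fmonom X}]}.

Definition free_alg : Type := M.

HB.instance Definition _ := GRing.Zmodule.on free_alg.

Definition free_one : free_alg := locked_with alg_key (1 : M).
Definition free_mul : free_alg -> free_alg -> free_alg :=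
  locked_with alg_key (fun u v : M => u * v).
Definition free_scale : k -> free_alg -> free_alg :=
  locked_with alg_key (fun c (u : M) => c *: u).
Definition free_var (x : X) : free_alg :=
  locked_with alg_key (<< fmu x >> : M).

Fact free_oneE : free_one = (1 : M). Proof. by rewrite /free_one unlock. Qed.

Fact free_mulE (u v : M) : free_mul u v = u * v.
Proof. by rewrite /free_mul unlock. Qed.

Fact free_scaleE c (u : M) : free_scale c u = c *: u.
Proof. by rewrite /free_scale unlock. Qed.

Fact free_mulA : associative free_mul.
Proof. by move=> u v w; rewrite !free_mulE mulrA. Qed.

Fact free_mul1 : left_id free_one free_mul.
Proof. by move=> u; rewrite free_mulE free_oneE mul1r. Qed.

Fact free_mulr1 : right_id free_one free_mul.
Proof. by move=> u; rewrite free_mulE free_oneE mulr1. Qed.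

Fact free_mulDl : left_distributive free_mul +%R.
Proof. by move=> u v w; rewrite !free_mulE; exact: (@mulrDl M). Qed.

Fact free_mulDr : right_distributive free_mul +%R.
Proof. by move=> u v w; rewrite !free_mulE; exact: (@mulrDr M). Qed.

Fact free_one_neq0 : free_one != 0.
Proof. by rewrite free_oneE; exact: (oner_neq0 M). Qed.

HB.instance Definition _ := GRing.Zmodule_isNzRing.Build free_alg
  free_mulA free_mul1 free_mulr1 free_mulDl free_mulDr free_one_neq0.

Fact free_scaleA a b u : free_scale a (free_scale b u) = free_scale (a * b) u.
Proof. by rewrite !free_scaleE scalerA. Qed.

Fact free_scale1 : left_id 1 free_scale.
Proof. by move=> u; rewrite free_scaleE scale1r. Qed.

Fact free_scaleDr : right_distributive free_scale +%R.
Proof. by move=> c u v; rewrite !free_scaleE; exact: (@scalerDr _ M). Qed.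

Fact free_scaleDl u : {morph free_scale^~ u : a b / a + b}.
Proof. by move=> a b; rewrite !free_scaleE; exact: (@scalerDl _ M). Qed.

HB.instance Definition _ := GRing.Zmodule_isLmodule.Build k free_alg
  free_scaleA free_scale1 free_scaleDr free_scaleDl.

Fact free_scalerAl (c : k) (u v : free_alg) : c *: (u * v) = (c *: u) * v.
Proof.
rewrite -[LHS]/(free_scale c (free_mul u v)) -[RHS]/(free_mul (free_scale c u) v).
by rewrite !(free_scaleE, free_mulE) fgscaleAl.
Qed.

HB.instance Definition _ := GRing.Lmodule_isLalgebra.Build k free_alg
  free_scalerAl.

Fact free_scalerAr (c : k) (u v : free_alg) : c *: (u * v) = u * (c *: v).
Proof.
rewrite -[LHS]/(free_scale c (free_mul u v)) -[RHS]/(free_mul u (free_scale c v)).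
rewrite !(free_scaleE, free_mulE); apply/malgP=> x; rewrite mcoeffZ.
rewrite [in LHS](mcoeffMl u v x).
rewrite (@mcoeffMlw _ _ (msupp u) (msupp v) u (c *: (v : M)) x);
  [|exact: finmap.fsubset_refl|exact: msuppZ_le].
rewrite mulr_sumr; apply: eq_bigr=> i _; rewrite mulr_sumr; apply: eq_bigr=> j _.
by rewrite mcoeffZ mulrnAr mulrCA.
Qed.

HB.instance Definition _ :=
  GRing.Lalgebra_isAlgebra.Build k free_alg free_scalerAr.

Section Eval.
Variables (B : algType k) (h : X -> B).

Definition fmonom_eval (w : {fmonom X}) : B := \prod_(x <- w) h x.

Fact fmonom_eval_mmorphism : mmorphism fmonom_eval.
Proof.
split=> [u v|]; rewrite /fmonom_eval; first by rewrite fmM big_cat.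
by rewrite fm1 big_nil.
Qed.

HB.instance Definition _ :=
  isMultiplicative.Build {fmonom X} B fmonom_eval fmonom_eval_mmorphism.

Definition free_eval (u : free_alg) : B := mmap (in_alg B) fmonom_eval u.

Fact free_eval_zmod_morphism : zmod_morphism free_eval.
Proof. exact: mmap_is_additive. Qed.

HB.instance Definition _ :=
  GRing.isZmodMorphism.Build free_alg B free_eval free_eval_zmod_morphism.

Fact free_eval_monoid_morphism : monoid_morphism free_eval.
Proof.
have [] := @commr_mmap_is_multiplicative _ _ _ (in_alg B) fmonom_eval.
  by move=> g m m'; rewrite /GRing.comm /= mulr_algl mulr_algr.
move=> fM f1; split=> [|u v].
  by rewrite -[1]/free_one free_oneE /free_eval f1.
by rewrite -[u * v]/(free_mul u v) free_mulE /free_eval fM.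
Qed.

HB.instance Definition _ :=
  GRing.isMonoidMorphism.Build free_alg B free_eval free_eval_monoid_morphism.

Fact free_eval_scalable : scalable free_eval.
Proof.
move=> c u; rewrite -[c *: u]/(free_scale c u) free_scaleE.
by rewrite /free_eval mmapZ /= mulr_algl.
Qed.

HB.instance Definition _ :=
  GRing.isScalable.Build k free_alg B *:%R free_eval free_eval_scalable.

Lemma free_eval_var x : free_eval (free_var x) = h x.
Proof.
rewrite /free_eval /free_var unlock mmapU /fmonom_eval fmU big_seq1 /=.
by rewrite scale1r mul1r.
Qed.
End Eval.
End FreeAlgebra.

Section TwoSidedIdeal.
Variables (k : fieldType) (A : algType k) (P : A -> Prop).

Inductive in_ideal : A -> Prop :=
| in_ideal0 : in_ideal 0
| in_ideal_gen a x b : P x -> in_ideal (a * x * b)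
| in_idealD x y : in_ideal x -> in_ideal y -> in_ideal (x + y).

Definition ideal : {pred A} := fun x => `[< in_ideal x >].

Lemma in_idealM a b x : in_ideal x -> in_ideal (a * x * b).
Proof.
elim=> [|a' y b' Py|y z _ IHy _ IHz].
- by rewrite mulr0 mul0r; exact: in_ideal0.
- by rewrite !mulrA -mulrA; exact: in_ideal_gen.
- by rewrite mulrDr mulrDl; exact: in_idealD.
Qed.

Lemma idealMlr a b x : x \in ideal -> a * x * b \in ideal.
Proof. by move=> /asboolP xI; apply/asboolP; exact: in_idealM. Qed.

Lemma idealMl a x : x \in ideal -> a * x \in ideal.
Proof. by move=> xI; rewrite -[_ * _]mulr1 idealMlr. Qed.

Lemma idealMr b x : x \in ideal -> x * b \in ideal.
Proof. by move=> xI; rewrite -[x]mul1r idealMlr. Qed.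

Fact ideal_zmod_closed : zmod_closed ideal.
Proof.
split=> [|x y /asboolP xI /asboolP yI]; apply/asboolP; first exact: in_ideal0.
apply: in_idealD => //; rewrite -[- y]mulr1 -mulN1r.
exact: in_idealM.
Qed.

HB.instance Definition _ := GRing.isZmodClosed.Build A ideal ideal_zmod_closed.

Definition proper := 1 \notin ideal.

Lemma ideal_ker (B : nzRingType) (f : {rmorphism A -> B}) :
  (forall x, P x -> f x = 0) -> forall x, x \in ideal -> f x = 0.
Proof.
move=> fP x /asboolP; elim=> [|a y b Py|y z _ IHy _ IHz].
- exact: rmorph0.
- by rewrite !rmorphM (fP y Py) mulr0 mul0r.
- by rewrite rmorphD IHy IHz addr0.
Qed.

Lemma proper_ker (B : nzRingType) (f : {rmorphism A -> B}) :
  (forall x, P x -> f x = 0) -> proper.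
Proof.
move=> fP; apply/negP=> /(ideal_ker fP); rewrite rmorph1 => /eqP.
by rewrite oner_eq0.
Qed.
End TwoSidedIdeal.

(* [algType]s are nontrivial rings, so the quotient takes a proof that the
   ideal generated by [P] is proper. *)
Section QuotientAlgebra.
Variables (k : fieldType) (A : algType k) (P : A -> Prop) (hP : proper P).

Definition quot_alg of proper P : Type := Quotient.quot (ideal P).
Local Notation Q := (quot_alg hP).

HB.instance Definition _ := GRing.Zmodule.on Q.
HB.instance Definition _ : EqQuotient A (Quotient.equiv (ideal P)) Q :=
  EqQuotient.on Q.

Definition quot_pi : A -> Q := locked_with alg_key (fun x : A => \pi_Q x).

Lemma quot_piP x y : reflect (quot_pi x = quot_pi y) (x - y \in ideal P).
Proof. by rewrite /quot_pi unlock Quotient.idealrBE; exact: eqP. Qed.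

Lemma quot_pi_eq x y : P (x - y) -> quot_pi x = quot_pi y.
Proof.
move=> Pxy; apply/quot_piP/asboolP; rewrite -[x - y]mul1r -[1 * _]mulr1.
exact: in_ideal_gen.
Qed.

Lemma quot_pi_repr x : quot_pi (repr x) = x.
Proof. by rewrite /quot_pi unlock; exact: reprK. Qed.

Lemma quot_pi_surj y : exists x, y = quot_pi x.
Proof. by exists (repr y); rewrite quot_pi_repr. Qed.

Lemma quot_repr_pi x : repr (quot_pi x) - x \in ideal P.
Proof. by apply/quot_piP; rewrite quot_pi_repr. Qed.

Definition quot_one : Q := quot_pi 1.
Definition quot_mul : Q -> Q -> Q :=
  locked_with alg_key (fun x y => quot_pi (repr x * repr y)).
Definition quot_scale : k -> Q -> Q :=
  locked_with alg_key (fun c x => quot_pi (c *: repr x)).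

Fact quot_pi_zmod_morphism : zmod_morphism quot_pi.
Proof.
by rewrite /quot_pi unlock; exact: (@pi_is_zmod_morphism _ _ _ (Quotient.quot (ideal P))). Qed.

HB.instance Definition _ :=
  GRing.isZmodMorphism.Build A Q quot_pi quot_pi_zmod_morphism.

Fact quot_piM : {morph quot_pi : x y / x * y >-> quot_mul x y}.
Proof.
move=> x y; rewrite /quot_mul [locked_with _ _]unlock; apply/esym/quot_piP.
set rx := repr _; set ry := repr _.
have -> : rx * ry - x * y = (rx - x) * ry + x * (ry - y).
  by rewrite mulrBl mulrBr addrA subrK.
by apply: rpredD; [apply: idealMr | apply: idealMl]; exact: quot_repr_pi.
Qed.

Fact quot_piZ c : {morph quot_pi : x / c *: x >-> quot_scale c x}.
Proof.
move=> x; rewrite /quot_scale [locked_with _ _]unlock; apply/esym/quot_piP.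
rewrite -scalerBr -[_ - x]mul1r scalerAl.
by apply: idealMl; exact: quot_repr_pi.
Qed.

Fact quot_mulA : associative quot_mul.
Proof.
move=> x y z; rewrite -[x]quot_pi_repr -[y]quot_pi_repr -[z]quot_pi_repr.
by rewrite -!quot_piM mulrA.
Qed.

Fact quot_mul1 : left_id quot_one quot_mul.
Proof. by move=> x; rewrite -[x]quot_pi_repr -quot_piM mul1r. Qed.

Fact quot_mulr1 : right_id quot_one quot_mul.
Proof. by move=> x; rewrite -[x]quot_pi_repr -quot_piM mulr1. Qed.

Fact quot_mulDl : left_distributive quot_mul +%R.
Proof.
move=> x y z; rewrite -[x]quot_pi_repr -[y]quot_pi_repr -[z]quot_pi_repr.
by rewrite -raddfD -!quot_piM -raddfD mulrDl.
Qed.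

Fact quot_mulDr : right_distributive quot_mul +%R.
Proof.
move=> x y z; rewrite -[x]quot_pi_repr -[y]quot_pi_repr -[z]quot_pi_repr.
by rewrite -raddfD -!quot_piM -raddfD mulrDr.
Qed.

Fact quot_one_neq0 : quot_one != 0.
Proof.
apply: contra hP => /eqP; rewrite -(raddf0 quot_pi) => /quot_piP.
by rewrite subr0.
Qed.

HB.instance Definition _ := GRing.Zmodule_isNzRing.Build Q
  quot_mulA quot_mul1 quot_mulr1 quot_mulDl quot_mulDr quot_one_neq0.

Fact quot_pi_monoid_morphism : monoid_morphism quot_pi.
Proof. by split=> //; exact: quot_piM. Qed.

HB.instance Definition _ :=
  GRing.isMonoidMorphism.Build A Q quot_pi quot_pi_monoid_morphism.

Fact quot_scaleA a b (x : Q) :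
  quot_scale a (quot_scale b x) = quot_scale (a * b) x.
Proof. by rewrite -[x]quot_pi_repr -!quot_piZ scalerA. Qed.

Fact quot_scale1 : left_id 1 quot_scale.
Proof. by move=> x; rewrite -[x]quot_pi_repr -quot_piZ scale1r. Qed.

Fact quot_scaleDr : right_distributive quot_scale +%R.
Proof.
move=> c x y; rewrite -[x]quot_pi_repr -[y]quot_pi_repr.
by rewrite -raddfD -!quot_piZ -raddfD scalerDr.
Qed.

Fact quot_scaleDl (x : Q) : {morph quot_scale^~ x : a b / a + b}.
Proof.
by move=> a b; rewrite -[x]quot_pi_repr -!quot_piZ -raddfD scalerDl.
Qed.

HB.instance Definition _ := GRing.Zmodule_isLmodule.Build k Q
  quot_scaleA quot_scale1 quot_scaleDr quot_scaleDl.

HB.instance Definition _ :=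
  GRing.isScalable.Build k A Q *:%R quot_pi quot_piZ.

Fact quot_scalerAl (c : k) (x y : Q) : c *: (x * y) = (c *: x) * y.
Proof.
rewrite -[x]quot_pi_repr -[y]quot_pi_repr -rmorphM -!linearZ.
by rewrite scalerAl rmorphM.
Qed.

HB.instance Definition _ := GRing.Lmodule_isLalgebra.Build k Q quot_scalerAl.

Fact quot_scalerAr (c : k) (x y : Q) : c *: (x * y) = x * (c *: y).
Proof.
rewrite -[x]quot_pi_repr -[y]quot_pi_repr -rmorphM -!linearZ.
by rewrite scalerAr rmorphM.
Qed.

HB.instance Definition _ := GRing.Lalgebra_isAlgebra.Build k Q quot_scalerAr.

Section Lift.
Variables (B : algType k) (f : {lrmorphism A -> B}).

Definition quot_lift of (forall x, P x -> f x = 0) := fun x : Q => f (repr x).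

Hypothesis fP : forall x, P x -> f x = 0.

Lemma quot_lift_pi x : quot_lift fP (quot_pi x) = f x.
Proof.
apply/eqP; rewrite -subr_eq0 -raddfB; apply/eqP.
exact: (ideal_ker fP (quot_repr_pi x)).
Qed.

Fact quot_lift_zmod_morphism : zmod_morphism (quot_lift fP).
Proof.
move=> x y; rewrite -[x]quot_pi_repr -[y]quot_pi_repr -raddfB.
by rewrite !quot_lift_pi raddfB.
Qed.

HB.instance Definition _ :=
  GRing.isZmodMorphism.Build Q B (quot_lift fP) quot_lift_zmod_morphism.

Fact quot_lift_monoid_morphism : monoid_morphism (quot_lift fP).
Proof.
split=> [|x y]; first by rewrite -(rmorph1 quot_pi) quot_lift_pi rmorph1.
rewrite -[x]quot_pi_repr -[y]quot_pi_repr -rmorphM.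
by rewrite !quot_lift_pi rmorphM.
Qed.

HB.instance Definition _ :=
  GRing.isMonoidMorphism.Build Q B (quot_lift fP) quot_lift_monoid_morphism.

Fact quot_lift_scalable : scalable (quot_lift fP).
Proof.
move=> c x; rewrite -[x]quot_pi_repr -linearZ.
by rewrite !quot_lift_pi linearZ.
Qed.

HB.instance Definition _ :=
  GRing.isScalable.Build k Q B *:%R (quot_lift fP) quot_lift_scalable.
End Lift.
End QuotientAlgebra.

Arguments quot_lift {k A P} hP {B f} fP.

Section Subalgebra.
Variables (k : fieldType) (A : algType k).

Record subalgebra (S : subalgClosed A) :=
  Subalgebra { subalg_val : A; subalg_valP : subalg_val \in S }.

Section Instances.
Variable S : subalgClosed A.
HB.instance Definition _ := [isSub for @subalg_val S].
HB.instance Definition _ := [Choice of subalgebra S by <:].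
HB.instance Definition _ := [SubChoice_isSubAlgebra of subalgebra S by <:].

Fact subalg_val_zmod_morphism : zmod_morphism (@subalg_val S).
Proof. by []. Qed.
Fact subalg_val_monoid_morphism : monoid_morphism (@subalg_val S).
Proof. by []. Qed.
Fact subalg_val_scalable : scalable (@subalg_val S).
Proof. by []. Qed.

HB.instance Definition _ := GRing.isZmodMorphism.Build (subalgebra S) A
  (@subalg_val S) subalg_val_zmod_morphism.
HB.instance Definition _ := GRing.isMonoidMorphism.Build (subalgebra S) A
  (@subalg_val S) subalg_val_monoid_morphism.
HB.instance Definition _ := GRing.isScalable.Build k (subalgebra S) A *:%R
  (@subalg_val S) subalg_val_scalable.
End Instances.

Section Generated.
Variable P : A -> Prop.

Inductive in_gen : A -> Prop :=
| in_gen_gen x : P x -> in_gen x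
| in_gen1 : in_gen 1
| in_genM x y : in_gen x -> in_gen y -> in_gen (x * y)
| in_gen_lin c x y : in_gen x -> in_gen y -> in_gen (c *: x + y).

Definition gen_subalg : {pred A} := fun x => `[< in_gen x >].

Fact gen_subalg_closed : GRing.subsemialg_closed gen_subalg.
Proof.
have gen0 : in_gen 0.
  by rewrite -(addNr 1) -scaleN1r; apply: in_gen_lin; exact: in_gen1.
split.
- exact/asboolP/in_gen1.
- split=> [|x y /asboolP xP /asboolP yP]; apply/asboolP=> //.
  by rewrite -[x]scale1r; exact: in_gen_lin.
- move=> c x /asboolP xP; apply/asboolP; rewrite -[_ *: _]addr0.
  exact: in_gen_lin.
- by move=> x y /asboolP xP /asboolP yP; exact/asboolP/in_genM.
Qed.

HB.instance Definition _ :=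
  GRing.isSubalgClosed.Build k A gen_subalg gen_subalg_closed.
End Generated.

(* The grading of [A] determined by homogeneous generators: [gens d x] says
   that [x] is one of the chosen generators of degree [d], and [in_degree d] is
   the span of the words of total degree [d] in the generators. *)
Section Grading.
Variable gens : int -> A -> Prop.

Inductive in_degree : int -> A -> Prop :=
| in_degree_gen d x : gens d x -> in_degree d x
| in_degree0 d : in_degree d 0
| in_degree1 : in_degree 0 1
| in_degreeM d e x y : in_degree d x -> in_degree e y -> in_degree (d + e) (x * y)
| in_degree_lin d c x y :
    in_degree d x -> in_degree d y -> in_degree d (c *: x + y).

Definition degree0 : {pred A} := fun x => `[< in_degree 0 x >].

Fact degree0_closed : GRing.subsemialg_closed degree0.
Proof.
split.
- exact/asboolP/in_degree1.
- split=> [|x y /asboolP xP /asboolP yP]; apply/asboolP.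
    exact: in_degree0.
  by rewrite -[x]scale1r; exact: in_degree_lin.
- move=> c x /asboolP xP; apply/asboolP; rewrite -[_ *: _]addr0.
  by apply: in_degree_lin => //; exact: in_degree0.
- move=> x y /asboolP xP /asboolP yP; apply/asboolP; rewrite -[0]addr0.
  exact: in_degreeM.
Qed.

HB.instance Definition _ :=
  GRing.isSubalgClosed.Build k A degree0 degree0_closed.
End Grading.
End Subalgebra.

(* [A[g^-1]], obtained from [A] by adjoining a two-sided inverse of [g]. The
   free generators are the elements of [A] ([Some a]) together with the formal
   inverse ([None]); the relations say that [Some] is a morphism of algebras
   and that [None] is inverse to [Some g]. If [g] is normal and regular this is
   the Ore localization of [A] at the powers of [g]. *)
Section Localization.
Variables (k : fieldType) (A : algType k) (g : A).

Definition loc_gen : choiceType := option A.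

Local Notation F := (free_alg k loc_gen).
Local Notation var a := (free_var k (Some a : loc_gen)).
Local Notation inv := (free_var k (None : loc_gen)).

Inductive loc_rel : F -> Prop :=
| loc_rel_lin c a b : loc_rel (var (c *: a + b) - (c *: var a + var b))
| loc_rel1 : loc_rel (var 1 - 1)
| loc_relM a b : loc_rel (var (a * b) - var a * var b)
| loc_relV : loc_rel (var g * inv - 1)
| loc_relVl : loc_rel (inv * var g - 1).

Section Eval.
Variables (B : algType k) (f : {lrmorphism A -> B}) (h : B).
Hypotheses (fgh : f g * h = 1) (hfg : h * f g = 1).

Definition loc_free_eval : F -> B :=
  free_eval (fun o : loc_gen => if o is Some a then f a else h).

HB.instance Definition _ := GRing.LRMorphism.on loc_free_eval.

Lemma loc_free_eval_rel x : loc_rel x -> loc_free_eval x = 0.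
Proof.
have var a' : loc_free_eval (var a') = f a' by exact: free_eval_var.
have inv : loc_free_eval inv = h by exact: free_eval_var.
case=> [c a b||a b||]; rewrite linearB /=; apply/eqP; rewrite subr_eq0; apply/eqP.
- by rewrite [RHS]linearP /= !var linearP.
- by rewrite var !rmorph1.
- by rewrite [RHS]rmorphM /= !var rmorphM.
- by rewrite [LHS]rmorphM rmorph1 /= var inv.
- by rewrite [LHS]rmorphM rmorph1 /= var inv.
Qed.

Lemma loc_rel_proper : proper loc_rel.
Proof. exact: proper_ker loc_free_eval_rel. Qed.
End Eval.

Variable hP : proper loc_rel.

Definition loc_alg : Type := quot_alg hP.

HB.instance Definition _ := GRing.Algebra.on loc_alg.

Definition loc_in (a : A) : loc_alg := quot_pi hP (var a).
Definition loc_inv : loc_alg := quot_pi hP inv.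

Fact loc_in_linear : linear loc_in.
Proof.
move=> c a b; apply: etrans (quot_pi_eq hP (loc_rel_lin c a b)) _.
exact: linearP (quot_pi hP) c _ _.
Qed.

Fact loc_in_monoid_morphism : monoid_morphism loc_in.
Proof.
split=> [|a b].
  exact: etrans (quot_pi_eq hP loc_rel1) (rmorph1 (quot_pi hP)).
exact: etrans (quot_pi_eq hP (loc_relM a b)) (rmorphM (quot_pi hP) _ _).
Qed.

HB.instance Definition _ :=
  GRing.isLinear.Build k A loc_alg *:%R loc_in loc_in_linear.
HB.instance Definition _ :=
  GRing.isMonoidMorphism.Build A loc_alg loc_in loc_in_monoid_morphism.

Lemma loc_inVr : loc_in g * loc_inv = 1.
Proof.
apply: etrans (esym (rmorphM (quot_pi hP) _ _)) _.
exact: etrans (quot_pi_eq hP loc_relV) (rmorph1 (quot_pi hP)).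
Qed.

Lemma loc_inVl : loc_inv * loc_in g = 1.
Proof.
apply: etrans (esym (rmorphM (quot_pi hP) _ _)) _.
exact: etrans (quot_pi_eq hP loc_relVl) (rmorph1 (quot_pi hP)).
Qed.
End Localization.

Section QuantumMatrices.
Variables (k : fieldType) (p : k) (a b : nat).

Definition qmx_gen : choiceType := ('I_a * 'I_b)%type.

Local Notation x i j := (free_var k ((i, j) : qmx_gen)).

Inductive qmx_rel : free_alg k qmx_gen -> Prop :=
| qmx_rel_row (i : 'I_a) (j l : 'I_b) : (j < l)%N ->
    qmx_rel (x i j * x i l - p *: (x i l * x i j))
| qmx_rel_col (i r : 'I_a) (j : 'I_b) : (i < r)%N ->
    qmx_rel (x i j * x r j - p *: (x r j * x i j))
| qmx_rel_anti (i r : 'I_a) (j l : 'I_b) : (r < i)%N -> (j < l)%N ->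
    qmx_rel (x i j * x r l - x r l * x i j)
| qmx_rel_diag (i r : 'I_a) (j l : 'I_b) : (i < r)%N -> (j < l)%N ->
    qmx_rel (x i j * x r l - x r l * x i j - (p - p^-1) *: (x i l * x r j)).

Section Eval.
Variable t : 'I_a -> 'I_b -> k.

Definition qmx_free_eval : free_alg k qmx_gen -> k^o :=
  free_eval (fun ij : qmx_gen => t ij.1 ij.2 : k^o).

HB.instance Definition _ := GRing.LRMorphism.on qmx_free_eval.

Hypothesis t_row : forall i (j l : 'I_b), (j < l)%N -> t i j * t i l = 0.
Hypothesis t_col : forall (i r : 'I_a) j, (i < r)%N -> t i j * t r j = 0.
Hypothesis t_diag : forall (i r : 'I_a) (j l : 'I_b),
  (i < r)%N -> (j < l)%N -> t i l * t r j = 0.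

Let evM i j r l : qmx_free_eval (x i j * x r l) = t i j * t r l.
Proof. by rewrite /qmx_free_eval rmorphM /= !free_eval_var. Qed.

Lemma qmx_free_eval_rel y : qmx_rel y -> qmx_free_eval y = 0.
Proof.
case=> [i j l jl|i r j ir|i r j l ri jl|i r j l ir jl].
- rewrite linearB linearZ /= !evM [t i l * _]mulrC t_row //.
  by rewrite scaler0 subr0.
- rewrite linearB linearZ /= !evM [t r j * _]mulrC t_col //.
  by rewrite scaler0 subr0.
- by rewrite linearB /= !evM [X in X - _]mulrC subrr.
- rewrite !linearB linearZ /= !evM [X in X - _ - _]mulrC subrr t_diag //.
  by rewrite scaler0 subr0.
Qed.
End Eval.

Fact qmx_proper : proper qmx_rel.
Proof.
apply: (proper_ker (@qmx_free_eval_rel (fun _ _ => 0) _ _ _)) => *;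
  exact: mul0r.
Qed.

Definition qmx : algType k := quot_alg qmx_proper.

Definition qmx_x (i : 'I_a) (j : 'I_b) : qmx := quot_pi qmx_proper (x i j).

Definition is_partition (lam : 'I_a -> nat) : Prop :=
  (forall i, lam i <= b)%N /\ {homo lam : i i' / (i <= i')%N >-> (i' <= i)%N}.

(* Columns are numbered from 0, so [j <= lambda_i] reads [j < lam i]. *)
Definition partition_subalg (lam : 'I_a -> nat) : algType k :=
  subalgebra (gen_subalg
    (fun y : qmx => exists (i : 'I_a) (j : 'I_b), (j < lam i)%N /\ y = qmx_x i j)).
End QuantumMatrices.

Definition Pi (m n : nat) : Type := {I : {set 'I_n} | #|I| == m}.

HB.instance Definition _ m n := Finite.on (Pi m n).

(* [elt I 0 < ... < elt I (m - 1)] are the elements of [I]. *)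
Definition elt m n (I : Pi m n) (s : 'I_m) : 'I_n :=
  enum_val (cast_ord (esym (eqP (valP I))) s).

Definition st_le m n (I J : Pi m n) : bool := [forall s, elt I s <= elt J s]%N.

Definition perm_length m (s : 'S_m) : nat :=
  #|[set ij : 'I_m * 'I_m | (ij.1 < ij.2)%N && (s ij.2 < s ij.1)%N]|.

Section Elt.
Variables m n : nat.
Implicit Types I J : Pi m n.

Lemma elt_inj I : injective (elt I).
Proof. by move=> r s /enum_val_inj /cast_ord_inj. Qed.

Lemma elt_ltn I (r s : 'I_m) : (r < s)%N -> (elt I r < elt I s)%N.
Proof.
pose lt := relpre (@nat_of_ord n) ltn.
have lt_trans : transitive lt by move=> i j l; exact: ltn_trans.
have I_sorted : sorted lt (enum (val I)).
  rewrite {1}/enum_mem sorted_filter //.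
  by rewrite -enumT -sorted_map val_enum_ord iota_ltn_sorted.
move=> rs; rewrite /elt !(enum_val_nth (elt I r)) /=.
by apply: (sorted_ltn_nth lt_trans); rewrite ?inE -?cardE ?(eqP (valP I)).
Qed.

Lemma mem_elt I r : elt I r \in val I.
Proof. exact: enum_valP. Qed.

Lemma eltP I x : x \in val I -> exists r, x = elt I r.
Proof.
move=> xI; exists (cast_ord (eqP (valP I)) (enum_rank_in xI x)).
by rewrite /elt cast_ordK enum_rankK_in.
Qed.

Lemma st_le_refl I : st_le I I.
Proof. exact/forallP. Qed.

Lemma perm_length1 : perm_length (1%g : 'S_m) = 0%N.
Proof.
apply/eqP; rewrite cards_eq0; apply/eqP/setP=> -[i j]; rewrite !inE !perm1 /=.
by apply/negP=> /andP[ij ji]; have := ltn_trans ij ji; rewrite ltnn.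
Qed.
End Elt.

Section QuantumGrassmannian.
Variables (k : fieldType) (q : k) (m n : nat).

Definition qminor (I : Pi m n) : qmx q m n :=
  \sum_(s : 'S_m) (- q) ^+ perm_length s *:
    \prod_(r < m) qmx_x q (s r) (elt I r).

Definition is_qminor (y : qmx q m n) : Prop := exists I, y = qminor I.

Definition qgrass : algType k := subalgebra (gen_subalg is_qminor).

Fact qminor_in_gen I : qminor I \in gen_subalg is_qminor.
Proof. by apply/asboolP/in_gen_gen; exists I. Qed.

Definition plucker (I : Pi m n) : qgrass := Subalgebra (qminor_in_gen I).

Variable gamma : Pi m n.

Definition schubert_rel (y : qgrass) : Prop :=
  exists2 alpha, ~~ st_le gamma alpha & y = plucker alpha.

(* The point of the grassmannian at which [gamma] takes the value 1 and all
   other maximal minors vanish; it shows that [gamma] is invertible in a nonzero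
   quotient of [S(gamma)]. *)
Section Point.
Let t (i : 'I_m) (j : 'I_n) : k := (elt gamma i == j)%:R.

Fact point_row i (j l : 'I_n) : (j < l)%N -> t i j * t i l = 0.
Proof.
rewrite /t; case: eqP => [<-|_]; last by rewrite mul0r.
by case: eqP => [<-|_]; [rewrite ltnn | rewrite mulr0].
Qed.

Fact point_col (i r : 'I_m) j : (i < r)%N -> t i j * t r j = 0.
Proof.
rewrite /t; case: eqP => [<-|_]; last by rewrite mul0r.
by case: eqP => [/elt_inj->|_]; [rewrite ltnn | rewrite mulr0].
Qed.

Fact point_diag (i r : 'I_m) (j l : 'I_n) :
  (i < r)%N -> (j < l)%N -> t i l * t r j = 0.
Proof.
move=> ir jl; rewrite /t; case: eqP => [il|_]; last by rewrite mul0r.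
case: eqP => [rj|_]; last by rewrite mulr0.
by have := ltn_trans jl; rewrite -il -rj => /(_ _ (elt_ltn gamma ir)); rewrite ltnn.
Qed.

Definition qmx_point : qmx q m n -> k^o :=
  quot_lift (qmx_proper q m n) (qmx_free_eval_rel point_row point_col point_diag).

HB.instance Definition _ := GRing.LRMorphism.on qmx_point.

Fact qmx_point_x i j : qmx_point (qmx_x q i j) = t i j.
Proof. by rewrite /qmx_point /qmx_x quot_lift_pi; exact: free_eval_var. Qed.

Fact qmx_point_qminor I : qmx_point (qminor I) = (I == gamma)%:R.
Proof.
rewrite /qminor linear_sum /=.
under eq_bigr => s _.
  rewrite linearZ rmorph_prod /=.
  under eq_bigr => r _ do rewrite qmx_point_x.
  over.
have [->|neq] := eqVneq.
  rewrite (bigD1 (1%g : 'S_m)) //= perm_length1 expr0 scale1r big1 => [|r _].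
    rewrite big1 ?addr0 // => s s1.
    have [r sr] : exists r, s r != r.
      apply/existsP; apply: contraR s1 => /existsPn H; apply/eqP/permP => r.
      by rewrite perm1; apply/eqP; have := H r; rewrite negbK.
    rewrite (bigD1 r) //= /t (inj_eq (@elt_inj _ _ gamma)) (negbTE sr) mul0r.
    exact: scaler0.
  by rewrite /t perm1 eqxx.
rewrite big1 // => s _; case: (pselect (exists r, t (s r) (elt I r) = 0)).
  by case=> r tr; rewrite (bigD1 r) //= tr mul0r; exact: scaler0.
move=> H; case/negP: neq; apply/eqP/val_inj/eqP.
rewrite eqEcard (eqP (valP I)) (eqP (valP gamma)) leqnn andbT.
apply/subsetP => x /eltP[r ->].
have [<-|ne] := eqVneq (elt gamma (s r)) (elt I r); first exact: mem_elt.
by case: H; exists r; rewrite /t (negbTE ne).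
Qed.

Definition qgrass_point : qgrass -> k^o := qmx_point \o @subalg_val _ _ _.

HB.instance Definition _ := GRing.LRMorphism.on qgrass_point.

Fact qgrass_point_plucker I : qgrass_point (plucker I) = (I == gamma)%:R.
Proof. exact: qmx_point_qminor. Qed.

Fact qgrass_point_rel y : schubert_rel y -> qgrass_point y = 0.
Proof.
case=> alpha ngt ->; rewrite qgrass_point_plucker.
by case: eqP ngt => // ->; rewrite st_le_refl.
Qed.

Fact schubert_proper : proper schubert_rel.
Proof. exact: proper_ker qgrass_point_rel. Qed.
End Point.

Definition schubert : algType k := quot_alg schubert_proper.

Definition schubert_plucker (I : Pi m n) : schubert :=
  quot_pi schubert_proper (plucker I).

Local Notation gbar := (schubert_plucker gamma).

Fact schubert_loc_proper : proper (loc_rel gbar).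
Proof.
pose f := quot_lift schubert_proper qgrass_point_rel.
have f1 : f gbar = 1.
  rewrite /f /schubert_plucker quot_lift_pi; apply: etrans (qgrass_point_plucker _) _.
  by rewrite eqxx.
exact: (@loc_rel_proper _ _ _ k^o f 1 (etrans (mulr1 _) f1)
  (etrans (mul1r _) f1)).
Qed.

Definition schubert_loc : algType k := loc_alg schubert_loc_proper.

Definition schubert_gens (d : int) (x : schubert) : Prop :=
  d = 1 /\ exists I, x = schubert_plucker I.

Definition schubert_loc_gens (d : int) (y : schubert_loc) : Prop :=
  (exists2 x, in_degree schubert_gens d x & y = loc_in schubert_loc_proper x)
  \/ (d = -1 /\ y = loc_inv schubert_loc_proper).

Definition schubert_cell : algType k :=
  subalgebra (degree0 schubert_loc_gens).
End QuantumGrassmannian.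

(* Main.v *)
(** The cell is compared with the algebra generated by boxes of a Young diagram
    through words in the generators.

    The quantum Pluecker relations [sum_c (-q)^* [J + c] [K - c] = 0] (for
    [#|J| = m - 1] and [#|K| = m + 1]) follow from the expansion of a quantum
    minor with a repeated row.  They suffice to compute in the localization of
    the Schubert variety: [gamma] q-commutes with every Pluecker coordinate, the
    cell is generated by the elements [gamma - c + a] gamma^-1 with [c] in
    [gamma], [a] not in [gamma] and [c < a], and these elements satisfy the
    relations of quantum matrices with parameter [q^-1], the free columns [a]
    being numbered in decreasing order.  Hence both algebras are spanned by the
    sorted words in their generators, and it remains to see that sorted words
    are linearly independent in both.

    To this end, a quantum echelon matrix with pivots in the columns [gamma] is
    built row by row in a quantum torus; the minors [alpha] which are not above
    [gamma] vanish on it.  Its reduced echelon form consists, up to nonzero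
    scalars, of the values of the generators of the cell, and is given by an
    explicit recursion, from which one reads off leading exponents that are
    linearly independent.  For [gamma = {1, ..., m}] the same torus represents
    the whole algebra of quantum matrices. *)

Require Import Defs.
From HB Require Import structures.
From mathcomp Require Import all_boot all_order all_algebra.
From mathcomp Require Import perm boolp.
From mathcomp Require Import ring zify.
Set Implicit Arguments.
Unset Strict Implicit.
Unset Printing Implicit Defensive.
Import Order.TTheory GRing.Theory Num.Theory.
Local Open Scope ring_scope.

(** The presentation of the localized Schubert variety does not show any element to be nonzero, and
    straightening bounds its size only from above. The lower bound has to come from a representation
    in which the cell generators can be computed: entries of the quantum echelon matrix are sums of
    many torus monomials, but those of its reduced form obey a recursion in which one monomial
    dominates for a suitable weight, and a quantum Cramer rule identifies them with the cell
    generators up to scalars. That [q] is not a root of unity enters through divisions: by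
    q^2-integers when row and column expansions of a minor are compared, and by [q ^+ 2 + 1] when
    the three-term relations on four columns are solved. Neither the cell nor the partition
    subalgebra is given by a presentation, so the isomorphism is not defined on generators. It is
    obtained as a subalgebra of the product of the two ambient algebras, generated by the pairs of
    corresponding generators: straightening is done once, in the product, and independence on each
    side makes this subalgebra the graph of a bijection. *)

Section LinearExpressions.
Variables (k : fieldType) (V : lmodType k).

(** Reflection for identities in a noncommutative algebra: products are opaque atoms, so an identity
    reduces to one scalar equation per atom, which [ring] or [field] settles in [k]. *)
Inductive linexp :=
| LinAtom of nat
| LinZero
| LinOpp of linexp
| LinAdd of linexp & linexp
| LinScale of k & linexp.

Fixpoint lin_eval (env : seq V) e : V :=
  match e with
  | LinAtom i => env`_i
  | LinZero => 0
  | LinOpp e => - lin_eval env e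
  | LinAdd e f => lin_eval env e + lin_eval env f
  | LinScale c e => c *: lin_eval env e
  end.

Fixpoint lin_coef (i : nat) e : k :=
  match e with
  | LinAtom j => if eqn j i then 1 else 0
  | LinZero => 0
  | LinOpp e => - lin_coef i e
  | LinAdd e f => lin_coef i e + lin_coef i f
  | LinScale c e => c * lin_coef i e
  end.

Lemma lin_eval_coef env e : lin_eval env e = \sum_(i < size env) lin_coef i e *: env`_i.
Proof.
elim: e => /= [j||e ->|e -> f ->|c e ->].
- have [js|sj] := ltnP j (size env); last first.
    rewrite nth_default // big1 // => i _; case: ifP => [/eqnP ji|]; last by rewrite scale0r.
    by have := ltn_ord i; rewrite -ji ltnNge sj.
  rewrite (bigD1 (Ordinal js)) //= big1 ?addr0 => [|i].
    by rewrite (introT eqnP (erefl j)) scale1r.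
  by rewrite -val_eqE /= eq_sym => /negbTE ji; rewrite [eqn j i]ji scale0r.
- by rewrite big1 // => i _; rewrite scale0r.
- by rewrite -sumrN; apply: eq_bigr => i _; rewrite scaleNr.
- by rewrite -big_split; apply: eq_bigr => i _; rewrite scalerDl.
- by rewrite scaler_sumr; apply: eq_bigr => i _; rewrite scalerA.
Qed.

(** A recursion instead of a quantifier over indices, so that [cbn] unfolds it into an explicit
    conjunction. *)
Fixpoint lin_eqs (n : nat) e f : Prop :=
  if n is n'.+1 then lin_coef n' e = lin_coef n' f /\ lin_eqs n' e f else True.

Lemma lin_evalP env e f : lin_eqs (size env) e f -> lin_eval env e = lin_eval env f.
Proof.
move=> ef; rewrite !lin_eval_coef; apply: eq_bigr => i _; congr (_ *: _).
elim: (size env) ef (val i) (ltn_ord i) => // l IHl [efl efs] j.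
by rewrite ltnS leq_eqVlt => /predU1P[->|/(IHl efs)].
Qed.
End LinearExpressions.

(* Atoms are compared up to conversion: the same product may occur with several
   inferred ring structures. *)
Ltac lin_mem x env :=
  lazymatch env with
  | nil => constr:(false)
  | ?y :: ?env' =>
      match constr:(Set) with
      | _ => let _ := match constr:(Set) with _ => unify x y end in constr:(true)
      | _ => lin_mem x env'
      end
  end.

Ltac lin_atoms e env :=
  lazymatch e with
  | 0%R => env
  | (- ?a)%R => lin_atoms a env
  | (?a + ?b)%R => let env' := lin_atoms a env in lin_atoms b env'
  | (?c *: ?a)%R => lin_atoms a env
  | _ => let b := lin_mem e env in
         lazymatch b with true => env | false => constr:(e :: env) end
  end.

Ltac lin_index x env :=
  lazymatch env with
  | ?y :: ?env' =>
      match constr:(Set) with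
      | _ => let _ := match constr:(Set) with _ => unify x y end in constr:(0%N)
      | _ => let i := lin_index x env' in constr:(i.+1)
      end
  end.

Ltac lin_quote k e env :=
  lazymatch e with
  | 0%R => constr:(@LinZero k)
  | (- ?a)%R => let a' := lin_quote k a env in constr:(@LinOpp k a')
  | (?a + ?b)%R =>
      let a' := lin_quote k a env in let b' := lin_quote k b env in
      constr:(@LinAdd k a' b')
  | (?c *: ?a)%R => let a' := lin_quote k a env in constr:(@LinScale k c a')
  | _ => let i := lin_index e env in constr:(@LinAtom k i)
  end.

(* Proves an identity between linear combinations over [k], up to one goal per
   atom: the equality of its coefficients. *)
Ltac lin_coefs k :=
  lazymatch goal with
  | |- @eq ?T ?a ?b =>
      let env := lin_atoms a (@nil T) in
      let env := lin_atoms b env in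
      let e := lin_quote k a env in
      let f := lin_quote k b env in
      apply: (@lin_evalP k _ env e f);
      cbn [lin_eqs lin_coef size eqn]; repeat split
  end.

(** * Quantum minors and Pluecker relations *)

(** The exponent of [- q] in an expansion. Its last argument is any natural number, so that
    [rk T c.+1] and [rk T n] make sense in the telescoping sum of [sum_rk_geometric]. *)
Definition rk n (S : {set 'I_n}) (i : nat) : nat := (\sum_(r in S) (r < i))%N.

Definition rk_gt n (S : {set 'I_n}) (i : nat) : nat := (\sum_(r in S) (i < r))%N.

Lemma rk_setD1_lt n (S : {set 'I_n}) (i : 'I_n) (r : nat) :
  i \in S -> (i < r)%N -> rk S r = (rk (S :\ i) r).+1.
Proof.
by move=> iS ir; rewrite /rk (big_setD1 i iS) /= ir.
Qed.

Lemma rk_setD1_ge n (S : {set 'I_n}) (i : 'I_n) (r : nat) :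
  (r <= i)%N -> rk (S :\ i) r = rk S r.
Proof.
move=> ri; have [iS|iS] := boolP (i \in S); last by rewrite (setDidPl _) // disjoint_sym disjoints1.
by rewrite /rk [RHS](big_setD1 i iS) /= ltnNge ri.
Qed.

Lemma rk_setU1 n (S : {set 'I_n}) (i : 'I_n) (r : nat) :
  i \notin S -> rk (i |: S) r = ((i < r) + rk S r)%N.
Proof. by move=> iS; rewrite /rk big_setU1. Qed.

(** Brings together the terms of (i, r) and (r, i), which form a quantum 2 by 2 minor in a double
    expansion. *)
Lemma sum_pairs n (V : nmodType) (S : {set 'I_n}) (F : 'I_n -> 'I_n -> V) :
  \sum_(i in S) \sum_(r in S :\ i) F i r =
  \sum_(i in S) \sum_(r in S | (i < r)%N) (F i r + F r i).
Proof.
under [RHS]eq_bigr => i iS do rewrite big_split /=.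
rewrite big_split /= [X in _ + X](exchange_big_dep (mem S)) /=; last first.
  by move=> i r _ /andP[].
rewrite -big_split /=; apply: eq_bigr => i iS.
rewrite (bigID (fun r : 'I_n => (i < r)%N)) /=; congr (_ + _); apply: eq_bigl => r.
  by rewrite !inE; case: eqVneq => [->|]; rewrite ?ltnn ?andbF.
rewrite !inE -leqNgt iS [in RHS]ltn_neqAle -(inj_eq val_inj) /=.
by case: (_ == _); case: (r \in S); case: (_ <= _)%N.
Qed.

Lemma enum_set_sorted n (T : {set 'I_n}) : sorted (relpre (@nat_of_ord n) ltn) (enum T).
Proof.
have lt_trans : transitive (relpre (@nat_of_ord n) ltn) by move=> i j l; exact: ltn_trans.
rewrite {1}/enum_mem sorted_filter //.
by rewrite -enumT -sorted_map val_enum_ord iota_ltn_sorted.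
Qed.

Lemma mem_filter_enum n (T : {set 'I_n}) (a : pred 'I_n) i :
  (i \in [seq r <- enum T | a r]) = a i && (i \in T).
Proof. by rewrite mem_filter mem_enum. Qed.

Lemma enum_setU1 n (T : {set 'I_n}) (c : 'I_n) : c \notin T ->
  enum (c |: T) = [seq r : 'I_n <- enum T | (r < c)%N] ++ c :: [seq r : 'I_n <- enum T | (c < r)%N].
Proof.
move=> cT; have lt_trans : transitive (relpre (@nat_of_ord n) ltn).
  by move=> i j l; exact: ltn_trans.
apply: (irr_sorted_eq lt_trans); first by move=> i /=; rewrite ltnn.
- exact: enum_set_sorted.
- have := enum_set_sorted T; rewrite !sorted_pairwise // pairwise_cat /= => sT.
  apply/and4P; split; try exact: pairwise_filter.
  + apply/allrelP => i j; rewrite mem_filter_enum in_cons => /andP[ic _] /predU1P[->//|].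
    by rewrite mem_filter_enum => /andP[cj _]; exact: ltn_trans cj.
  + by apply/allP => i; rewrite mem_filter_enum => /andP[].
- move=> i; rewrite mem_enum mem_cat in_cons !mem_filter_enum !inE.
  have [->|ic] := eqVneq i c; first by rewrite (negbTE cT) !andbF.
  by rewrite -andb_orl -neq_ltn (inj_eq val_inj) ic.
Qed.

Lemma enum_setI n (T : {set 'I_n}) (c : 'I_n) : c \notin T ->
  enum T = [seq r : 'I_n <- enum T | (r < c)%N] ++ [seq r : 'I_n <- enum T | (c < r)%N].
Proof.
move=> cT; have := enum_setU1 cT; set s1 := filter _ _; set s2 := filter _ _ => E.
have lt_trans : transitive (relpre (@nat_of_ord n) ltn).
  by move=> i j l; exact: ltn_trans.
apply: (irr_sorted_eq lt_trans); first by move=> i /=; rewrite ltnn.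
- exact: enum_set_sorted.
- apply: (subseq_sorted lt_trans _ (enum_set_sorted (c |: T))).
  by rewrite E cat_subseq // subseq_cons.
- move=> i; rewrite mem_enum mem_cat !mem_filter_enum -andb_orl -neq_ltn (inj_eq val_inj).
  by case: eqVneq => //= ->; apply/negbTE.
Qed.

Lemma size_rk n (T : {set 'I_n}) (c : nat) : size [seq r : 'I_n <- enum T | (r < c)%N] = rk T c.
Proof.
rewrite size_filter -sum1_count big_mkcond big_enum /=.
by apply: eq_bigr => r _; case: (r < c)%N.
Qed.

Lemma size_rk_gt n (T : {set 'I_n}) (c : nat) : size [seq r : 'I_n <- enum T | (c < r)%N] = rk_gt T c.
Proof.
rewrite size_filter -sum1_count big_mkcond big_enum /=.
by apply: eq_bigr => r _; case: (c < r)%N.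
Qed.

(** On [T] the rank takes the values 0, ..., #|T| - 1 once each, so the sum is geometric. The proof
    telescopes over all columns: the rank grows by one exactly when an element of [T] is passed. *)
Lemma sum_rk_geometric (R : comPzRingType) n (T : {set 'I_n}) (x : R) :
  (x - 1) * \sum_(c in T) x ^+ rk T c = x ^+ #|T| - 1.
Proof.
have rkS (c : 'I_n) : rk T c.+1 = ((c \in T) + rk T c)%N.
  have [cT|cT] := boolP (c \in T).
    rewrite /rk !(big_setD1 c cT) /= ltnS leqnn ltnn !add1n add0n; congr _.+1.
    apply: eq_bigr => r; rewrite !inE => /andP[rc _].
    by rewrite ltnS leq_eqVlt val_eqE (negbTE rc).
  apply: eq_bigr => r rT; rewrite ltnS leq_eqVlt val_eqE; case: eqVneq => // rc.
  by rewrite -rc rT in cT.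
transitivity (\sum_(0 <= c < n) (x ^+ rk T c.+1 - x ^+ rk T c)).
  rewrite big_mkord mulr_sumr big_mkcond /=; apply: eq_bigr => c _.
  by rewrite rkS; case: ifP => _; rewrite ?subrr // exprS mulrBl mul1r.
have -> : #|T| = rk T n by rewrite /rk -sum1_card; apply: eq_bigr => r _; rewrite ltn_ord.
by rewrite telescope_sumr // -[1](expr0 x); congr (_ - x ^+ _); rewrite /rk big1.
Qed.

(** * Quantum determinants for arbitrary sequences of columns *)

Section QMatrix.
Variables (k : fieldType) (A : algType k) (q : k).

Definition qmatrix m n (X : 'I_m -> 'I_n -> A) : Prop :=
  [/\ forall i (j l : 'I_n), (j < l)%N -> X i j * X i l = q *: (X i l * X i j),
      forall (i r : 'I_m) j, (i < r)%N -> X i j * X r j = q *: (X r j * X i j),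
      forall (i r : 'I_m) (j l : 'I_n), (i < r)%N -> (j < l)%N ->
        X i l * X r j = X r j * X i l &
      forall (i r : 'I_m) (j l : 'I_n), (i < r)%N -> (j < l)%N ->
        X i j * X r l = X r l * X i j + (q - q^-1) *: (X i l * X r j)].

Lemma qmatrix_trans m n (X : 'I_m -> 'I_n -> A) :
  qmatrix X -> qmatrix (fun j i => X i j).
Proof.
case=> Xr Xc Xa Xd; split=> [i j l jl|i r j ir|i r j l ir jl|i r j l ir jl].
- exact: Xc.
- exact: Xr.
- exact/esym/Xa.
- by rewrite Xd // (Xa j l).
Qed.

(** Expansion along the first listed column. The columns form a sequence and not a set, so that
    permuted and repeated columns make sense and q-alternation can be stated. *)
Fixpoint coldet m n (X : 'I_m -> 'I_n -> A) (S : {set 'I_m}) (cs : seq 'I_n) : A :=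
  if cs is c :: cs' then
    \sum_(i in S) (- q) ^+ rk S i *: (X i c * coldet X (S :\ i) cs')
  else 1.

Section ColDet.
Hypothesis q0 : q != 0.
Variables (m n : nat) (X : 'I_m -> 'I_n -> A).
Hypothesis XP : qmatrix X.
Implicit Types (S : {set 'I_m}) (cs : seq 'I_n).

(** For [i < r], deleting [i] lowers the rank of [r] by one, while deleting [r] does not affect that
    of [i]. Choosing the two rows in the opposite order thus costs one factor [- q], and a 2 by 2
    minor appears. *)
Lemma coldet2 S c c' cs :
  coldet X S [:: c, c' & cs] = \sum_(i in S) \sum_(r in S | (i < r)%N)
    (- q) ^+ (rk S i + rk (S :\ i) r) *:
       ((X i c * X r c' - q *: (X r c * X i c')) * coldet X (S :\ i :\ r) cs).
Proof.
pose F (i r : 'I_m) := (- q) ^+ (rk S i + rk (S :\ i) r) *: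
  (X i c * X r c' * coldet X (S :\ i :\ r) cs).
transitivity (\sum_(i in S) \sum_(r in S :\ i) F i r).
  apply: eq_bigr => i iS /=; rewrite mulr_sumr scaler_sumr; apply: eq_bigr => r rS.
  by rewrite /F -scalerAr scalerA exprD mulrA.
rewrite sum_pairs; apply: eq_bigr => i iS; apply: eq_bigr => r /andP[rS ir].
rewrite /F (setDDl S [set r] [set i]) setUC -setDDl mulrBl scalerBr -scalerAl scalerA.
congr (_ + _); rewrite (@rk_setD1_ge _ _ r i) 1?ltnW // (@rk_setD1_lt _ _ i r) //.
by rewrite addSn addnC exprSr mulrN scaleNr.
Qed.

Lemma coldet_swap S (c c' : 'I_n) cs : (c < c')%N ->
  coldet X S [:: c', c & cs] = (- q) *: coldet X S [:: c, c' & cs].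
Proof.
case: XP => Xr Xc Xa Xd cc'; rewrite !coldet2 scaler_sumr.
apply: eq_bigr => i iS; rewrite scaler_sumr; apply: eq_bigr => r /andP[rS ir].
rewrite scalerA mulrC -scalerA; congr (_ *: _). rewrite [RHS]scalerAl; congr (_ * _).
rewrite (Xd i r c c') // (Xa i r c c') //.
by lin_coefs k; field.
Qed.
Lemma coldet_eq S (c : 'I_n) cs : coldet X S [:: c, c & cs] = 0.
Proof.
case: XP => _ Xc _ _; rewrite coldet2 big1 // => i _; rewrite big1 // => r /andP[_ ir].
by rewrite Xc // subrr mul0r scaler0.
Qed.

Lemma coldet_cat a cs cs' p S :
  (forall S', coldet X S' cs = a *: coldet X S' cs') ->
  coldet X S (p ++ cs) = a *: coldet X S (p ++ cs').
Proof.
move=> E; elim: p S => //= c p IHp S; rewrite scaler_sumr; apply: eq_bigr => i _.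
by rewrite IHp -scalerAr !scalerA mulrC.
Qed.

Lemma coldet_move_lt S (c : 'I_n) cs1 cs2 : all (fun r : 'I_n => (r < c)%N) cs1 ->
  coldet X S (c :: cs1 ++ cs2) = (- q) ^+ size cs1 *: coldet X S (cs1 ++ c :: cs2).
Proof.
elim: cs1 S => [|c' cs1 IH] S /=; first by rewrite expr0 scale1r.
case/andP => c'c cs1c; rewrite -/(coldet X S [:: c, c' & cs1 ++ cs2]).
rewrite (coldet_swap S _ c'c) (coldet_cat [:: c'] _ (fun S' => IH S' cs1c)).
by rewrite scalerA -exprS.
Qed.

Lemma coldet_move_gt S (c : 'I_n) cs1 cs2 : all (fun r : 'I_n => (c < r)%N) cs1 ->
  coldet X S (cs1 ++ c :: cs2) = (- q) ^+ size cs1 *: coldet X S (c :: cs1 ++ cs2).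
Proof.
elim: cs1 S => [|c' cs1 IH] S /=; first by rewrite expr0 scale1r.
case/andP => c'c cs1c; rewrite -/(coldet X S [:: c, c' & cs1 ++ cs2]).
rewrite -/(coldet X S (c' :: cs1 ++ c :: cs2)).
rewrite (coldet_cat [:: c'] _ (fun S' => IH S' cs1c)).
by rewrite [_ ++ _]/= (coldet_swap S _ c'c) scalerA -exprSr.
Qed.

Lemma coldet_dup S (c : 'I_n) cs : c \in cs -> coldet X S (c :: cs) = 0.
Proof.
elim: cs S => // c' cs IH S; have [<- _|cc' /=] := eqVneq c c'; first exact: coldet_eq.
rewrite inE (negbTE cc') /= => ccs.
have zero : coldet X S [:: c', c & cs] = 0.
  by rewrite (@coldet_cat 0 _ [::] [:: c']) ?scale0r // => S';
    rewrite IH // scale0r.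
have q1 : - q != 0 by rewrite oppr_eq0.
case: (ltngtP c c') => [lt|lt|/val_inj E]; last by rewrite E eqxx in cc'.
  (* [coldet_swap] rewrites from the decreasing order, so here it is read backwards and the factor
     [- q] is cancelled. *)
  by apply: (scalerI q1); rewrite scaler0 -coldet_swap.
by rewrite -/(coldet X S [:: c, c' & cs]) coldet_swap // zero scaler0.
Qed.

Lemma coldet_cons_enum S (T : {set 'I_n}) c : c \notin T ->
  coldet X S (c :: enum T) = (- q) ^+ rk T c *: coldet X S (enum (c |: T)).
Proof.
move=> cT; rewrite enum_setU1 // -size_rk {1}(enum_setI cT) coldet_move_lt //.
by apply/allP => r; rewrite mem_filter_enum => /andP[].
Qed.

Lemma coldet_rcons_enum S (T : {set 'I_n}) c : c \notin T ->
  coldet X S (rcons (enum T) c) = (- q) ^+ rk_gt T c *: coldet X S (enum (c |: T)).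
Proof.
move=> cT; rewrite enum_setU1 // -size_rk_gt -cats1 {1}(enum_setI cT) -catA.
apply: coldet_cat => S'; rewrite coldet_move_gt ?cats0 //.
by apply/allP => r; rewrite mem_filter_enum => /andP[].
Qed.

Lemma coldet_rcons_dup S c cs : c \in cs -> coldet X S (rcons cs c) = 0.
Proof.
case/splitPr => s1 s2; rewrite rcons_cat (@coldet_cat 0 _ [::]) ?scale0r // => S'.
by rewrite scale0r rcons_cons coldet_dup // mem_rcons mem_head.
Qed.

(** The point is that [B] does not depend on [c]: relations that hold in every row, such as
    [row_plucker], can be multiplied by these coefficients and summed. *)
Lemma coldet_rcons cs : exists B : {set 'I_m} -> 'I_m -> A,
  forall S c, coldet X S (rcons cs c) = \sum_i B S i * X i c.
Proof.
elim: cs => [|c' cs [B IH]].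
  exists (fun S i => if i \in S then ((- q) ^+ rk S i)%:A else 0) => S c /=.
  rewrite big_mkcond; apply: eq_bigr => i _; case: ifP => _; last by rewrite mul0r.
  by rewrite mulr1 -scalerAl mul1r.
exists (fun S i => \sum_(r in S) (- q) ^+ rk S r *: (X r c' * B (S :\ r) i)) => S c /=.
under [RHS]eq_bigr => i _ do rewrite mulr_suml.
rewrite exchange_big /=; apply: eq_bigr => r _; rewrite IH mulr_sumr scaler_sumr.
by apply: eq_bigr => i _; rewrite -scalerAl mulrA.
Qed.
End ColDet.

(** * Row expansions against column expansions *)

Section Duality.
Hypotheses (q0 : q != 0) (hq : forall l : nat, (0 < l)%N -> q ^+ l != 1).
Variables (m n : nat) (X : 'I_m -> 'I_n -> A).
Hypothesis XP : qmatrix X.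

Let XtP := qmatrix_trans XP.

(* Both sides, multiplied by the q^2-integer [#|S|], are equal to the double sum
   over the pairs of a row and a column to expand along. *)
Lemma coldet_trans (S : {set 'I_m}) (T : {set 'I_n}) : #|S| = #|T| ->
  coldet X S (enum T) = coldet (fun j i => X i j) T (enum S).
Proof.
move: {2}#|S| (erefl #|S|) => l; elim: l S T => [|l IH] S T Sl ST.
  move/eqP: (ST); rewrite Sl eq_sym cards_eq0 => /eqP->.
  by move/eqP: Sl; rewrite cards_eq0 => /eqP->; rewrite !enum_set0.
pose N := \sum_(i < l.+1) (q ^+ 2) ^+ i.
have N0 : N != 0.
  apply: contra (hq (isT : (0 < 2 * l.+1)%N)) => /eqP N0.
  by rewrite exprM -subr_eq0 subrX1 -/N N0 mulr0.
have qq (a : nat) : (- q) ^+ a * (- q) ^+ a = (q ^+ 2) ^+ a by rewrite -exprMn mulrNN.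
have sumN p (U : {set 'I_p}) : #|U| = l.+1 -> \sum_(c in U) (q ^+ 2) ^+ rk U c = N.
  move=> Ul; apply: (@mulfI _ (q ^+ 2 - 1)); last by rewrite sum_rk_geometric Ul subrX1.
  by rewrite subr_eq0; apply: hq.
apply: (scalerI N0).
pose F (i : 'I_m) (j : 'I_n) := (- q) ^+ (rk S i + rk T j) *: (X i j * coldet X (S :\ i) (enum (T :\ j))).
transitivity (\sum_(j in T) \sum_(i in S) F i j).
  rewrite -(sumN _ T) -?ST // scaler_suml; apply: eq_bigr => j jT.
  have jTj : j \notin T :\ j by rewrite !inE eqxx.
  have := coldet_cons_enum q0 XP S jTj; rewrite setD1K // rk_setD1_ge // => E.
  rewrite -qq -scalerA -E /= scaler_sumr; apply: eq_bigr => i iS.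
  by rewrite scalerA -exprD addnC.
rewrite exchange_big -(sumN _ S) // scaler_suml; apply: eq_bigr => i iS.
have iSi : i \notin S :\ i by rewrite !inE eqxx.
have := coldet_cons_enum q0 XtP T iSi; rewrite setD1K // rk_setD1_ge // => E.
rewrite -qq -scalerA -E /= scaler_sumr; apply: eq_bigr => j jT.
rewrite scalerA -exprD /F IH //.
  by apply/eqP; rewrite -eqSS -Sl (cardsD1 i S) iS.
by apply/eqP; rewrite -eqSS; move: ST; rewrite (cardsD1 i S) iS (cardsD1 j T) jT => /eqP.
Qed.

(* The left hand side is a row expansion of a minor in which the row [i] occurs
   twice. *)
Lemma row_plucker i (K : {set 'I_n}) : #|K| = m.+1 ->
  \sum_(c in K) (- q) ^+ rk K c *: (X i c * coldet X setT (enum (K :\ c))) = 0.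
Proof.
move=> Km; have := @coldet_dup q0 _ _ _ XtP K i (enum [set: 'I_m]).
rewrite mem_enum inE => /(_ isT); rewrite /= => E; rewrite -[RHS]E.
apply: eq_bigr => c cK; rewrite coldet_trans //.
by apply/eqP; rewrite -eqSS cardsT card_ord -Km (cardsD1 c K) cK.
Qed.

(** Each row satisfies [row_plucker]. Multiplying by the coefficients of a minor linear in its last
    column absorbs [X i c] into the minor on the columns [J], [c], which vanishes for [c] in [J]
    because a column repeats. *)
Lemma plucker_relation (J K : {set 'I_n}) : #|K| = m.+1 ->
  \sum_(c in K :\: J) (- q) ^+ (rk_gt J c + rk K c) *:
    (coldet X setT (enum (c |: J)) * coldet X setT (enum (K :\ c))) = 0.
Proof.
move=> Km.
transitivity (\sum_(c in K) (- q) ^+ rk K c *: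
    (coldet X setT (rcons (enum J) c) * coldet X setT (enum (K :\ c)))).
  rewrite [RHS](big_setID J) /= [X in _ = X + _]big1 ?add0r => [|c]; last first.
    rewrite inE => /andP[_ cJ].
    by rewrite (coldet_rcons_dup q0 XP) ?mem_enum // mul0r scaler0.
  apply: eq_bigr => c; rewrite inE => /andP[cJ _].
  by rewrite (coldet_rcons_enum q0 XP) // -scalerAl scalerA -exprD addnC.
have [B BE] := coldet_rcons X (enum J).
transitivity (\sum_i B setT i *
    \sum_(c in K) (- q) ^+ rk K c *: (X i c * coldet X setT (enum (K :\ c)))).
  under [RHS]eq_bigr => i _ do rewrite mulr_sumr.
  rewrite exchange_big /=; apply: eq_bigr => c _.
  rewrite BE mulr_suml scaler_sumr; apply: eq_bigr => i _.
  by rewrite -scalerAr mulrA.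
by rewrite big1 // => i _; rewrite row_plucker // mulr0.
Qed.
End Duality.
End QMatrix.

(** * Comparison with the permutation formula for minors *)

Lemma sum_ltn_ord l i : (\sum_(b < l) (b < i) = minn i l)%N.
Proof. elim: l => [|l IH]; [by rewrite big_ord0 minn0 | rewrite big_ord_recr /= IH; lia]. Qed.

Lemma lift_perm_onto l (s : 'S_l.+1) :
  exists s', s = lift_perm ord0 (s ord0) s'.
Proof.
pose g k := odflt k (unlift (s ord0) (s (lift ord0 k))).
have gK k : lift (s ord0) (g k) = s (lift ord0 k).
  rewrite /g; have := neq_lift ord0 k.
  by rewrite -(inj_eq (@perm_inj _ s)) => /unlift_some[? ? ->].
have g_inj : injective g.
  move=> k k' E; apply: (@lift_inj _ ord0); apply: (@perm_inj _ s).
  by rewrite -!gK E.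
exists (perm g_inj); apply/permP => k.
by case: (unliftP ord0 k) => [k'|] ->; rewrite ?lift_perm_lift ?lift_perm_id ?permE.
Qed.

Lemma lift_perm_inj l (i j : 'I_l.+1) : injective (lift_perm i j).
Proof.
move=> s s' E; apply/permP => a; apply: (@lift_inj _ j).
by rewrite -!(lift_perm_lift i) E.
Qed.

(** Position 0 takes the value [i] and is inverted with the [i] smaller values; lifting keeps the
    order among the other positions and values. *)
Lemma perm_length_lift l (i : 'I_l.+1) (s : 'S_l) :
  perm_length (lift_perm ord0 i s) = (i + perm_length s)%N.
Proof.
have len p (t : 'S_p) : perm_length t = (\sum_(a : 'I_p) \sum_(b : 'I_p | (a < b)%N) (t b < t a))%N.
  rewrite /perm_length -sum1_card pair_big_dep big_mkcond [RHS]big_mkcond.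
  by apply: eq_bigr => -[a b] _; rewrite inE /=; case: (a < b)%N; case: (_ < _)%N.
rewrite !len big_ord_recl; congr (_ + _)%N.
  rewrite big_mkcond big_ord_recl /= add0n.
  under eq_bigr => b _ do rewrite lift_perm_lift lift_perm_id /= /bump.
  rewrite (reindex_inj (@perm_inj _ s^-1%g)) /=.
  under eq_bigr => b _ do rewrite permKV.
  transitivity (\sum_(b < l) (b < i))%N.
    by apply: eq_bigr => b _; case: (leqP i b) => ib; rewrite ?add1n ?add0n ?ib // ltnNge leqW.
  by rewrite sum_ltn_ord; apply/minn_idPl; rewrite -ltnS.
apply: eq_bigr => a _; rewrite big_mkcond big_ord_recl /= add0n [RHS]big_mkcond.
apply: eq_bigr => b _; rewrite !lift_perm_lift ltnNge leq_bump2 -ltnNge.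
by congr (if _ then nat_of_bool _ else _); rewrite /= ltnNge leq_bump2 -ltnNge.
Qed.

Section MaximalMinors.
Variables (k : fieldType) (A : algType k) (q : k).

(** The row map [f] serves the induction: deleting the row [f a] replaces [f] by [f \o lift a],
    which is again increasing. *)
Lemma coldet_perm m n (X : 'I_m -> 'I_n -> A) l (f : 'I_l -> 'I_m) (c : 'I_l -> 'I_n) :
    {homo f : a b / (a < b)%N} ->
  coldet q X (f @: setT) (map c (enum 'I_l)) =
    \sum_(s : 'S_l) (- q) ^+ perm_length s *: \prod_(r < l) X (f (s r)) (c r).
Proof.
elim: l f c => [|l IH] f c f_mono.
  rewrite (big_pred1 (1%g : 'S_0)) => [|s]; last by apply/esym/eqP/permS0.
  by rewrite perm_length1 expr0 big_ord0 scale1r enum_ord0.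
have f_inj : injective f.
  move=> a b E; apply/val_inj; case: (ltngtP a b) => // /f_mono.
    by rewrite E ltnn.
  by rewrite E ltnn.
rewrite enum_ordSl /= big_imset /=; last by move=> a b _ _; exact: f_inj.
rewrite [RHS](partition_big (fun s : 'S_l.+1 => s ord0) predT) //=.
rewrite big_mkcond /=; apply: eq_bigr => a _; rewrite inE.
have -> : \sum_(s : 'S_l.+1 | s ord0 == a) (- q) ^+ perm_length s *:
      \prod_(r < l.+1) X (f (s r)) (c r) =
    \sum_(s in lift_perm ord0 a @: setT) (- q) ^+ perm_length s *:
      \prod_(r < l.+1) X (f (s r)) (c r).
  apply: eq_bigl => s; apply/eqP/imsetP => [<-|[s' _ ->]]; last exact: lift_perm_id.
  by have [s' E] := lift_perm_onto s; exists s'.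
rewrite big_imset /=; last by move=> s s' _ _; exact: lift_perm_inj.
have -> : rk (f @: setT) (f a) = a.
  rewrite /rk big_imset /=; last by move=> x y _ _; exact: f_inj.
  rewrite (eq_bigr (fun b : 'I_l.+1 => nat_of_bool (b < a)%N)) => [|b _]; last first.
    congr nat_of_bool; case: (ltngtP b a) => [ba|ab|/val_inj->]; last by rewrite ltnn.
      exact: f_mono.
    by apply/negbTE; rewrite -leqNgt ltnW // f_mono.
  rewrite big_mkcond /=.
  rewrite (eq_bigr (fun b : 'I_l.+1 => nat_of_bool (b < a)%N)) => [|b _]; last by rewrite inE.
  by rewrite sum_ltn_ord; apply/minn_idPl; rewrite ltnW.
have -> : (f @: setT) :\ f a = (f \o lift a) @: setT.
  apply/setP => x; rewrite !inE; apply/andP/imsetP => [[xa /imsetP[b _ xb]]|[b _ ->]].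
    rewrite xb (inj_eq f_inj) eq_sym in xa; have [b' bb' _] := unlift_some xa.
    by exists b'; rewrite // xb bb'.
  by rewrite /= (inj_eq f_inj) eq_sym neq_lift imset_f.
rewrite -map_comp IH => [|x y xy]; last by apply: f_mono; rewrite /= /bump; lia.
rewrite mulr_sumr scaler_sumr big_mkcond /= [RHS]big_mkcond; apply: eq_bigr => s _.
rewrite !inE perm_length_lift exprD -scalerAr scalerA big_ord_recl lift_perm_id.
by congr (_ *: (_ * _)); apply: eq_bigr => r _; rewrite lift_perm_lift.
Qed.

End MaximalMinors.

Lemma enum_elt m n (I : Pi m n) : enum (val I) = map (elt I) (enum 'I_m).
Proof.
have lt_trans : transitive (relpre (@nat_of_ord n) ltn) by move=> x y z; exact: ltn_trans.
apply: (irr_sorted_eq lt_trans); first by move=> x /=; rewrite ltnn.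
- exact: enum_set_sorted.
- rewrite sorted_map; have := enum_set_sorted [set: 'I_m]; rewrite enum_setT -enumT.
  by apply: sub_sorted => x y /=; exact: elt_ltn.
- move=> x; rewrite mem_enum; apply/idP/mapP => [/eltP[r ->]|[r _ ->]].
    by exists r; rewrite ?mem_enum.
  exact: mem_elt.
Qed.

Section QuantumMatrixMinors.
Variables (k : fieldType) (q : k).

Lemma qmx_x_qmatrix a b : qmatrix q (@qmx_x k q a b).
Proof.
split=> [i j l jl|i r j ir|i r j l ir jl|i r j l ir jl]; rewrite -!rmorphM -?linearZ.
- exact/quot_pi_eq/qmx_rel_row.
- exact/quot_pi_eq/qmx_rel_col.
- exact/esym/quot_pi_eq/qmx_rel_anti.
- rewrite -rmorphD; apply: quot_pi_eq; rewrite opprD addrA; exact: qmx_rel_diag.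
Qed.

Lemma qminorE m n (I : Pi m n) :
  qminor q I = coldet q (@qmx_x k q m n) setT (enum (val I)).
Proof.
rewrite enum_elt.
by have := coldet_perm q (@qmx_x k q m n) (elt I) (fun (a b : 'I_m) ab => ab); rewrite imset_id.
Qed.
End QuantumMatrixMinors.

(** * Calculus of Pluecker coordinates *)

Lemma setD1C (I : finType) (S : {set I}) x y : S :\ x :\ y = S :\ y :\ x.
Proof. by rewrite !setDDl setUC. Qed.

Lemma sum_setU (I : finType) (S T : {set I}) (F : I -> nat) : [disjoint S & T] ->
  (\sum_(i in S :|: T) F i = \sum_(i in S) F i + \sum_(i in T) F i)%N.
Proof. by move=> ST; rewrite -bigU //; apply: eq_bigl => i; rewrite !inE. Qed.

Section PluckerCalculus.
Variables (k : fieldType) (A : algType k) (q : k).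
Hypotheses (q0 : q != 0) (hq : forall l : nat, (0 < l)%N -> q ^+ l != 1).
Variables (m n : nat) (br : {set 'I_n} -> A).

(** Stated for an arbitrary function on column sets, so that one calculus serves both the localized
    Schubert variety and the torus. *)
Definition plucker_axiom := forall J K : {set 'I_n}, #|J|.+1 = m -> #|K| = m.+1 ->
  \sum_(c in K :\: J) (- q) ^+ (rk_gt J c + rk K c) *: (br (c |: J) * br (K :\ c)) = 0.

Hypothesis brP : plucker_axiom.

(** An element of the common part [L] lies on exactly one side of [c], hence adds exactly one to the
    exponent. All terms share the factor [(- q) ^+ #|L|], which cancels. *)
Lemma plucker_axiom_disjoint (L J K : {set 'I_n}) :
    [disjoint L & J] -> [disjoint L & K] -> (#|J| + #|L|).+1 = m -> (#|K| + #|L|)%N = m.+1 ->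
  \sum_(c in K :\: J) (- q) ^+ (rk_gt J c + rk K c) *:
    (br (c |: (J :|: L)) * br (K :\ c :|: L)) = 0.
Proof.
move=> LJ LK Jm Km.
have JL : #|J :|: L| = (#|J| + #|L|)%N.
  by rewrite cardsU setIC disjoint_setI0 // cards0 subn0.
have KL : #|K :|: L| = (#|K| + #|L|)%N.
  by rewrite cardsU setIC disjoint_setI0 // cards0 subn0.
have := @brP (J :|: L) (K :|: L); rewrite JL KL => /(_ Jm Km) E.
apply: (@scalerI _ _ ((- q) ^+ #|L|)); first by rewrite expf_neq0 // oppr_eq0.
rewrite scaler0 -[RHS]E scaler_sumr.
have KJ : (K :|: L) :\: (J :|: L) = K :\: J.
  apply/setP => c; rewrite !inE; have [cL|_] := boolP (c \in L); last by rewrite !orbF.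
  by rewrite (disjointFr LK cL) !orbT andbF.
rewrite KJ; apply: eq_bigr => c; rewrite inE => /andP[cJ cK].
have cL : c \notin L by rewrite (disjointFl LK cK).
rewrite scalerA -exprD; congr ((- q) ^+ _ *: (_ * br _)); last first.
  have Lc : L :\ c = L by apply/setDidPl; rewrite disjoint_sym disjoints1.
  by rewrite setDUl Lc.
have -> : rk_gt (J :|: L) c = (rk_gt J c + rk_gt L c)%N by apply: sum_setU; rewrite disjoint_sym.
have -> : rk (K :|: L) c = (rk K c + rk L c)%N by apply: sum_setU; rewrite disjoint_sym.
have -> : #|L| = (rk_gt L c + rk L c)%N; last by lia.
rewrite /rk_gt /rk -big_split -sum1_card; apply: eq_bigr => r rL /=.
by case: ltngtP => // /val_inj rc; rewrite rc rL in cL.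
Qed.

Lemma plucker_exchange (J : {set 'I_n}) (c a : 'I_n) : c \notin J -> a \notin J ->
  #|J|.+1 = m -> (c < a)%N ->
  br (c |: J) * br (a |: J) = q *: (br (a |: J) * br (c |: J)).
Proof.
move=> cJ aJ Jm ca; have ac : (a < c)%N = false by rewrite ltnNge ltnW.
have c_a : c != a by apply: contraTneq ca => ->; rewrite ltnn.
have J0 : [disjoint J & set0] by rewrite -setI_eq0 setI0.
have Jca : [disjoint J & [set c; a]].
  rewrite -setI_eq0; apply/eqP/setP => r; rewrite !inE.
  by case: eqP => [->|_]; [rewrite (negbTE cJ) | case: eqP => [->|_]; rewrite ?andbF // (negbTE aJ)].
have := plucker_axiom_disjoint J0 Jca; rewrite cards0 cards2 c_a add2n Jm => /(_ erefl erefl).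
rewrite setD0 set0U big_setU1 ?inE //= big_set1.
have -> : [set c; a] :\ c = [set a] by rewrite setU1K // inE.
have -> : [set c; a] :\ a = [set c] by rewrite setUC setU1K // inE eq_sym.
rewrite !rk_setU1 ?inE // /rk /rk_gt !big_set1 !big_set0 !ltnn ca ac !add0n.
rewrite expr0 scale1r expr1 scaleNr => /eqP.
by rewrite subr_eq0 => /eqP.
Qed.

(** * Three-term relations and commutation on four columns *)

Section ThreeTerm.
Variable L : {set 'I_n}.
Hypothesis Lm : #|L|.+2 = m.

Definition brL (x y : 'I_n) : A := br (x |: (y |: L)).

Lemma brLC x y : brL x y = brL y x.
Proof. by rewrite /brL setUCA. Qed.

Lemma plucker_three_term (x y z w : 'I_n) :
    uniq [:: x; y; z; w] -> all (fun r => r \notin L) [:: x; y; z; w] -> (y < z)%N -> (z < w)%N ->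
  (- q) ^+ (y < x)%N *: (brL y x * brL z w) + (- q) ^+ (z < x).+1 *: (brL z x * brL y w)
    + (- q) ^+ (w < x).+2 *: (brL w x * brL y z) = 0.
Proof.
rewrite /= !inE !negb_or !andbT => /and3P[/and3P[xy xz xw] /andP[yz yw] zw].
case/and4P => xL yL zL wL lyz lzw; have lyw := ltn_trans lyz lzw.
have [lzy lwy lwz] : [/\ (z < y)%N = false, (w < y)%N = false & (w < z)%N = false].
  by split; rewrite ltnNge ltnW.
have Lx : [disjoint L & [set x]] by rewrite disjoint_sym disjoints1.
have Lyzw : [disjoint L & [set y; z; w]].
  rewrite -setI_eq0; apply/eqP/setP => r; rewrite !inE.
  have [->|_] := eqVneq r y; first by rewrite (negbTE yL).
  have [->|_] := eqVneq r z; first by rewrite (negbTE zL).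
  by have [->|_] := eqVneq r w; rewrite ?andbF // (negbTE wL).
have K3 : #|[set y; z; w]| = 3 by rewrite -setUA cardsU1 cards2 !inE negb_or yz yw zw.
have := plucker_axiom_disjoint Lx Lyzw; rewrite cards1 K3 !addSn !add0n Lm => /(_ erefl erefl).
have -> : [set y; z; w] :\: [set x] = [set y; z; w].
  by apply/setDidPl; rewrite disjoint_sym disjoints1 !inE !negb_or xy xz xw.
rewrite -setUA big_setU1 ?inE ?negb_or ?yz ?yw //= big_setU1 ?inE //= big_set1.
rewrite !rk_setU1 ?inE ?negb_or ?yz ?yw // /rk /rk_gt !big_set1 !ltnn lyz lzw lyw lzy lwy lwz /=.
have -> : (y |: [set z; w]) :\ y = [set z; w] by rewrite setU1K // !inE negb_or yz yw.
have -> : (y |: [set z; w]) :\ z = [set y; w].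
  by rewrite setUCA setU1K // !inE negb_or [z == y]eq_sym yz zw.
have -> : (y |: [set z; w]) :\ w = [set y; z].
  by rewrite setUA setUC setU1K // !inE negb_or ![w == _]eq_sym yw zw.
by rewrite !addn0 !addn1 addn2 -!setUA addrA.
Qed.

Section Four.
Variables a b c d : 'I_n.
Hypotheses (abcd : sorted ltn [seq nat_of_ord x | x <- [:: a; b; c; d]])
  (abcdL : all (fun r => r \notin L) [:: a; b; c; d]).

(** The three-term relations with [x] equal to [a], [b], [c], [d] are four linear relations among
    the six ordered products of complementary pairs. Eliminating between them divides by
    [q ^+ 2 + 1], a factor of [q ^+ 4 - 1]. *)
Lemma plucker_four :
  [/\ brL a b * brL c d = q ^+ 2 *: (brL c d * brL a b),
      brL a d * brL b c = brL b c * brL a d &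
      brL a c * brL b d = brL b d * brL a c + (q - q^-1) *: (brL a d * brL b c)].
Proof.
move: abcd abcdL; rewrite /= !andbT => /and3P[ab bc cd] /and4P[aL bL cL dL].
have [ac bd] : (a < c)%N /\ (b < d)%N by split; [exact: ltn_trans bc | exact: ltn_trans cd].
have ad := ltn_trans ab bd.
have N (x y : 'I_n) : (x < y)%N -> (y < x)%N = false by move=> xy; rewrite ltnNge ltnW.
have ne (x y : 'I_n) : (x < y)%N -> (x == y) = false.
  by move=> xy; apply/negbTE; apply: contraTneq xy => ->; rewrite ltnn.
have ne' (x y : 'I_n) : (x < y)%N -> (y == x) = false by move=> xy; rewrite eq_sym ne.
have E1 := @plucker_three_term a b c d.
have E2 := @plucker_three_term b a c d.
have E3 := @plucker_three_term c a b d.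
have E4 := @plucker_three_term d a b c.
move: E1 E2 E3 E4; rewrite /= !inE.
rewrite !(ne _ _ ab) !(ne _ _ bc) !(ne _ _ cd) !(ne _ _ ac) !(ne _ _ bd) !(ne _ _ ad).
rewrite ?(ne' _ _ ab) ?(ne' _ _ bc) ?(ne' _ _ cd) ?(ne' _ _ ac) ?(ne' _ _ bd) ?(ne' _ _ ad).
rewrite aL bL cL dL ab bc cd ac bd ad ?(N _ _ ab) ?(N _ _ bc) ?(N _ _ cd) ?(N _ _ ac) ?(N _ _ bd) ?(N _ _ ad).
move=> /(_ isT isT isT isT) E1 /(_ isT isT isT isT) E2.
move=> /(_ isT isT isT isT) E3 /(_ isT isT isT isT) E4.
have q21 : q ^+ 2 + 1 != 0.
  have := hq (isT : (0 < 4)%N); apply: contra => /eqP E.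
  have F : q ^+ 4 - 1 = (q ^+ 2 + 1) * (q ^+ 2 - 1) by ring.
  by rewrite -subr_eq0 F E mul0r.
move: E1 E2 E3 E4; rewrite ![brL b a]brLC ![brL c a]brLC ![brL d a]brLC.
rewrite ![brL c b]brLC ![brL d b]brLC ![brL d c]brLC /=.
set e1 := (X in X = 0 -> _); move=> E1; set e2 := (X in X = 0 -> _) => E2.
set e3 := (X in X = 0 -> _) => E3; set e4 := (X in X = 0 -> _) => E4.
(* Each identity is a combination of the four relations; the scalars given to [cmb0] below are the
   solution of the resulting linear system in the atoms. *)
pose cmb t1 t2 t3 t4 := t1 *: e1 + t2 *: e2 + t3 *: e3 + t4 *: e4.
have cmb0 t1 t2 t3 t4 : cmb t1 t2 t3 t4 = 0.
  by rewrite /cmb E1 E2 E3 E4 !scaler0 !addr0.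
pose s := (q ^+ 2 + 1)^-1.
split; apply/eqP; rewrite -subr_eq0; apply/eqP.
- rewrite -(cmb0 s (- (q * s)) (- s) (q * s)) /cmb /e1 /e2 /e3 /e4 /s.
  by lin_coefs k; field; rewrite ?q0 ?q21.
- rewrite -(cmb0 s (s / q) (- s) (- (s / q))) /cmb /e1 /e2 /e3 /e4 /s.
  by lin_coefs k; field; rewrite ?q0 ?q21.
- rewrite -(cmb0 (- (q * s)) (- s) (- (s / q)) (- (s / q ^+ 2))) /cmb /e1 /e2 /e3 /e4 /s.
  by lin_coefs k; field; rewrite ?q0 ?q21.
Qed.
End Four.
End ThreeTerm.

(** * Degree-one generators of the cell *)

Section Cell.
Variables (gam : {set 'I_n}) (h : A).
Hypotheses (gam_m : #|gam| = m) (gh : br gam * h = 1) (hg : h * br gam = 1).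
Hypothesis br0 : forall c a, c \in gam -> a \notin gam -> (a < c)%N ->
  br (a |: gam :\ c) = 0.

Local Notation g := (br gam).

(** Classically this is, up to sign, the entry of the reduced echelon form in the row of the pivot
    [c] and the column [a], by Cramer's rule. *)
Definition cellgen (c a : 'I_n) : A := br (a |: gam :\ c) * h.

Let card_setD1 c : c \in gam -> #|gam :\ c|.+1 = m.
Proof. by move=> cg; rewrite -gam_m (cardsD1 c gam) cg. Qed.

Lemma gam_br1 c a : c \in gam -> a \notin gam ->
  g * br (a |: gam :\ c) = q *: (br (a |: gam :\ c) * g).
Proof.
move=> cg ag; case: (ltngtP c a) => [ca|ac|/val_inj E]; last by rewrite E (negbTE ag) in cg.
  rewrite -{1 4}(setD1K cg); apply: plucker_exchange => //; last exact: card_setD1.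
    by rewrite !inE eqxx.
  by rewrite !inE (negbTE ag) andbF.
by rewrite br0 // mulr0 mul0r scaler0.
Qed.

Lemma inv_br1 c a : c \in gam -> a \notin gam ->
  h * br (a |: gam :\ c) = q^-1 *: (br (a |: gam :\ c) * h).
Proof.
move=> cg ag; set b := br _.
have -> : h * b = h * (b * g) * h by rewrite !mulrA -[RHS]mulrA gh mulr1.
apply: (scalerI q0); rewrite scalerA divff // scale1r scalerAl scalerAr.
by rewrite -gam_br1 // mulrA hg mul1r.
Qed.

Lemma gam_cellgen c a : c \in gam -> a \notin gam ->
  g * cellgen c a = q *: (cellgen c a * g).
Proof.
move=> cg ag; rewrite /cellgen mulrA gam_br1 // -!scalerAl -!mulrA gh hg.
by [].
Qed.

(** With both inverses collected on the right, every relation between cell generators becomes one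
    between products of two minors. *)
Lemma cellgenM c a c' a' : c' \in gam -> a' \notin gam ->
  cellgen c a * cellgen c' a' =
    q^-1 *: (br (a |: gam :\ c) * br (a' |: gam :\ c') * h * h).
Proof.
move=> cg ag; rewrite /cellgen -mulrA [h * _]mulrA inv_br1 //.
by rewrite -!scalerAl -scalerAr !mulrA.
Qed.

Lemma cellgen_same_pivot c a a' : c \in gam -> a \notin gam -> a' \notin gam -> (a < a')%N ->
  cellgen c a * cellgen c a' = q *: (cellgen c a' * cellgen c a).
Proof.
move=> cg ag ag' aa'; rewrite !cellgenM // plucker_exchange ?card_setD1 //.
- by rewrite -!scalerAl scalerA mulrC -scalerA.
- by rewrite !inE (negbTE ag) andbF.
- by rewrite !inE (negbTE ag') andbF.
Qed.

Lemma cellgen_same_column c c' a : c \in gam -> c' \in gam -> a \notin gam -> (c < c')%N ->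
  cellgen c' a * cellgen c a = q *: (cellgen c a * cellgen c' a).
Proof.
move=> cg cg' ag cc'; rewrite !cellgenM //.
have ne : c != c' by apply: contraTneq cc' => ->; rewrite ltnn.
have ag_ne x : x \in gam -> x != a by apply: contraTneq => ->.
pose J := a |: gam :\ c :\ c'.
have -> : a |: gam :\ c = c' |: J.
  by rewrite /J setUCA setD1K // !inE eq_sym ne.
have -> : a |: gam :\ c' = c |: J.
  by rewrite /J (setD1C gam c c') setUCA setD1K // !inE ne.
rewrite plucker_exchange //.
- by rewrite -!scalerAl scalerA mulrC -scalerA.
- by rewrite !inE eqxx /= andbF orbF ag_ne.
- by rewrite !inE eqxx /= orbF ag_ne.
- rewrite /J cardsU1 !inE (negbTE ag) !andbF /= -(card_setD1 cg).
  by rewrite (cardsD1 c' (gam :\ c)) !inE eq_sym ne cg'.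
Qed.

Section TwoPivots.
Variables c c' : 'I_n.
Hypotheses (cg : c \in gam) (cg' : c' \in gam) (cc' : (c < c')%N).

Local Notation L := (gam :\ c :\ c').

Let ne : c != c'. Proof. by apply: contraTneq cc' => ->; rewrite ltnn. Qed.

Let cardL : #|L|.+2 = m.
Proof.
by rewrite -(card_setD1 cg) (cardsD1 c' (gam :\ c)) !inE eq_sym ne cg'.
Qed.

Let Lout x : x \notin gam -> x \notin L.
Proof. by move=> xg; rewrite !inE (negbTE xg) !andbF. Qed.

Let Lc : c \notin L. Proof. by rewrite !inE eqxx /= andbF. Qed.
Let Lc' : c' \notin L. Proof. by rewrite !inE eqxx. Qed.

Let brL1 a : br (a |: gam :\ c) = brL L c' a.
Proof. by rewrite /brL setUCA setD1K // !inE eq_sym ne. Qed.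

Let brL2 a : br (a |: gam :\ c') = brL L c a.
Proof.
by rewrite /brL (setD1C gam c c') setUCA setD1K // !inE ne.
Qed.

(** The column [a] may lie on either side of [c']. In both cases the two minors correspond to the
    outer and the inner pair of the four columns, and these commute. *)
Lemma cellgen_antidiagonal a a' : a \notin gam -> a' \notin gam ->
    (c < a)%N -> (c' < a')%N -> (a < a')%N ->
  cellgen c a * cellgen c' a' = cellgen c' a' * cellgen c a.
Proof.
move=> ag ag' ca ca' aa'; rewrite !cellgenM // !brL1 !brL2.
have a_c' : a != c' by apply: contraNneq ag => ->.
case: (ltngtP a c') => [ac'|c'a|/val_inj E]; last by rewrite E eqxx in a_c'.
- have [] := @plucker_four L cardL c a c' a'; rewrite /= ?ca ?ac' ?ca' ?Lc ?Lc' ?Lout //.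
  by move=> _ E _; rewrite [brL L c' a]brLC E.
- have [] := @plucker_four L cardL c c' a a'; rewrite /= ?cc' ?c'a ?aa' ?Lc ?Lc' ?Lout //.
  by move=> _ E _; rewrite E.
Qed.

Lemma cellgen_diagonal a a' : a \notin gam -> a' \notin gam -> (c' < a)%N -> (a < a')%N ->
  cellgen c' a * cellgen c a' =
    cellgen c a' * cellgen c' a + (q - q^-1) *: (cellgen c' a' * cellgen c a).
Proof.
move=> ag ag' ca aa'; rewrite !cellgenM // !brL1 !brL2.
have [] := @plucker_four L cardL c c' a a'; rewrite /= ?cc' ?ca ?aa' ?Lc ?Lc' ?Lout //.
move=> _ _ ->; rewrite scalerA mulrC -scalerA -scalerDr; congr (_ *: _).
by rewrite -!mulrA mulrDl -scalerAl !mulrA.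
Qed.
End TwoPivots.

Definition is_cellgen (y : A) : Prop :=
  exists c a, [/\ c \in gam, a \notin gam & y = cellgen c a].

(* The Pluecker relation for [alpha \ a] and [gam + a] expresses [alpha] through
   minors which differ from [gam] in fewer elements. *)
Lemma br_cell (alpha : {set 'I_n}) : #|alpha| = m ->
  g * br alpha = q ^+ #|alpha :\: gam| *: (br alpha * g) /\
  in_gen is_cellgen (br alpha * h).
Proof.
move: {2}#|_ :\: _| (erefl #|alpha :\: gam|) => d.
elim: d alpha => [|d IH] alpha alpha_d alpha_m.
  have -> : alpha = gam.
    by apply/eqP; rewrite eqEcard gam_m alpha_m leqnn andbT -setD_eq0 -cards_eq0 alpha_d.
  by rewrite setDv cards0 expr0 scale1r; split=> //; rewrite gh; exact: in_gen1.
have [a] : exists a, a \in alpha :\: gam by apply/set0Pn; rewrite -cards_eq0 alpha_d.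
rewrite inE => /andP[ag aalpha].
have J_m : #|alpha :\ a|.+1 = m by rewrite -alpha_m (cardsD1 a alpha) aalpha.
have K_m : #|a |: gam| = m.+1 by rewrite cardsU1 ag gam_m.
have := brP J_m K_m; rewrite (big_setD1 a) /=; last by rewrite !inE eqxx.
rewrite setD1K // setU1K //; set e := (rk_gt _ _ + _)%N.
have -> : (a |: gam) :\: (alpha :\ a) :\ a = gam :\: alpha.
  apply/setP => c; rewrite !inE; have [->|] := eqVneq c a; last by case: (c \in alpha).
  by rewrite (negbTE ag) andbF.
move/eqP; rewrite addrC addr_eq0 eq_sym => /eqP/(congr1 (fun z => - z)); rewrite opprK.
pose t c := - (- q) ^- e * (- q) ^+ (rk_gt (alpha :\ a) c + rk (a |: gam) c).
move/(congr1 (fun z => (- q) ^- e *: z)).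
have qe : (- q) ^+ e != 0 by rewrite expf_neq0 // oppr_eq0.
rewrite scalerA mulVf // scale1r => E.
have {E} E : br alpha * g = \sum_(c in gam :\: alpha)
    t c *: (br (c |: alpha :\ a) * br (a |: gam :\ c)).
  rewrite E scalerN scaler_sumr -sumrN; apply: eq_bigr => c.
  rewrite inE => /andP[calpha cg]; rewrite scalerA /t mulNr scaleNr.
  have ca : c != a by apply: contraTneq cg => ->.
  congr (- (_ *: (_ * br _))); apply/setP => x; rewrite !inE.
  by have [->|] := eqVneq x a; rewrite //= eq_sym ca.
have dist c : c \in gam :\: alpha -> #|(c |: alpha :\ a) :\: gam| = d /\ #|c |: alpha :\ a| = m.
  rewrite inE => /andP[calpha cg]; split; last first.
    by rewrite cardsU1 !inE (negbTE calpha) andbF add1n.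
  apply/eqP; rewrite -eqSS -alpha_d (cardsD1 a (alpha :\: gam)) inE ag aalpha add1n eqSS.
  apply/eqP; congr #|pred_of_set _|; apply/setP => x; rewrite !inE.
  by have [->|_ /=] := eqVneq x c; [rewrite cg /= andbF | rewrite andbCA].
have brE : br alpha = \sum_(c in gam :\: alpha) t c *: (br (c |: alpha :\ a) * cellgen c a).
  rewrite -[LHS]mulr1 -gh mulrA E mulr_suml; apply: eq_bigr => c _.
  by rewrite -scalerAl -mulrA.
split.
  rewrite alpha_d {1}brE mulr_sumr E scaler_sumr; apply: eq_bigr => c cga.
  have [cd cm] := dist c cga.
  move: cga; rewrite inE => /andP[_ cg].
  rewrite -scalerAr mulrA; have [-> _] := IH _ cd cm.
  rewrite cd -scalerAl -mulrA gam_cellgen // -!scalerAr !scalerA exprSr mulrAC.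
  rewrite /cellgen -[_ * h * g]mulrA hg mulr1; congr (_ *: _); ring.
rewrite brE mulr_suml; apply: (big_ind (in_gen is_cellgen)).
- by rewrite -(addNr 1) -scaleN1r; apply: in_gen_lin; exact: in_gen1.
- by move=> x y xG yG; rewrite -[x]scale1r; exact: in_gen_lin.
- move=> c cga; have [cd cm] := dist c cga; have [_ IHc] := IH _ cd cm.
  move: cga; rewrite inE => /andP[_ cg].
  have -> : t c *: (br (c |: alpha :\ a) * cellgen c a) * h =
      (t c * q) *: (br (c |: alpha :\ a) * h * cellgen c a) + 0.
    rewrite addr0 -scalerAl -scalerA; congr (_ *: _).
    rewrite -!mulrA scalerAr; congr (_ * _).
    rewrite /cellgen [h * (_ * _)]mulrA inv_br1 // -scalerAl scalerA divff // scale1r.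
    by rewrite mulrA.
  apply: in_gen_lin; last first.
    by rewrite -(addNr 1) -scaleN1r; apply: in_gen_lin; exact: in_gen1.
  by apply: in_genM => //; apply: in_gen_gen; exists c, a.
Qed.
End Cell.
End PluckerCalculus.

(** * Quantum echelon matrices *)

Section QCommutation.
Variables (k : fieldType) (A : algType k).
Implicit Types (x y z : A) (c d : k).

Definition qcomm c x y : Prop := x * y = c *: (y * x).

Lemma qcommMl c d x y z : qcomm c x z -> qcomm d y z -> qcomm (c * d) (x * y) z.
Proof.
move=> xz yz; rewrite /qcomm -mulrA yz -scalerAr (mulrA x) xz -scalerAl scalerA mulrA.
by rewrite [d * c]mulrC.
Qed.

Lemma qcommMr c d x y z : qcomm c x y -> qcomm d x z -> qcomm (c * d) x (y * z).
Proof.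
move=> xy xz; rewrite /qcomm (mulrA x) xy -scalerAl -(mulrA y x z) xz -scalerAr scalerA (mulrA y).
by [].
Qed.

Lemma qcomm_sym c x y : c != 0 -> qcomm c x y -> qcomm c^-1 y x.
Proof. by move=> c0 xy; rewrite /qcomm xy scalerA mulVf // scale1r. Qed.

Lemma qcomm_suml c (I : eqType) (r : seq I) (F : I -> A) y :
  (forall i, i \in r -> qcomm c (F i) y) -> qcomm c (\sum_(i <- r) F i) y.
Proof.
move=> Fy; rewrite /qcomm mulr_suml mulr_sumr scaler_sumr !big_seq.
exact: eq_bigr.
Qed.

Lemma qcomm_sumr c (I : eqType) (r : seq I) (F : I -> A) x :
  (forall i, i \in r -> qcomm c x (F i)) -> qcomm c x (\sum_(i <- r) F i).
Proof.
move=> Fy; rewrite /qcomm mulr_suml mulr_sumr scaler_sumr !big_seq.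
exact: eq_bigr.
Qed.

Lemma qcomm_invl c x x' y : x * x' = 1 -> x' * x = 1 -> c != 0 ->
  qcomm c x y -> qcomm c^-1 x' y.
Proof.
move=> xx' x'x c0 xy; rewrite /qcomm -[x' * y]mulr1 -xx' mulrA -[x' * y * x]mulrA.
have -> : y * x = c^-1 *: (x * y) by rewrite xy scalerA mulVf // scale1r.
by rewrite -scalerAr mulrA x'x mul1r -scalerAl.
Qed.

Lemma qcomm_invr c x y y' : y * y' = 1 -> y' * y = 1 -> c != 0 ->
  qcomm c x y -> qcomm c^-1 x y'.
Proof.
move=> yy' y'y c0 xy; rewrite /qcomm -[x * y']mul1r -y'y -mulrA [y * _]mulrA.
have -> : y * x = c^-1 *: (x * y) by rewrite xy scalerA mulVf // scale1r.
by rewrite -scalerAl -scalerAr -[x * y * y']mulrA yy' mulr1.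
Qed.

Lemma qcomm0l c y : qcomm c 0 y.
Proof. by rewrite /qcomm mul0r mulr0 scaler0. Qed.
End QCommutation.

Section Block.
Variables (k : fieldType) (A : algType k) (q : k) (q0 : q != 0).
Variables (S S' D D' tj tl : A).
Hypotheses (tjl : qcomm q tj tl).
Hypotheses (tjS : qcomm q^-1 tj S) (tjS' : qcomm q^-1 tj S').
Hypotheses (tlS : qcomm q^-1 tl S) (tlS' : qcomm q^-1 tl S').
Hypotheses (tlD : qcomm q tl D) (tlD' : qcomm q tl D').
Hypotheses (SS' : qcomm q S S') (D'S : qcomm q D' S) (DS : qcomm (q ^+ 2) D S).
Hypothesis DS' : D * S' = q *: (S' * D) + (q ^+ 2 - 1) *: (S * D').

Let swap4 (x y z z' w : A) : y * z = z' * y -> (x * y) * (z * w) = (x * z') * (y * w).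
Proof. by move=> yz; rewrite -mulrA (mulrA y) yz !mulrA. Qed.

Let tjS_ : tj * S = (q^-1 *: S) * tj. Proof. by rewrite tjS scalerAl. Qed.
Let tjS'_ : tj * S' = (q^-1 *: S') * tj. Proof. by rewrite tjS' scalerAl. Qed.
Let tlS_ : tl * S = (q^-1 *: S) * tl. Proof. by rewrite tlS scalerAl. Qed.
Let tlS'_ : tl * S' = (q^-1 *: S') * tl. Proof. by rewrite tlS' scalerAl. Qed.
Let tlSD : tl * (S + D) = (q^-1 *: S + q *: D) * tl.
Proof. by rewrite mulrDr tlS tlD mulrDl !scalerAl. Qed.
Let tlSD' : tl * (S' + D') = (q^-1 *: S' + q *: D') * tl.
Proof. by rewrite mulrDr tlS' tlD' mulrDl !scalerAl. Qed.

(** This and the next three lemmas treat the block on rows [i < r] and columns [j < l] after a row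
    has been added: [S], [S'] are the tails of the two rows from [l] on, [D], [D'] their slices from
    [j] to [l], so that the entries are [(S + D) * tj], [S * tl], [(S' + D') * tj], [S' * tl]. *)
Lemma block_row : ((S + D) * tj) * (S * tl) = q *: ((S * tl) * ((S + D) * tj)).
Proof.
rewrite (swap4 _ _ tjS_) (swap4 _ _ tlSD) tjl -scalerAr !scalerAl; congr (_ * _).
rewrite !(mulrDl, mulrDr, =^~ scalerAl, =^~ scalerAr) DS.
by lin_coefs k; field.
Qed.

Lemma block_col : (S * tl) * (S' * tl) = q *: ((S' * tl) * (S * tl)).
Proof.
rewrite (swap4 _ _ tlS_) (swap4 _ _ tlS'_) scalerAl; congr (_ * _).
by rewrite -!scalerAr SS' scalerA mulrC -scalerA.
Qed.

Lemma block_anti : (S * tl) * ((S' + D') * tj) = ((S' + D') * tj) * (S * tl).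
Proof.
rewrite (swap4 _ _ tjS_) (swap4 _ _ tlSD') tjl -scalerAr scalerAl; congr (_ * _).
rewrite !(mulrDl, mulrDr, =^~ scalerAl, =^~ scalerAr) D'S SS'.
by lin_coefs k; field.
Qed.

Lemma block_diag : ((S + D) * tj) * (S' * tl) =
  (S' * tl) * ((S + D) * tj) + (q - q^-1) *: ((S * tl) * ((S' + D') * tj)).
Proof.
rewrite (swap4 _ _ tjS'_) (swap4 _ _ tlSD) (swap4 _ _ tlSD') tjl -scalerAr !scalerAl -mulrDl.
congr (_ * _); rewrite !(mulrDl, mulrDr, =^~ scalerAl, =^~ scalerAr) SS' DS'.
by lin_coefs k; field.
Qed.
End Block.

(** * Appending a row to a quantum matrix *)

Section RowStep.
Variables (k : fieldType) (A : algType k) (q : k) (q0 : q != 0) (n : nat).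

(** Natural indices with bounds inside the relations, because the number of rows grows along a
    recursion. *)
Definition nat_qmatrix a (X : nat -> nat -> A) : Prop :=
  [/\ forall i j l, (i < a)%N -> (j < l)%N -> (l < n)%N -> qcomm q (X i j) (X i l),
      forall i r j, (i < r)%N -> (r < a)%N -> (j < n)%N -> qcomm q (X i j) (X r j),
      forall i r j l, (i < r)%N -> (r < a)%N -> (j < l)%N -> (l < n)%N ->
        X i l * X r j = X r j * X i l &
      forall i r j l, (i < r)%N -> (r < a)%N -> (j < l)%N -> (l < n)%N ->
        X i j * X r l = X r l * X i j + (q - q^-1) *: (X i l * X r j)].

Variables (a : nat) (Y : nat -> nat -> A) (t u : nat -> A) (kap : nat).
Hypothesis YP : nat_qmatrix a Y.
Hypothesis tt : forall j l, (j < l)%N -> (l < n)%N -> qcomm q (t j) (t l).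
Hypothesis tu : forall j, (j < n)%N -> t j * u j = 1.
Hypothesis ut : forall j, (j < n)%N -> u j * t j = 1.
Hypothesis Yt : forall i j l, (i < a)%N -> (j < n)%N -> (l < n)%N ->
  qcomm (if j == l then q else 1) (Y i j) (t l).

Let Z i s := Y i s * u s.
Let Sm i j l := \sum_(j <= s < l) Z i s.

(** The old rows are multiplied on the right by a lower unipotent matrix: the identity in the
    columns before [kap], and [u s * t j] for [s >= j] in a column [j] from [kap] on, with diagonal
    [u j * t j = 1]. *)
Definition add_row i j : A :=
  if i == a then (if (kap <= j)%N then t j else 0)
  else if (j < kap)%N then Y i j else Sm i j n * t j.

Let Yu i j l : (i < a)%N -> (j < n)%N -> (l < n)%N ->
  qcomm (if j == l then q^-1 else 1) (Y i j) (u l).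
Proof.
move=> ia jn ln; have := qcomm_invr (tu ln) (ut ln) _ (Yt ia jn ln).
by case: (j == l) => /=; rewrite ?invr1; apply; rewrite ?oner_eq0.
Qed.

Let uu j l : (j < l)%N -> (l < n)%N -> qcomm q (u j) (u l).
Proof.
move=> jl ln; have jn := ltn_trans jl ln; rewrite -[q]invrK.
apply: (qcomm_invl (tu jn) (ut jn)); rewrite ?invr_eq0 //.
by apply: (qcomm_invr (tu ln) (ut ln)) => //; exact: tt.
Qed.

Let Zt i s l : (i < a)%N -> (s < n)%N -> (l < n)%N ->
  qcomm (if (s < l)%N then q^-1 else q) (Z i s) (t l).
Proof.
move=> ia sn ln; have Yst := Yt ia sn ln; case: (ltngtP s l) Yst => [sl|ls|<-{l ln}] Yst.
- rewrite -[q^-1]mul1r; apply: qcommMl => //.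
  by apply: (qcomm_invl (tu sn) (ut sn)) => //; exact: tt.
- rewrite -[q]mul1r; apply: qcommMl => //; rewrite -[q]invrK.
  apply: qcomm_sym; rewrite ?invr_eq0 //.
  by apply: (qcomm_invr (tu sn) (ut sn)) => //; exact: tt.
- rewrite -[q]mulr1; apply: qcommMl => //.
  by rewrite /qcomm scale1r tu // ut.
Qed.

Let ZZ i r s l : (i < a)%N -> (r < a)%N -> (s < n)%N -> (l < n)%N ->
  Z i s * Z r l = (if s == l then q else 1) *: (Y i s * Y r l * (u s * u l)).
Proof.
move=> ia ra sn ln; have E : u s * Y r l = (if s == l then q else 1) *: (Y r l * u s).
  have := qcomm_sym _ (Yu ra ln sn); rewrite [l == s]eq_sym.
  by case: (s == l) => /=; rewrite ?invr1 ?invrK; apply; rewrite ?invr_eq0 ?oner_eq0.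
by rewrite /Z -mulrA (mulrA (u s)) E -scalerAl -scalerAr !mulrA.
Qed.

(** After multiplication by [u], how [Z i s] and [Z r l] commute depends only on the order of [s]
    and [l]. The relations therefore extend to the sums [Sm] over successive intervals of
    columns. *)
Let Z_row i s l : (i < a)%N -> (s < l)%N -> (l < n)%N -> qcomm (q ^+ 2) (Z i s) (Z i l).
Proof.
case: YP => Yr _ _ _ ia sl ln; have sn := ltn_trans sl ln.
rewrite /qcomm !ZZ // (ltn_eqF sl) (gtn_eqF sl) !scale1r Yr //. rewrite (uu sl ln).
by rewrite -scalerAl -scalerAr scalerA.
Qed.

Let Z_col i r s : (i < r)%N -> (r < a)%N -> (s < n)%N -> qcomm q (Z i s) (Z r s).
Proof.
case: YP => _ Yc _ _ ir ra sn; have ia := ltn_trans ir ra.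
by rewrite /qcomm !ZZ // eqxx Yc // -scalerAl !scalerA.
Qed.

Let Z_anti i r s l : (i < r)%N -> (r < a)%N -> (s < l)%N -> (l < n)%N ->
  qcomm q (Z r s) (Z i l).
Proof.
case: YP => _ _ Ya _ ir ra sl ln; have ia := ltn_trans ir ra; have sn := ltn_trans sl ln.
rewrite /qcomm !ZZ // (ltn_eqF sl) (gtn_eqF sl) !scale1r (Ya i r s l) // (uu sl ln).
by rewrite -scalerAr.
Qed.

Let Z_diag i r s l : (i < r)%N -> (r < a)%N -> (s < l)%N -> (l < n)%N ->
  Z i s * Z r l = q *: (Z r l * Z i s) + (q ^+ 2 - 1) *: (Z i l * Z r s).
Proof.
case: YP => _ _ _ Yd ir ra sl ln; have ia := ltn_trans ir ra; have sn := ltn_trans sl ln.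
rewrite !ZZ // (ltn_eqF sl) (gtn_eqF sl) !scale1r (Yd i r s l) // (uu sl ln) -!scalerAr mulrDl -scalerAl.
by lin_coefs k; field.
Qed.

Let in_range j l s : s \in index_iota j l -> (j <= s)%N /\ (s < l)%N.
Proof. by rewrite mem_index_iota => /andP[]. Qed.

Let Sm_row i j l p : (i < a)%N -> (p <= n)%N -> qcomm (q ^+ 2) (Sm i j l) (Sm i l p).
Proof.
move=> ia pn; apply: qcomm_suml => s /in_range[js sl]; apply: qcomm_sumr => r /in_range[lr rp].
by apply: Z_row => //; [exact: leq_trans lr | exact: leq_trans pn].
Qed.

Let Sm_anti i r j l p : (i < r)%N -> (r < a)%N -> (p <= n)%N ->
  qcomm q (Sm r j l) (Sm i l p).
Proof.
move=> ir ra pn; apply: qcomm_suml => s /in_range[js sl].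
apply: qcomm_sumr => s' /in_range[lr rp].
by apply: Z_anti => //; [exact: leq_trans lr | exact: leq_trans pn].
Qed.

Let Sm_diag i r j l p : (i < r)%N -> (r < a)%N -> (p <= n)%N ->
  Sm i j l * Sm r l p =
    q *: (Sm r l p * Sm i j l) + (q ^+ 2 - 1) *: (Sm i l p * Sm r j l).
Proof.
move=> ir ra pn; rewrite /Sm !big_distrlr /= [X in q *: X]exchange_big.
rewrite [X in (q ^+ 2 - 1) *: X]exchange_big /= !scaler_sumr -big_split !big_seq /=.
apply: eq_bigr => s /in_range[js sl]; rewrite !scaler_sumr -big_split !big_seq /=.
apply: eq_bigr => s' /in_range[ls' s'p]; apply: Z_diag => //.
  exact: leq_trans ls'.
exact: leq_trans pn.
Qed.

Let SmSl i j l : (j <= l)%N -> Sm i j l.+1 = Sm i j l + Z i l.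
Proof. by move=> jl; rewrite /Sm big_nat_recr. Qed.

Let Sm1 i l : Sm i l l.+1 = Z i l.
Proof. by rewrite /Sm big_nat1. Qed.

Let Sm_cat i j l p : (j <= l)%N -> (l <= p)%N -> Sm i j p = Sm i j l + Sm i l p.
Proof. by move=> jl lp; rewrite /Sm (big_cat_nat jl lp). Qed.

(** Here both rows use the same interval, so it is lengthened one column at a time. The surplus
    [q ^+ 2 - 1] from [Sm_diag] is what turns the cross term [Z i l * Sm r j l] into [q] times its
    reverse. *)
Let Sm_col i r j p : (i < r)%N -> (r < a)%N -> (j <= p)%N -> (p <= n)%N ->
  qcomm q (Sm i j p) (Sm r j p).
Proof.
move=> ir ra /subnKC <-; elim: (p - j)%N => [|d IH].
  by rewrite addn0 /Sm big_geq // => _; apply: qcomm0l.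
rewrite addnS => jd; have {}IH := IH (ltnW jd); rewrite /qcomm !SmSl ?leq_addr //.
set l := (j + d)%N in jd IH *; rewrite !(mulrDl, mulrDr) IH Z_col //.
have := @Sm_diag i r j l l.+1 ir ra jd; rewrite !Sm1 => ->.
have := @Sm_anti i r j l l.+1 ir ra jd; rewrite !Sm1 => ->.
by lin_coefs k; ring.
Qed.

Let Sm_t i j p l : (i < a)%N -> (p <= n)%N -> (l <= j)%N -> (l < n)%N ->
  qcomm q (Sm i j p) (t l).
Proof.
move=> ia pn lj ln; apply: qcomm_suml => s /in_range[js sp].
have := Zt ia (leq_trans sp pn) ln; rewrite ltnNge.
by rewrite (leq_trans lj js).
Qed.

Let Sm_t' i j p l : (i < a)%N -> (p <= l)%N -> (l < n)%N ->
  qcomm q^-1 (Sm i j p) (t l).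
Proof.
move=> ia pl ln; apply: qcomm_suml => s /in_range[js sp].
have sl := leq_trans sp pl; have := Zt ia (ltn_trans sl ln) ln.
by rewrite sl.
Qed.

Let Y_Sm i j l r : (i < a)%N -> (j < l)%N -> (l <= n)%N -> (r < a)%N -> forall c d,
  c = d -> (forall s, (l <= s)%N -> (s < n)%N -> Y i j * Y r s = c *: (Y r s * Y i j)) ->
  Y i j * Sm r l n = d *: (Sm r l n * Y i j).
Proof.
move=> ia jl ln ra c _ <- E; apply: qcomm_sumr => s /in_range[ls sn].
rewrite -[c]mulr1; apply: qcommMr; first exact: E.
have := Yu ia (leq_trans jl ln) sn; by rewrite (ltn_eqF (leq_trans jl ls)).
Qed.

Let t_Sm i j p l : (i < a)%N -> (p <= n)%N -> (l <= j)%N -> (l < n)%N ->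
  qcomm q^-1 (t l) (Sm i j p).
Proof. by move=> ia pn lj ln; apply: qcomm_sym => //; exact: Sm_t. Qed.

Let t_Sm' i j p l : (i < a)%N -> (p <= l)%N -> (l < n)%N ->
  qcomm q (t l) (Sm i j p).
Proof.
by move=> ia pl ln; rewrite -[q]invrK; apply: qcomm_sym; rewrite ?invr_eq0 //; exact: Sm_t'.
Qed.

(** Columns before [kap] keep their relations, a pair of columns straddling [kap] is handled summand
    by summand, and two columns from [kap] on form a block as above once the longer tail is split at
    [l]. *)
Lemma add_row_qmatrix : (kap < n)%N -> nat_qmatrix a.+1 add_row.
Proof.
move=> kn; have [Yr Yc Ya Yd] := YP.
have low i j : (i < a)%N -> add_row i j = if (j < kap)%N then Y i j else Sm i j n * t j.
  by move=> ia; rewrite /add_row ltn_eqF.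
have top j : add_row a j = if (kap <= j)%N then t j else 0 by rewrite /add_row eqxx.
have Y_t i j l : (i < a)%N -> (j < l)%N -> (l < n)%N -> Y i j * t l = t l * Y i j.
  by move=> ia jl ln; have := Yt ia (ltn_trans jl ln) ln; rewrite ltn_eqF // /qcomm scale1r.
have Sm_split i j l : (j < l)%N -> (l < n)%N -> Sm i j n = Sm i l n + Sm i j l.
  by move=> jl ln; rewrite addrC; apply: Sm_cat; exact: ltnW.
split.
- move=> i j l; rewrite ltnS leq_eqVlt => /predU1P[->|ia] jl ln.
    rewrite !top; case: (leqP kap j) => [kj|_]; last exact: qcomm0l.
    by rewrite (leq_trans kj (ltnW jl)); exact: tt.
  rewrite !low //; case: (ltnP l kap) => [lk|kl]; first by rewrite (ltn_trans jl lk); exact: Yr.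
  case: (ltnP j kap) => [jk|kj].
    rewrite -[q]mulr1; apply: qcommMr; last by rewrite /qcomm scale1r Y_t.
    apply: (Y_Sm _ _ _ _ (erefl q)) => // [|s ls sn]; first exact: ltnW.
    by apply: Yr => //; exact: leq_trans ls.
  rewrite (Sm_split _ j l) //; apply: block_row => //.
  + exact: tt.
  + by apply: t_Sm => //; [exact: ltnW | exact: ltn_trans ln].
  + by apply: t_Sm.
  + exact: t_Sm'.
  + exact: Sm_row.
- move=> i r j ir; rewrite ltnS leq_eqVlt => /predU1P[ra|ra] jn.
    rewrite ra in ir *; rewrite top low //; case: (leqP kap j) => [kj|_]; last first.
      by rewrite /qcomm mulr0 mul0r scaler0.
    rewrite -[q]mulr1; apply: qcommMl; last by rewrite /qcomm scale1r.
    exact: Sm_t.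
  have ia := ltn_trans ir ra; rewrite !low //; case: (ltnP j kap) => [jk|kj]; first exact: Yc.
  by apply: block_col => //; [exact: t_Sm | exact: t_Sm | apply: Sm_col => //; exact: ltnW].
- move=> i r j l ir; rewrite ltnS leq_eqVlt => /predU1P[ra|ra] jl ln.
    rewrite ra in ir *; rewrite top low //; case: (leqP kap j) => [kj|_]; last first.
      by rewrite mulr0 mul0r.
    rewrite ltnNge (leq_trans kj (ltnW jl)) /=.
    have jn := ltn_trans jl ln.
    have : qcomm (q^-1 * q) (t j) (Sm i l n * t l).
      by apply: qcommMr; [apply: t_Sm => //; exact: ltnW | exact: tt].
    by rewrite mulVf // /qcomm scale1r.
  have ia := ltn_trans ir ra; rewrite !low //.
  case: (ltnP l kap) => [lk|kl]; first by rewrite (ltn_trans jl lk); exact: Ya.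
  case: (ltnP j kap) => [jk|kj].
    have E : Y r j * Sm i l n = 1 *: (Sm i l n * Y r j).
      apply: (Y_Sm _ _ _ _ (erefl 1)) => // [|s ls sn]; first exact: ltnW.
      by rewrite scale1r (Ya i r j s) //; exact: leq_trans ls.
    by rewrite -mulrA -Y_t // mulrA -[Sm _ _ _ * _]scale1r -E mulrA.
  have jn := ltn_trans jl ln.
  rewrite (Sm_split _ j l) //; apply: (block_anti q0) => //.
  + exact: tt.
  + by apply: t_Sm => //; exact: ltnW.
  + exact: t_Sm.
  + exact: t_Sm'.
  + by apply: Sm_col => //; exact: ltnW.
  + exact: Sm_anti.
- move=> i r j l ir; rewrite ltnS leq_eqVlt => /predU1P[ra|ra] jl ln.
    have jn := ltn_trans jl ln.
    rewrite ra in ir *; rewrite !top !low //; case: (leqP kap j) => [kj|jk]; last first.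
      by rewrite mulr0 scaler0 addr0; case: (leqP kap l) => _; rewrite ?Y_t // mulr0 mul0r.
    have kl := leq_trans kj (ltnW jl); rewrite kl ltnNge kl /=.
    rewrite (Sm_split _ j l) // -!mulrA tt // [t l * (_ * _)]mulrA mulrDr t_Sm // t_Sm' //.
    rewrite !mulrDl -!scalerAl -!scalerAr -!mulrA.
    by lin_coefs k; field.
  have ia := ltn_trans ir ra; have jn := ltn_trans jl ln; rewrite !low //.
  case: (ltnP l kap) => [lk|kl]; first by rewrite (ltn_trans jl lk); exact: Yd.
  case: (ltnP j kap) => [jk|kj].
    have E : Y i j * Sm r l n = Sm r l n * Y i j + (q - q^-1) *: (Sm i l n * Y r j).
      rewrite /Sm mulr_sumr !mulr_suml scaler_sumr -big_split !big_seq /=.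
      apply: eq_bigr => s /in_range[ls sn]; have js := leq_trans jl ls.
      have uY i' : (i' < a)%N -> u s * Y i' j = Y i' j * u s.
        by move=> i'a; have := Yu i'a jn sn; rewrite ltn_eqF // /qcomm scale1r => ->.
      rewrite /Z -!mulrA !uY // !mulrA Yd // mulrDl -!scalerAl.
      by [].
    by rewrite mulrA E mulrDl -scalerAl -!mulrA !Y_t.
  rewrite !(Sm_split _ j l) //; apply: block_diag => //.
  + exact: tt.
  + by apply: t_Sm => //; exact: ltnW.
  + exact: t_Sm.
  + exact: t_Sm.
  + exact: t_Sm'.
  + exact: t_Sm'.
  + by apply: Sm_col => //; exact: ltnW.
  + exact: Sm_diag.
Qed.
End RowStep.

(** * Echelon matrices over a torus and their reduced form *)

Section EchelonModel.
Variables (k : fieldType) (A : algType k) (q : k) (q0 : q != 0) (m n : nat).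
Variables (t u : nat -> nat -> A) (kap : nat -> nat).

Definition torus_grid : Prop :=
  [/\ forall a j l, (a < m)%N -> (j < l)%N -> (l < n)%N -> qcomm q (t a j) (t a l),
      forall a b j l, (a < b)%N -> (b < m)%N -> (j < n)%N -> (l < n)%N ->
        qcomm (if j == l then q else 1) (t a j) (t b l),
      forall a j, (a < m)%N -> (j < n)%N -> t a j * u a j = 1 &
      forall a j, (a < m)%N -> (j < n)%N -> u a j * t a j = 1].

Hypothesis tP : torus_grid.
Hypothesis kap_mono : forall a b, (a < b)%N -> (b < m)%N -> (kap a < kap b)%N.
Hypothesis kap_n : forall a, (a < m)%N -> (kap a < n)%N.

Fixpoint echelon a : nat -> nat -> A :=
  if a is a'.+1 then add_row n a' (echelon a') (t a') (u a') (kap a') else fun _ _ => 0.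

Lemma echelon_top a j : echelon a.+1 a j = if (kap a <= j)%N then t a j else 0.
Proof. by rewrite /= /add_row eqxx. Qed.

Lemma echelon_low a i j : (i < a)%N -> echelon a.+1 i j =
  if (j < kap a)%N then echelon a i j
  else (\sum_(j <= s < n) echelon a i s * u a s) * t a j.
Proof. by move=> ia; rewrite /= /add_row ltn_eqF. Qed.

Arguments echelon : simpl never.

(** In a summand [echelon a i s * u a s * t a j] the scalar picked up by the first factor is
    cancelled by that of [u a s], leaving that of [t a j]. This is the hypothesis under which the
    row [b] can be appended. *)
Lemma echelon_t a b i j l : (i < a)%N -> (a <= b)%N -> (b < m)%N -> (j < n)%N -> (l < n)%N ->
  qcomm (if j == l then q else 1) (echelon a i j) (t b l).
Proof.
case: tP => tr tc tu ut; elim: a j => // a IH j; rewrite ltnS leq_eqVlt => ia ab bm jn ln.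
have am := ltn_trans ab bm.
case/predU1P: ia => [->|ia].
  rewrite echelon_top; case: (kap a <= j)%N; [exact: tc | exact: qcomm0l].
rewrite echelon_low //; case: (j < kap a)%N; first by apply: IH => //; exact: ltnW.
rewrite -[if _ then _ else _]mul1r; apply: qcommMl; last exact: tc.
apply: qcomm_suml => s; rewrite mem_index_iota => /andP[js sn].
have := qcomm_invl (tu a s am sn) (ut a s am sn) _ (tc a b s l ab bm sn ln).
have := IH s ia (ltnW ab) bm sn ln.
case: (s == l) => /= E1 E2.
  by rewrite -[1](divff q0); apply: qcommMl => //; exact: E2.
by rewrite -[1]mulr1; apply: qcommMl => //; have := E2 (oner_neq0 _); rewrite invr1.
Qed.

Lemma echelon_qmatrix a : (a <= m)%N -> nat_qmatrix q n a (echelon a).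
Proof.
case: tP => tr tc tu ut; elim: a => [_|a IH am].
  by split=> [//|i r j _ //|i r j l _ //|i r j l _ //].
apply: add_row_qmatrix => //.
- by apply: IH; exact: ltnW.
- by move=> j l; exact: tr.
- by move=> j; exact: tu.
- by move=> j; exact: ut.
- by move=> i j l ia jn ln; exact: echelon_t.
- exact: kap_n.
Qed.

Lemma echelon_left a i j : (i < a)%N -> (a <= m)%N -> (j < kap i)%N -> echelon a i j = 0.
Proof.
elim: a => // a IH; rewrite ltnS leq_eqVlt => /predU1P[->|ia] am ji.
  by rewrite echelon_top leqNgt ji.
rewrite echelon_low // (ltn_trans ji (kap_mono ia am)).
by rewrite IH // ltnW.
Qed.

Lemma echelon_pivot a i : (i < a)%N -> (a <= m)%N -> echelon a i (kap i) = t i (kap i).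
Proof.
elim: a => // a IH; rewrite ltnS leq_eqVlt => /predU1P[->|ia] am.
  by rewrite echelon_top leqnn.
by rewrite echelon_low // kap_mono // IH // ltnW.
Qed.

(* Left multiplication by the inverse of the pivot columns turns the echelon
   matrix into a reduced one, with entries [reduced]. *)
Fixpoint reduced a r j : A :=
  if a is a'.+1 then
    if r == a' then (if (j < kap a')%N then 0 else u a' (kap a') * t a' j)
    else if (j < kap a')%N then reduced a' r j
    else - (\sum_(kap a' <= s < j) reduced a' r s * u a' s) * t a' j
  else 0.

Lemma reduced_top a j :
  reduced a.+1 a j = if (j < kap a)%N then 0 else u a (kap a) * t a j.
Proof. by rewrite /= eqxx. Qed.

Lemma reduced_low a r j : (r < a)%N -> reduced a.+1 r j =
  if (j < kap a)%N then reduced a r j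
  else - (\sum_(kap a <= s < j) reduced a r s * u a s) * t a j.
Proof. by move=> ra; rewrite /= ltn_eqF. Qed.

Arguments reduced : simpl never.

(** For a column [j] from [kap a] on, the new pivot row contributes the full tail sum from [kap a],
    because [t a (kap a)] meets its inverse. The rows [r < a] subtract the part before [j], and the
    tail from [j] remains. *)
Lemma echelon_reduced a i j : (i < a)%N -> (a <= m)%N -> (j < n)%N ->
  echelon a i j = \sum_(r < a) echelon a i (kap r) * reduced a r j.
Proof.
case: tP => tr tc tu ut; elim: a i j => // a IH i j ia am jn; rewrite big_ord_recr /= reduced_top.
move: ia; rewrite ltnS leq_eqVlt => /predU1P[->|ia].
  rewrite echelon_top big1 ?add0r => [|r _]; last first.
    by rewrite echelon_top leqNgt kap_mono // mul0r.
  rewrite echelon_top leqnn; case: leqP => [kj|_]; last by rewrite mulr0.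
  by rewrite mulrA tu ?mul1r // kap_n.
rewrite !echelon_low // ltnn.
under eq_bigr => r _ do rewrite reduced_low // echelon_low // kap_mono //.
have am' := ltnW am; case: leqP => [kj|jk].
  have -> : \sum_(r < a) echelon a i (kap r) *
        (- (\sum_(kap a <= s < j) reduced a r s * u a s) * t a j) =
      - (\sum_(kap a <= s < j) echelon a i s * u a s) * t a j.
    under eq_bigr => r _ do rewrite mulrA mulrN mulr_sumr.
    rewrite -mulr_suml sumrN exchange_big /=; congr (- _ * _); rewrite !big_seq; apply: eq_bigr => s.
    rewrite mem_index_iota => /andP[ks sj]; rewrite (IH i s) // ?(ltn_trans sj) //.
    by rewrite mulr_suml; apply: eq_bigr => r _; rewrite mulrA.
  rewrite -mulrA (mulrA (t a _)) tu ?kap_n // mul1r -mulrDl; congr (_ * _).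
  by rewrite [X in _ + X](big_cat_nat kj (ltnW jn)) /= addrA addNr add0r.
by rewrite mulr0 addr0 -IH.
Qed.

(** The pivot columns form an upper triangular matrix with invertible diagonal, so back substitution
    applies; [d] in the proof makes it an induction from the last row upwards. *)
Lemma echelon_solve a (N N' : nat -> A) : (a <= m)%N ->
  (forall i, (i < a)%N -> \sum_(r < a) echelon a i (kap r) * N r =
    \sum_(r < a) echelon a i (kap r) * N' r) ->
  forall r, (r < a)%N -> N r = N' r.
Proof.
case: tP => tr tc tu ut am E.
suff H d r : (a <= r + d)%N -> (r < a)%N -> N r = N' r by move=> r; apply: (H a); exact: leq_addl.
elim: d r => [|d IH] r; first by rewrite addn0 leqNgt => /negbTE->.
move=> ard ra; have := E r ra; rewrite (bigD1 (Ordinal ra)) //= [X in _ = X -> _](bigD1 (Ordinal ra)) //= echelon_pivot //.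
have -> : \sum_(i < a | i != Ordinal ra) echelon a r (kap i) * N i =
    \sum_(i < a | i != Ordinal ra) echelon a r (kap i) * N' i.
  apply: eq_bigr => i; rewrite -val_eqE /= => ir; case: (ltngtP i r) ir => // [lt|gt] _.
    by rewrite echelon_left ?mul0r // kap_mono // (leq_trans ra).
  by rewrite IH // (leq_trans ard) // addnS -addSn leq_add2r.
move/addIr/(congr1 (fun z => u r (kap r) * z)).
have rm := leq_trans ra am.
by rewrite !mulrA ut ?mul1r // kap_n.
Qed.
End EchelonModel.

(** * The quantum torus *)

Section Operators.
Variables (k : fieldType) (G : zmodType).

(** Composition is associative by definition, so realizing the torus by operators on functions
    avoids a cocycle computation for a twisted product. *)
Record operator := Operator {
  op_fun :> (G -> k) -> G -> k;
  op_linear : forall c f g v,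
    op_fun (fun w => c * f w + g w) v = c * op_fun f v + op_fun g v }.

Lemma operatorP (F F' : operator) : (forall f v, F f v = F' f v) -> F = F'.
Proof.
case: F F' => F HF [F' HF'] /= E.
have FF' : F = F' by apply/funext => f; apply/funext => v.
by rewrite -FF' in HF' *; congr Operator; exact: Prop_irrelevance.
Qed.

HB.instance Definition _ := gen_eqMixin operator.
HB.instance Definition _ := gen_choiceMixin operator.

Program Definition op_zero := @Operator (fun _ _ => 0) _.
Next Obligation. by rewrite mulr0 addr0. Qed.
Program Definition op_opp (F : operator) := @Operator (fun f v => - F f v) _.
Next Obligation. by rewrite op_linear opprD mulrN. Qed.
Program Definition op_add (F F' : operator) := @Operator (fun f v => F f v + F' f v) _.
Next Obligation. by rewrite !op_linear mulrDr addrACA. Qed.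
Program Definition op_scale c (F : operator) := @Operator (fun f v => c * F f v) _.
Next Obligation. by rewrite !op_linear mulrDr mulrCA. Qed.
Definition op_one := @Operator (fun f => f) (fun _ _ _ _ => erefl _).
Program Definition op_mul (F F' : operator) := @Operator (fun f => F (F' f)) _.
Next Obligation.
rewrite -op_linear; congr (F _ v); apply/funext => w; exact: op_linear.
Qed.

Fact op_addA : associative op_add.
Proof. by move=> x y z; apply: operatorP => f v /=; rewrite addrA. Qed.
Fact op_addC : commutative op_add.
Proof. by move=> x y; apply: operatorP => f v /=; rewrite addrC. Qed.
Fact op_add0 : left_id op_zero op_add.
Proof. by move=> x; apply: operatorP => f v /=; rewrite add0r. Qed.
Fact op_addN : left_inverse op_zero op_opp op_add.
Proof. by move=> x; apply: operatorP => f v /=; rewrite addNr. Qed.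

HB.instance Definition _ := GRing.isZmodule.Build operator op_addA op_addC op_add0 op_addN.

Fact op_mulA : associative op_mul.
Proof. by move=> x y z; apply: operatorP. Qed.
Fact op_mul1 : left_id op_one op_mul.
Proof. by move=> x; apply: operatorP. Qed.
Fact op_mulr1 : right_id op_one op_mul.
Proof. by move=> x; apply: operatorP. Qed.
Fact op_mulDl : left_distributive op_mul op_add.
Proof. by move=> x y z; apply: operatorP. Qed.
Fact op_mulDr : right_distributive op_mul op_add.
Proof.
move=> x y z; apply: operatorP => f v /=.
rewrite -[x (y f) v]mul1r -op_linear; congr (x _ v); apply/funext => w /=.
by rewrite mul1r.
Qed.
Fact op_one_neq0 : op_one != op_zero.
Proof.
by apply/eqP => /(congr1 (fun F : operator => F (fun=> 1) 0)) /= /eqP; rewrite oner_eq0.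
Qed.

HB.instance Definition _ := GRing.Zmodule_isNzRing.Build operator
  op_mulA op_mul1 op_mulr1 op_mulDl op_mulDr op_one_neq0.

Fact op_scaleA a b (x : operator) : op_scale a (op_scale b x) = op_scale (a * b) x.
Proof. by apply: operatorP => f v /=; rewrite mulrA. Qed.
Fact op_scale1 : left_id 1 op_scale.
Proof. by move=> x; apply: operatorP => f v /=; rewrite mul1r. Qed.
Fact op_scaleDr : right_distributive op_scale +%R.
Proof. by move=> c x y; apply: operatorP => f v /=; rewrite mulrDr. Qed.
Fact op_scaleDl (x : operator) : {morph op_scale^~ x : a b / a + b}.
Proof. by move=> a b; apply: operatorP => f v /=; rewrite mulrDl. Qed.

HB.instance Definition _ := GRing.Zmodule_isLmodule.Build k operator
  op_scaleA op_scale1 op_scaleDr op_scaleDl.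

Fact op_scalerAl (c : k) (x y : operator) : c *: (x * y) = (c *: x) * y.
Proof. by apply: operatorP. Qed.

HB.instance Definition _ := GRing.Lmodule_isLalgebra.Build k operator op_scalerAl.

Fact op_scalerAr (c : k) (x y : operator) : c *: (x * y) = x * (c *: y).
Proof.
apply: operatorP => f v /=; rewrite -[RHS]/(x (fun w => c * y f w) v).
have E g : g = (fun w : G => 0 * 0 + g w) :> (G -> k).
  by apply/funext => w; rewrite mul0r add0r.
have -> : (fun w => c * y f w) = (fun w => c * y f w + 0).
  by apply/funext => w; rewrite addr0.
rewrite op_linear; have := @op_linear x (-1) (fun=> 0) (fun=> 0) v.
rewrite (_ : (fun=> _) = (fun=> 0)); last by apply/funext => w; rewrite mulr0 addr0.
by rewrite mulN1r addNr => ->; rewrite addr0.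
Qed.

HB.instance Definition _ := GRing.Lalgebra_isAlgebra.Build k operator op_scalerAr.
End Operators.

(** * Torus monomials, weights and leading terms *)

Section QuantumTorus.
Variables (k : fieldType) (q : k) (q0 : q != 0) (G : zmodType) (B : G -> G -> int).
Hypothesis Bl : forall u v w, B (u + v) w = B u w + B v w.
Hypothesis Br : forall u v w, B w (u + v) = B w u + B w v.

(** A shift twisted by the character [q ^ B u]; bilinearity of [B] turns composition into the torus
    product [monoM]. *)
Program Definition mono (u : G) : operator k G :=
  @Operator k G (fun f v => q ^ B u v * f (v + u)) _.
Next Obligation. by rewrite mulrDr mulrCA. Qed.

Lemma monoM u v : mono u * mono v = q ^ B v u *: mono (u + v).
Proof.
apply: operatorP => f w; rewrite -[LHS]/(q ^ B u w * (q ^ B v (w + u) * f (w + u + v))).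
rewrite -[RHS]/(q ^ B v u * (q ^ B (u + v) w * f (w + (u + v)))).
rewrite Br Bl !expfzDr // addrA !mulrA; congr (_ * _).
by rewrite mulrC mulrA.
Qed.

Lemma mono0 : mono 0 = 1.
Proof.
apply: operatorP => f w; rewrite -[RHS]/(f w) -[LHS]/(q ^ B 0 w * f (w + 0)).
have -> : B 0 w = 0 by apply: (addrI (B 0 w)); rewrite -Bl !addr0.
by rewrite expr0z mul1r addr0.
Qed.

(** Applied to the indicator of [u] and evaluated at 0, where all twists are trivial, a combination
    of monomials returns the coefficient of [mono u]. *)
Definition coef (u : G) (F : operator k G) : k := F (fun v => (v == u)%:R) 0.

Lemma coefD u F F' : coef u (F + F') = coef u F + coef u F'.
Proof. by []. Qed.

Lemma coefZ u c F : coef u (c *: F) = c * coef u F.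
Proof. by []. Qed.

Lemma coef_sum (I : Type) (r : seq I) (F : I -> operator k G) u :
  coef u (\sum_(i <- r) F i) = \sum_(i <- r) coef u (F i).
Proof. by elim: r => [|i r IH]; rewrite ?big_nil // !big_cons coefD IH. Qed.

Lemma coef_mono u v : coef u (mono v) = (v == u)%:R.
Proof.
rewrite /coef /= add0r; have -> : B v 0 = 0 by apply: (addrI (B v 0)); rewrite -Br !addr0.
by rewrite expr0z mul1r.
Qed.

Arguments coef : simpl never.
Variable wt : G -> int.
Hypothesis wtD : forall u v, wt (u + v) = wt u + wt v.

Inductive low (w : int) : operator k G -> Prop :=
| low0 : low w 0
| low_cons c v F : (wt v < w)%R -> low w F -> low w (c *: mono v + F).

Lemma lowD w F F' : low w F -> low w F' -> low w (F + F').
Proof.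
elim=> [|c v E vw _ IH] F'w; first by rewrite add0r.
by rewrite -addrA; apply: low_cons => //; exact: IH.
Qed.

Lemma lowZ w c F : low w F -> low w (c *: F).
Proof.
elim=> [|d v E vw _ IH]; first by rewrite scaler0; exact: low0.
by rewrite scalerDr scalerA; exact: low_cons.
Qed.

Lemma low_mono w v : (wt v < w)%R -> low w (mono v).
Proof.
by move=> vw; rewrite -[mono v]scale1r -[_ *: _]addr0; apply: low_cons => //; exact: low0.
Qed.

Lemma low_le w w' F : (w <= w')%R -> low w F -> low w' F.
Proof.
move=> ww'; elim=> [|c v E vw _ IH]; first exact: low0.
by apply: low_cons => //; exact: Order.POrderTheory.lt_le_trans ww'.
Qed.

Lemma low_sum w (I : eqType) (r : seq I) (F : I -> operator k G) :
  (forall i, i \in r -> low w (F i)) -> low w (\sum_(i <- r) F i).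
Proof.
elim: r => [|i r IH] Fw; first by rewrite big_nil; exact: low0.
rewrite big_cons; apply: lowD; first by apply: Fw; rewrite mem_head.
by apply: IH => j jr; apply: Fw; rewrite in_cons jr orbT.
Qed.

Lemma low_monoMl w u F : low w F -> low (wt u + w) (mono u * F).
Proof.
elim=> [|c v E vw _ IH]; first by rewrite mulr0; exact: low0.
rewrite mulrDr; apply: lowD => //; rewrite -scalerAr monoM.
by do 2!apply: lowZ; apply: low_mono; rewrite wtD ltrD2l.
Qed.

Lemma low_monoMr w u F : low w F -> low (w + wt u) (F * mono u).
Proof.
elim=> [|c v E vw _ IH]; first by rewrite mul0r; exact: low0.
rewrite mulrDl; apply: lowD => //; rewrite -scalerAl monoM.
by do 2!apply: lowZ; apply: low_mono; rewrite wtD ltrD2r.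
Qed.

Lemma lowM w w' F F' : low w F -> low w' F' -> low (w + w') (F * F').
Proof.
move=> Fw F'w'; elim: Fw => [|c v E vw _ IH]; first by rewrite mul0r; exact: low0.
rewrite mulrDl; apply: lowD => //; rewrite -scalerAl; apply: lowZ.
by apply: low_le (low_monoMl v F'w'); rewrite lerD2r ltW.
Qed.

Lemma coef_low w u F : (w <= wt u)%R -> low w F -> coef u F = 0.
Proof.
move=> wu; elim=> [//|c v E vw _ IH]; rewrite coefD coefZ coef_mono IH addr0.
have [vu|_] := eqVneq v u; last by rewrite mulr0.
by move: vw; rewrite vu ltNge wu.
Qed.

Definition lead (u : G) (F : operator k G) : Prop :=
  exists c L, [/\ c != 0, low (wt u) L & F = c *: mono u + L].

Lemma lead_mono u : lead u (mono u).
Proof. by exists 1, 0; split; [exact: oner_neq0 | exact: low0 | rewrite scale1r addr0]. Qed.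

Lemma leadZ c u F : c != 0 -> lead u F -> lead u (c *: F).
Proof.
move=> c0 [d [L [d0 Lu ->]]]; exists (c * d), (c *: L).
by rewrite mulf_neq0 // scalerDr scalerA; split=> //; exact: lowZ.
Qed.

Lemma leadD u F L : lead u F -> low (wt u) L -> lead u (F + L).
Proof.
move=> [d [L' [d0 L'u ->]]] Lu; exists d, (L' + L).
by rewrite addrA; split=> //; exact: lowD.
Qed.

Lemma leadM u v F F' : lead u F -> lead v F' -> lead (u + v) (F * F').
Proof.
move=> [c [L [c0 Lu ->]]] [d [L' [d0 L'v ->]]].
exists (c * d * q ^ B v u), (c *: (mono u * L') + (d *: (L * mono v) + L * L')).
split; first by rewrite !mulf_neq0 // expfz_neq0.
  rewrite wtD; apply: lowD; first by apply: lowZ; exact: low_monoMl.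
  by apply: lowD; [apply: lowZ; exact: low_monoMr | exact: lowM].
rewrite mulrDl !mulrDr -!scalerAl -!scalerAr monoM !scalerA !addrA.
by [].
Qed.

Lemma coef_lead u F : lead u F -> coef u F != 0.
Proof.
move=> [c [L [c0 Lu ->]]]; rewrite coefD coefZ coef_mono eqxx mulr1.
by rewrite (coef_low _ Lu) // addr0.
Qed.

Lemma coef_lead0 u v F : lead u F -> (wt u <= wt v)%R -> u != v -> coef v F = 0.
Proof.
move=> [c [L [c0 Lu ->]]] uv u_v; rewrite coefD coefZ coef_mono (negbTE u_v) mulr0.
by rewrite (coef_low uv Lu) addr0.
Qed.

(** Take an index of maximal weight among those with nonzero coefficient. Ties in weight are
    harmless: the exponents are distinct, so no other term of the sum contains that monomial. *)
Lemma lead_independent (I : eqType) (F : I -> operator k G) (e : I -> G) (s : seq I)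
    (c : I -> k) :
    (forall i, i \in s -> lead (e i) (F i)) -> uniq s -> {in s &, injective e} ->
  \sum_(i <- s) c i *: F i = 0 -> forall i, i \in s -> c i = 0.
Proof.
move=> Fe s_uniq e_inj F0.
have max (s' : seq I) : s' != [::] ->
    exists2 i, i \in s' & forall j, j \in s' -> (wt (e j) <= wt (e i))%R.
  elim: s' => // i [|j s'] IH _.
    by exists i; rewrite ?mem_head // => j; rewrite inE => /eqP->.
  have [//|l ls lmax] := IH; have [il|li] := lerP (wt (e i)) (wt (e l)).
    exists l => [|h]; first by rewrite in_cons ls orbT.
    by rewrite in_cons => /predU1P[->|/lmax].
  exists i => [|h]; first exact: mem_head.
  by rewrite in_cons => /predU1P[->//|/lmax/le_trans]; apply; exact: ltW.
have [s0|/max[i]] := eqVneq [seq i <- s | c i != 0] [::].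
  move=> i si; apply/eqP; apply: contraT => ci.
  by have := mem_filter (fun i => c i != 0) i s; rewrite s0 ci si.
rewrite mem_filter => /andP[ci si] imax.
have := congr1 (coef (e i)) F0; rewrite coef_sum (bigD1_seq i) //= coefZ big1_seq.
  rewrite addr0 => /eqP; rewrite mulf_eq0 (negbTE ci) (negbTE (coef_lead (Fe i si))).
  by [].
move=> j /andP[ji js]; rewrite coefZ; have [->|cj] := eqVneq (c j) 0; first by rewrite mul0r.
rewrite (coef_lead0 (Fe j js)) ?mulr0 // ?imax ?mem_filter ?cj //.
by apply: contra ji => /eqP/e_inj->.
Qed.
End QuantumTorus.

(** * Leading exponents of the reduced echelon form *)

Section TorusGrid.
Variables (k : fieldType) (q : k) (q0 : q != 0) (m n : nat).

Definition gridZ : zmodType := {ffun 'I_m * 'I_n -> int}.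

(** Zero when (i, j) lies outside the grid, which makes it total on natural numbers for the
    recursion [red_exp]. *)
Definition eps (i j : nat) : gridZ :=
  [ffun x : 'I_m * 'I_n => ((val x.1 == i) && (val x.2 == j))%:R].

(** Commutation sees only the antisymmetrized form. With this choice, generators in one row or one
    column q-commute, the earlier one first, and all other pairs commute. *)
Definition grid_order (x y : 'I_m * 'I_n) : int :=
  ((x.1 == y.1) && (y.2 < x.2)%N)%:R + ((x.2 == y.2) && (y.1 < x.1)%N)%:R.

Definition grid_form (u v : gridZ) : int := \sum_x \sum_y grid_order x y * u x * v y.

Lemma grid_formDl u v w : grid_form (u + v) w = grid_form u w + grid_form v w.
Proof.
rewrite /grid_form -big_split; apply: eq_bigr => x _; rewrite -big_split.
by apply: eq_bigr => y _; rewrite ffunE mulrDr mulrDl.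
Qed.

Lemma grid_formDr u v w : grid_form w (u + v) = grid_form w u + grid_form w v.
Proof.
rewrite /grid_form -big_split; apply: eq_bigr => x _; rewrite -big_split.
by apply: eq_bigr => y _; rewrite ffunE mulrDr.
Qed.

Lemma sum_eps (x : 'I_m * 'I_n) (F : 'I_m * 'I_n -> int) :
  \sum_y F y * eps x.1 x.2 y = F x.
Proof.
rewrite (bigD1 x) //= big1 => [|y ne]; rewrite ffunE ?eqxx ?mulr1 ?addr0 //.
by rewrite !val_eqE -[_ && _]/(y == (x.1, x.2)) -surjective_pairing (negbTE ne) mulr0.
Qed.

Lemma grid_form_eps (x y : 'I_m * 'I_n) :
  grid_form (eps x.1 x.2) (eps y.1 y.2) = grid_order x y.
Proof.
rewrite /grid_form; under eq_bigr => x' _ do rewrite sum_eps.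
exact: (sum_eps x (fun x' => grid_order x' y)).
Qed.

Lemma grid_form_epsE i j i' j' : (i < m)%N -> (j < n)%N -> (i' < m)%N -> (j' < n)%N ->
  grid_form (eps i j) (eps i' j') =
    ((i == i') && (j' < j)%N)%:R + ((j == j') && (i' < i)%N)%:R.
Proof.
move=> im jn im' jn'.
exact: (grid_form_eps (Ordinal im, Ordinal jn) (Ordinal im', Ordinal jn')).
Qed.

(** Moving a box one column to the right in row [i] lowers the weight by [i]; the different rates in
    different rows are what single out a leading term in [lead_reduced]. *)
Definition weight (u : gridZ) : int := - \sum_(x : 'I_m * 'I_n) (x.1 * x.2)%N%:R * u x.

Lemma weightD u v : weight (u + v) = weight u + weight v.
Proof.
rewrite /weight -opprD -big_split; congr (- _); apply: eq_bigr => x _.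
by rewrite ffunE mulrDr.
Qed.

Lemma weight_eps i j : (i < m)%N -> (j < n)%N -> weight (eps i j) = - (i * j)%N%:R.
Proof.
move=> im jn; rewrite /weight; congr (- _).
exact: (sum_eps (Ordinal im, Ordinal jn) (fun x => (x.1 * x.2)%N%:R)).
Qed.

Lemma weightN u : weight (- u) = - weight u.
Proof.
apply: (addrI (weight u)); rewrite -weightD !subrr /weight.
by rewrite big1 ?oppr0 // => x _; rewrite ffunE mulr0.
Qed.

Definition gridt i j : operator k gridZ := mono q grid_form (eps i j).
Definition gridtV i j : operator k gridZ := mono q grid_form (- eps i j).

Lemma grid_formNl u v : grid_form (- u) v = - grid_form u v.
Proof.
apply: (addrI (grid_form u v)); rewrite -grid_formDl !subrr.
by apply: (addrI (grid_form 0 v)); rewrite -grid_formDl !addr0.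
Qed.

Lemma grid_formNr u v : grid_form u (- v) = - grid_form u v.
Proof.
apply: (addrI (grid_form u v)); rewrite -grid_formDr !subrr.
by apply: (addrI (grid_form u 0)); rewrite -grid_formDr !addr0.
Qed.

Lemma mono_qcomm u v (c : k) : q ^ (grid_form v u - grid_form u v) = c ->
  qcomm c (mono q grid_form u) (mono q grid_form v).
Proof.
move=> <-; rewrite /qcomm !(monoM q0 grid_formDl grid_formDr) scalerA -expfzDr // subrK.
by rewrite addrC.
Qed.

Lemma grid_torus : torus_grid q m n gridt gridtV.
Proof.
split=> [a j l am jl ln|a b j l ab bm jn ln|a j am jn|a j am jn].
- have jn := ltn_trans jl ln; apply: mono_qcomm.
  by rewrite !grid_form_epsE // !eqxx jl ltnn !andbF addr0 (ltnNge l) (ltnW jl) subr0.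
- have am := ltn_trans ab bm; apply: mono_qcomm.
  rewrite !grid_form_epsE // (gtn_eqF ab) (ltn_eqF ab) [l == j]eq_sym ab.
  by rewrite (ltnNge b) (ltnW ab) !andbF !add0r subr0 andbT; case: (j == l).
- rewrite /gridt /gridtV (monoM q0 grid_formDl grid_formDr) subrr grid_formNl.
  rewrite grid_form_epsE // !ltnn !andbF addr0 oppr0 expr0z scale1r.
  exact: mono0 grid_formDl.
- rewrite /gridt /gridtV (monoM q0 grid_formDl grid_formDr) addNr grid_formNr.
  rewrite grid_form_epsE // !ltnn !andbF addr0 oppr0 expr0z scale1r.
  exact: mono0 grid_formDl.
Qed.

Variable kap : nat -> nat.
Hypothesis kap_mono : forall a b, (a < b)%N -> (b < m)%N -> (kap a < kap b)%N.
Hypothesis kap_n : forall a, (a < m)%N -> (kap a < n)%N.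

Local Notation lead := (lead q grid_form weight).
Local Notation low := (low q grid_form weight).
Local Notation reduced := (reduced gridt gridtV kap).

(* The exponent of the leading term of [reduced a r j]; in each row [b > r] the
   leading term moves from column [j] to column [j - 1] when [kap b < j]. *)
Fixpoint red_exp a r j : gridZ :=
  if a is a'.+1 then
    if r == a' then eps a' j - eps a' (kap a')
    else if (j < kap a')%N then red_exp a' r j
    else red_exp a' r j.-1 + (eps a' j - eps a' j.-1)
  else 0.

Definition nonpivot a r j :=
  [/\ (r < a)%N, (kap r < j)%N, (j < n)%N & forall b, (b < a)%N -> j != kap b].

Lemma red_exp_step a r j : (a <= m)%N -> (r < a)%N -> (j.+1 < n)%N ->
  (forall b, (b < a)%N -> (kap b < j)%N) ->
  weight (red_exp a r j.+1) = weight (red_exp a r j) - r%:R.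
Proof.
elim: a j => // a IH j am ra jn kj; have jn' := ltnW jn.
rewrite /= (ltnNge j.+1) (ltnNge j); have [ra'|ar|ra'] := ltngtP r a.
- rewrite (ltnW (kj a _)) // (leqW (ltnW (kj a _))) //=.
  case: j jn jn' kj => [|j] jn jn' kj; first by have := kj a (ltnSn a).
  rewrite !weightD !weightN !weight_eps // ?(ltnW jn') //= IH ?(ltnW am) //.
    by rewrite !mulnS !natrD; ring.
  move=> b ba; rewrite -ltnS; apply: leq_trans (kj a (ltnSn a)).
  by rewrite ltnS kap_mono.
- by move: ra; rewrite ltnS leqNgt ar.
- rewrite ra' !weightD !weightN !weight_eps ?kap_n // mulnS natrD; ring.
Qed.

Lemma red_exp_weight a r j d : (a < m)%N -> (r < a)%N -> (j + d < n)%N -> (kap a <= j)%N ->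
  weight (red_exp a r j) = weight (red_exp a r (j + d)) + (r * d)%N%:R.
Proof.
move=> am ra; elim: d => [|d IH] jn kj; first by rewrite addn0 muln0 addr0.
rewrite IH // ?addnS ?red_exp_step ?(ltnW am) //; last 3 first.
- by rewrite -addnS.
- by move=> b ba; apply: leq_trans (leq_addr d j); apply: leq_trans kj; exact: kap_mono.
- by rewrite -addnS ltnW // -addnS.
by rewrite mulnS natrD; ring.
Qed.

(** In the recursive sum, moving [s] one column to the right lowers the weight of [red_exp a r s] by
    [r] while [- eps a s] raises it by [a]. As [r < a], the last summand dominates. *)
Lemma lead_reduced a r j : (a <= m)%N -> nonpivot a r j ->
  lead (red_exp a r j) (reduced a r j).
Proof.
elim: a j => [j _ [] //|a IH j am [ra rj jn jk]].
have leadM := leadM q0 grid_formDl grid_formDr weightD.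
case: (ltngtP r a) ra => [ra _|ar|ra _]; last 2 first.
- by rewrite ltnS leqNgt ar.
- rewrite {}ra in rj jk *; rewrite reduced_top ltnNge ltnW //= eqxx addrC.
  by apply: leadM; exact: lead_mono.
rewrite reduced_low //= ltn_eqF //.
have jk' b : (b < a)%N -> j != kap b by move=> ba; apply: jk; exact: leqW.
have [jka|kaj] := ltnP j (kap a); first by apply: IH => //; exact: ltnW.
have {}kaj : (kap a < j)%N by rewrite ltn_neqAle eq_sym jk.
case: j => // j in rj jn jk jk' kaj *; rewrite ltnS in kaj.
have np s : (kap a <= s)%N -> (s < n)%N -> nonpivot a r s.
  move=> ks sn; split=> //; first by apply: leq_trans ks; exact: kap_mono.
  by move=> b ba; rewrite gtn_eqF //; apply: leq_trans ks; exact: kap_mono.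
have jn' := ltnW jn; have am' := ltnW am.
have leadR s : (kap a <= s)%N -> (s < n)%N ->
    lead (red_exp a r s - eps a s) (reduced a r s * gridtV a s).
  by move=> ks sn; apply: leadM; [apply: IH => //; exact: np | exact: lead_mono].
rewrite big_nat_recr //= mulNr -mulrN -scaleN1r -scalerAr; apply: leadZ.
  by rewrite oppr_eq0 oner_neq0.
rewrite addrA addrAC; apply: leadM; last exact: lead_mono.
rewrite [_ + reduced a r j * _]addrC; apply: leadD; first exact: leadR.
apply: low_sum => s; rewrite mem_index_iota => /andP[ks sj].
have sn := ltn_trans sj jn'; have [c [L [_ Lw ->]]] := leadR s ks sn.
have lt : (weight (red_exp a r s - eps a s)%R < weight (red_exp a r j - eps a j)%R)%R.
  pose d := (j - s)%N; have d0 : (0 < d)%N by rewrite subn_gt0.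
  have jE : (s + d)%N = j by rewrite subnKC // ltnW.
  have ajE : (a * j)%N = (a * s + a * d)%N by rewrite -mulnDr jE.
  rewrite !weightD !weightN !weight_eps // !opprK ajE natrD.
  rewrite (@red_exp_weight a r s d) ?jE // -addrA ltrD2l addrC ltrD2l.
  by rewrite ltr_nat ltn_pmul2r.
apply: lowD; last exact: low_le (ltW lt) Lw.
by apply: lowZ; exact: low_mono.
Qed.

Lemma red_exp_row a r j (x : 'I_m * 'I_n) : (a <= x.1)%N -> red_exp a r j x = 0.
Proof.
elim: a r j => [r j _|a IH r j ax] /=; first by rewrite ffunE.
case: ifP => _; first by rewrite !ffunE (gtn_eqF ax) subrr.
have ax' := ltnW ax; case: ifP => _; first exact: IH.
by rewrite !ffunE IH // (gtn_eqF ax) subrr.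
Qed.

(** On the rows before [a] the exponents of step [a.+1] are those of step [a], shifted by one column
    beyond [kap a], so the induction hypothesis kills the coefficients with [r < a]. Row [a] then
    reads off the remaining ones. *)
Lemma red_exp_independent a (f : nat -> nat -> int) : (a <= m)%N ->
    (forall r j, ~ nonpivot a r j -> f r j = 0) ->
    (forall x, \sum_(r < a) \sum_(0 <= j < n) f r j * red_exp a r j x = 0) ->
  forall r j, f r j = 0.
Proof.
elim: a f => [f _ f0 _ r j|a IH f am f0 fE]; first by apply: f0 => -[].
have kn := kap_n am; have n0 : (0 < n)%N by exact: leq_trans kn.
have fk b : (b <= a)%N -> forall r, f r (kap b) = 0.
  by move=> ba r; apply: f0 => -[_ _ _ /(_ b ba)]; rewrite eqxx.
(* Undoes the shift: column [kap a], where [f] vanishes, is skipped, and the last column, which then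
   has no source, receives 0. *)
pose f' r s := if (r < a)%N then
  (if (s < kap a)%N then f r s else if (s.+1 < n)%N then f r s.+1 else 0) else 0.
have f'0 r s : f' r s = 0.
  apply: IH => [|{}r {}s np|x]; first exact: ltnW.
    rewrite /f'; case: ltnP => // ra; case: ltnP => [sk|ks].
      apply: f0 => -[_ rs sn jk]; apply: np; split=> // b ba; apply: jk; exact: leqW.
    case: ltnP => // sn; apply: f0 => -[_ rs _ jk]; apply: np; split=> //.
    - by apply: leq_trans ks; exact: kap_mono.
    - exact: ltnW.
    - by move=> b ba; rewrite gtn_eqF //; apply: leq_trans ks; exact: kap_mono.
  have [ax|xa] := leqP a x.1.
    by rewrite big1 // => i _; rewrite big1 // => j _; rewrite red_exp_row ?mulr0.
  rewrite -[RHS](fE x) big_ord_recr /= [X in _ = _ + X]big1 ?addr0 => [|j _]; last first.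
    by rewrite eqxx !ffunE (ltn_eqF xa) subrr mulr0.
  apply: eq_bigr => i _; rewrite (ltn_eqF (ltn_ord i)) (big_cat_nat (leq0n (kap a)) (ltnW kn)).
  rewrite [RHS](big_cat_nat (leq0n (kap a)) (ltnW kn)) /=; congr (_ + _).
    by rewrite !big_nat; apply: eq_bigr => j /andP[_ jk]; rewrite /f' ltn_ord jk.
  rewrite [RHS]big_ltn // fk // mul0r add0r.
  have kn1 : (kap a <= n.-1)%N by rewrite -ltnS prednK.
  rewrite big_add1 (big_cat_nat kn1 (leq_pred n)) /= [X in _ + X]big1_seq ?addr0; last first.
    move=> l /andP[_]; rewrite mem_index_iota => /andP[ns sn]; rewrite /f' ltn_ord.
    rewrite (ltnNge l) (leq_trans kn1 ns) ltnNge -{1}(prednK n0) ltnS ns /=.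
    by rewrite mul0r.
  rewrite !big_nat; apply: eq_bigr => j /andP[kj jn].
  have jn' : (j.+1 < n)%N by rewrite -(prednK n0) ltnS.
  rewrite /f' ltn_ord (ltnNge j) kj jn' /= (ltnNge j.+1) (leqW kj) /=.
  by rewrite !ffunE (ltn_eqF xa) subrr addr0.
move=> r j; have [ra|ar] := ltnP r a.
  have [jn|nj] := ltnP j n; last by apply: f0 => -[_ _]; rewrite ltnNge nj.
  have := f'0 r; rewrite /f' ra; case: (ltngtP j (kap a)) => [jk|kj|->] F; last exact: fk.
    by have := F j; rewrite jk.
  case: j => // j in jn kj *; have := F j.
  by rewrite (ltnNge j) -ltnS kj jn.
have [ra|ne] := eqVneq r a; last first.
  by apply: f0 => -[]; rewrite ltnS leq_eqVlt (negbTE ne) ltnNge ar.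
have [[_ kj jn _]|] := pselect (nonpivot a.+1 r j); last exact: f0.
rewrite {}ra in kj *; have := fE (Ordinal am, Ordinal jn).
rewrite big_ord_recr /= big1 ?add0r => [|i _]; last first.
  rewrite big1 // => s _; have := f'0 i; rewrite /f' ltn_ord => F.
  case: (ltngtP s (kap a)) => [sk|ks|->]; last by rewrite fk // mul0r.
    by have := F s; rewrite sk => ->; rewrite mul0r.
  case: s => // s in ks *; have := F s; rewrite (ltnNge s) -ltnS ks /=.
  case: ltnP => [_ ->|ns _]; first by rewrite mul0r.
  by rewrite f0 ?mul0r // => -[_ _]; rewrite ltnNge ns.
rewrite (bigD1_seq j) ?iota_uniq ?mem_index_iota //= eqxx !ffunE /= !eqxx.
rewrite (gtn_eqF kj) subr0 mulr1 big1 ?addr0 // => s sj.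
have [->|sk] := eqVneq s (kap a); first by rewrite fk // mul0r.
by rewrite !ffunE /= [j == s]eq_sym (negbTE sj) (gtn_eqF kj) !andbF subrr mulr0.
Qed.
End TorusGrid.

(** * Maps out of the localized Schubert variety *)

Section QuantumMatrixMaps.
Variables (k : fieldType) (q : k) (m n : nat) (B : algType k) (X : 'I_m -> 'I_n -> B).

Definition qmx_free_map : free_alg k (qmx_gen m n) -> B :=
  free_eval (fun ij : qmx_gen m n => X ij.1 ij.2).

HB.instance Definition _ := GRing.LRMorphism.on qmx_free_map.

Hypothesis XP : qmatrix q X.

Lemma qmx_free_map_rel y : qmx_rel q y -> qmx_free_map y = 0.
Proof.
have var i j : qmx_free_map (free_var k ((i, j) : qmx_gen m n)) = X i j by exact: free_eval_var.
case: XP => Xr Xc Xa Xd; case=> [i j l jl|i r j ir|i r j l ri jl|i r j l ir jl].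
- by rewrite linearB linearZ /= !rmorphM /= !var Xr // subrr.
- by rewrite linearB linearZ /= !rmorphM /= !var Xc // subrr.
- by rewrite linearB /= !rmorphM /= !var (Xa r i j l) // subrr.
- by rewrite !linearB linearZ /= !rmorphM /= !var Xd // -addrA -opprD subrr.
Qed.

Definition qmx_map : qmx q m n -> B := quot_lift (qmx_proper q m n) qmx_free_map_rel.

HB.instance Definition _ := GRing.LRMorphism.on qmx_map.

Lemma qmx_map_x i j : qmx_map (qmx_x q i j) = X i j.
Proof. by rewrite /qmx_map /qmx_x quot_lift_pi; exact: free_eval_var. Qed.

Lemma qmx_map_coldet S cs : qmx_map (coldet q (@qmx_x k q m n) S cs) = coldet q X S cs.
Proof.
elim: cs S => [|c cs IH] S /=; first exact: rmorph1.
rewrite linear_sum /=; apply: eq_bigr => i _.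
by rewrite linearZ rmorphM /= qmx_map_x IH.
Qed.
End QuantumMatrixMaps.

Section SchubertMaps.
Variables (k : fieldType) (q : k) (m n : nat) (gamma : Pi m n).
Variables (B : algType k) (X : 'I_m -> 'I_n -> B) (h : B).
Hypothesis XP : qmatrix q X.

Local Notation br S := (coldet q X setT (enum S)).

Hypothesis brX0 : forall alpha : Pi m n, ~~ st_le gamma alpha -> br (val alpha) = 0.
Hypotheses (gh : br (val gamma) * h = 1) (hg : h * br (val gamma) = 1).

Definition qgrass_map : qgrass q m n -> B := qmx_map XP \o @subalg_val _ _ _.

HB.instance Definition _ := GRing.LRMorphism.on qgrass_map.

Lemma qgrass_map_plucker alpha : qgrass_map (plucker q alpha) = br (val alpha).
Proof. by rewrite /qgrass_map /= qminorE qmx_map_coldet. Qed.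

Lemma qgrass_map_rel y : schubert_rel gamma y -> qgrass_map y = 0.
Proof. by case=> alpha alpha_gamma ->; rewrite qgrass_map_plucker brX0. Qed.

Definition schubert_map : schubert q gamma -> B := quot_lift (schubert_proper q gamma) qgrass_map_rel.

HB.instance Definition _ := GRing.LRMorphism.on schubert_map.

Lemma schubert_map_plucker alpha : schubert_map (schubert_plucker q gamma alpha) = br (val alpha).
Proof.
rewrite /schubert_map /schubert_plucker quot_lift_pi; exact: qgrass_map_plucker.
Qed.

Lemma schubert_map_invr : schubert_map (schubert_plucker q gamma gamma) * h = 1.
Proof. by rewrite schubert_map_plucker. Qed.

Lemma schubert_map_invl : h * schubert_map (schubert_plucker q gamma gamma) = 1.
Proof. by rewrite schubert_map_plucker. Qed.

Definition schubert_loc_map : schubert_loc q gamma -> B :=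
  quot_lift (schubert_loc_proper q gamma) (loc_free_eval_rel schubert_map_invr schubert_map_invl).

HB.instance Definition _ := GRing.LRMorphism.on schubert_loc_map.

Lemma schubert_loc_map_in x :
  schubert_loc_map (loc_in (schubert_loc_proper q gamma) x) = schubert_map x.
Proof. by rewrite /schubert_loc_map /loc_in quot_lift_pi; exact: free_eval_var. Qed.

Lemma schubert_loc_map_inv :
  schubert_loc_map (loc_inv (schubert_loc_proper q gamma)) = h.
Proof. by rewrite /schubert_loc_map /loc_inv quot_lift_pi; exact: free_eval_var. Qed.
End SchubertMaps.

(** * Minors of the echelon matrix and the exchange of pivots *)

Section PivotSets.
Variables m n : nat.
Implicit Types I J : Pi m n.

Lemma val_elt I : val I = elt I @: setT.
Proof.
apply/setP => x; apply/idP/imsetP => [/eltP[r ->]|[r _ ->]]; first by exists r.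
exact: mem_elt.
Qed.

Lemma sum_elt (V : nmodType) I (F : 'I_n -> V) :
  \sum_(c in val I) F c = \sum_r F (elt I r).
Proof.
rewrite val_elt big_imset /=; last by move=> r s _ _; exact: elt_inj.
by apply: eq_bigl => r; rewrite inE.
Qed.

Lemma rk_elt I v : rk (val I) v = (\sum_r (elt I r < v))%N.
Proof.
rewrite /rk val_elt big_imset /=; last by move=> r s _ _; exact: elt_inj.
by apply: eq_bigl => r; rewrite inE.
Qed.

Lemma st_le_rk I J v : st_le I J -> (rk (val J) v <= rk (val I) v)%N.
Proof.
move=> /forallP IJ; rewrite !rk_elt; apply: leq_sum => r _.
by case: (ltnP (elt J r)) => // /(leq_ltn_trans (IJ r)) ->.
Qed.

Lemma st_le_exchange (gamma alpha : Pi m n) (c a : 'I_n) : c \in val gamma -> a \notin val gamma ->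
  (a < c)%N -> val alpha = a |: val gamma :\ c -> ~~ st_le gamma alpha.
Proof.
move=> cg ag ac E; apply/negP => /(st_le_rk a.+1); rewrite E rk_setU1 ?inE ?(negbTE ag) ?andbF //.
by rewrite rk_setD1_ge // ltnS leqnn add1n ltnn.
Qed.

Lemma exchange_card (gamma : Pi m n) (c a : 'I_n) : c \in val gamma -> a \notin val gamma ->
  #|a |: val gamma :\ c| == m.
Proof.
move=> cg ag; rewrite cardsU1 !inE (negbTE ag) andbF.
by apply/eqP; have := eqP (valP gamma); rewrite (cardsD1 c (val gamma)) cg.
Qed.
End PivotSets.

Lemma leq_elt m n (I : Pi m n) (r s : 'I_m) : (r <= s)%N -> (elt I r <= elt I s)%N.
Proof.
by rewrite leq_eqVlt => /predU1P[/val_inj->//|/(elt_ltn I)/ltnW].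
Qed.

Lemma card_ord_lt m v : (v <= m)%N -> #|[set r : 'I_m | (r < v)%N]| = v.
Proof.
move=> vm; rewrite -sum1_card big_mkcond /= -[RHS](minn_idPl vm) -sum_ltn_ord.
by apply: eq_bigr => r _; rewrite inE; case: ltnP.
Qed.

Lemma prodr_eq0 (R : pzRingType) (I : eqType) (i : I) (s : seq I) (F : I -> R) :
  i \in s -> F i = 0 -> \prod_(j <- s) F j = 0.
Proof.
move=> + Fi; elim: s => // j s IH; rewrite in_cons big_cons => /predU1P[<-|/IH->].
  by rewrite Fi mul0r.
by rewrite mulr0.
Qed.

Section TorusCell.
Variables (k : fieldType) (q : k).
Hypotheses (q0 : q != 0) (hq : forall l : nat, (0 < l)%N -> q ^+ l != 1).
Variables (m n : nat) (gamma : Pi m n).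

Definition pivot (r : nat) : nat := if insub r is Some i then elt gamma i : nat else 0%N.

Lemma pivotE (i : 'I_m) : pivot i = elt gamma i.
Proof. by rewrite /pivot valK. Qed.

Lemma pivot_mono a b : (a < b)%N -> (b < m)%N -> (pivot a < pivot b)%N.
Proof.
move=> ab bm; have am := ltn_trans ab bm.
rewrite -[a]/(val (Ordinal am)) -[b]/(val (Ordinal bm)) !pivotE; exact: elt_ltn.
Qed.

Lemma pivot_n a : (a < m)%N -> (pivot a < n)%N.
Proof. by move=> am; rewrite -[a]/(val (Ordinal am)) pivotE. Qed.

Local Notation T := (operator k (gridZ m n)).
Local Notation t := (@gridt k q m n).
Local Notation u := (@gridtV k q m n).

Definition echX (i : 'I_m) (j : 'I_n) : T := echelon n t u pivot m i j.

Lemma echX_qmatrix : qmatrix q echX.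
Proof.
have [Yr Yc Ya Yd] := echelon_qmatrix q0 (grid_torus q0 m n) pivot_n (leqnn m).
split=> [i j l jl|i r j ir|i r j l ir jl|i r j l ir jl].
- exact: Yr.
- exact: Yc.
- exact: Ya.
- exact: Yd.
Qed.

Lemma echX_left i (j : 'I_n) : (j < elt gamma i)%N -> echX i j = 0.
Proof.
by move=> ji; apply: (echelon_left n t u pivot_mono); rewrite ?pivotE.
Qed.

Lemma echX_pivot i : echX i (elt gamma i) = t i (elt gamma i).
Proof.
by rewrite /echX -pivotE; apply: (echelon_pivot n t u pivot_mono).
Qed.

Local Notation br S := (coldet q echX setT (enum S)).

Lemma br_perm (alpha : Pi m n) : br (val alpha) =
  \sum_(s : 'S_m) (- q) ^+ perm_length s *: \prod_(r < m) echX (s r) (elt alpha r).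
Proof.
rewrite enum_elt.
by have := coldet_perm q echX (elt alpha) (fun (a b : 'I_m) ab => ab); rewrite imset_id.
Qed.

(** If the column [elt alpha r0] is left of the pivot of row [r0], the pigeonhole principle gives,
    for every permutation, some [r <= r0] sent to a row [>= r0]; the entry there is left of its
    pivot. *)
Lemma br_echX0 (alpha : Pi m n) : ~~ st_le gamma alpha -> br (val alpha) = 0.
Proof.
move=> /forallPn[r0]; rewrite -ltnNge => ar0; rewrite br_perm big1 // => s _.
have [r rr0 sr] : exists2 r : 'I_m, (r <= r0)%N & (r0 <= s r)%N.
  apply/exists_inP; apply: contraT => /exists_inPn H.
  have : s @: [set r : 'I_m | (r < r0.+1)%N] \subset [set r : 'I_m | (r < r0)%N].
    apply/subsetP => _ /imsetP[r rr0 ->]; rewrite inE ltnS in rr0; rewrite inE ltnNge.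
    exact: H.
  move/subset_leq_card; rewrite card_imset; last exact: perm_inj.
  by rewrite !card_ord_lt ?ltnn // ltnW.
rewrite (@prodr_eq0 _ _ r) ?mem_index_enum ?scaler0 // echX_left //.
apply: leq_trans (leq_ltn_trans _ ar0) _; first by rewrite (leq_elt _ rr0).
by rewrite leq_elt.
Qed.

(** A permutation that raises no index is the identity, since the sum of its values is fixed. Any
    other one meets an entry left of a pivot, so only the diagonal survives. *)
Lemma br_echX_pivot : br (val gamma) = \prod_(r < m) t r (elt gamma r).
Proof.
rewrite br_perm (bigD1 (1%g : 'S_m)) //= perm_length1 expr0 scale1r [X in _ + X]big1 ?addr0 => [|s s1].
  by apply: eq_bigr => r _; rewrite perm1 echX_pivot.
have [r rs] : exists r : 'I_m, (r < s r)%N.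
  apply/existsP; apply: contraR s1 => /existsPn H; apply/eqP/permP => r; rewrite perm1.
  have le i : (s i <= i)%N by rewrite leqNgt; exact: H.
  apply/val_inj/eqP; rewrite eqn_leq le leqNgt; apply/negP => lt.
  have : (\sum_i s i < \sum_(i : 'I_m) i)%N.
    rewrite (bigD1 r) //= [X in (_ < X)%N](bigD1 r) //= -addSn leq_add //.
    by apply: leq_sum.
  by rewrite -(reindex_inj (@perm_inj _ s) (P := predT) (F := fun i : 'I_m => (i : nat))) ltnn.
by rewrite (@prodr_eq0 _ _ r) ?mem_index_enum ?scaler0 // echX_left // elt_ltn.
Qed.

Lemma br_echX_inv : exists h, br (val gamma) * h = 1 /\ h * br (val gamma) = 1.
Proof.
rewrite br_echX_pivot; case: (grid_torus q0 m n) => _ _ tu ut.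
elim: (index_enum _) => [|r s [h [gh hg]]]; first by exists 1; rewrite big_nil mulr1.
exists (h * u r (elt gamma r)); rewrite big_cons; split.
  by rewrite -mulrA (mulrA _ h) gh mul1r tu.
by rewrite -mulrA (mulrA (u _ _)) ut // mul1r.
Qed.

Lemma br_echX_plucker : plucker_axiom q m (fun S => br S).
Proof. by move=> J K _ Km; exact: plucker_relation echX_qmatrix J K Km. Qed.

Lemma br_echX_left c a : c \in val gamma -> a \notin val gamma -> (a < c)%N ->
  br (a |: val gamma :\ c) = 0.
Proof.
move=> cg ag ac; pose alpha : Pi m n := exist (fun S : {set 'I_n} => #|S| == m) _ (exchange_card cg ag).
rewrite -[_ |: _]/(val alpha); apply: br_echX0.
exact: (st_le_exchange cg ag ac).
Qed.

Variable h : T.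
Hypotheses (gh : br (val gamma) * h = 1) (hg : h * br (val gamma) = 1).

(** Cramer's rule: [row_plucker] on the pivots and [a] writes column [a] through the pivot columns
    with the cell generators as coefficients, up to scalars. The reduced form does the same, and the
    coefficients are unique by [echelon_solve]. *)
Lemma lead_cellgen (r : 'I_m) (a : 'I_n) : a \notin val gamma -> (elt gamma r < a)%N ->
  lead q (@grid_form m n) (@weight m n) (red_exp m n pivot m r a)
    (cellgen (fun S => br S) (val gamma) h (elt gamma r) a).
Proof.
move=> ag ra; pose K := a |: val gamma.
have Km : #|K| = m.+1 by rewrite /K cardsU1 ag (eqP (valP gamma)).
(* The power of [- q] at [c] relative to the one at [a], negated because the term of [a] is moved to
   the other side. *)
pose co (c : nat) := - (- q) ^- rk K a * (- q) ^+ rk K c.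
have q1 l : (- q) ^+ l != 0 by rewrite expf_neq0 // oppr_eq0.
have co0 c : co c != 0 by rewrite /co mulf_neq0 // oppr_eq0 invr_eq0.
pose N (i : nat) := if insub i is Some i' then
  co (elt gamma i') *: cellgen (fun S => br S) (val gamma) h (elt gamma i') a else 0.
have NE (i : 'I_m) : N i = co (elt gamma i) *:
    cellgen (fun S => br S) (val gamma) h (elt gamma i) a by rewrite /N valK.
suff E : N r = reduced t u pivot m r a.
  have -> : cellgen (fun S => br S) (val gamma) h (elt gamma r) a =
      (co (elt gamma r))^-1 *: reduced t u pivot m r a.
    by rewrite -E NE scalerA mulVf // scale1r.
  apply: leadZ; first by rewrite invr_eq0.
  apply: lead_reduced => //; [exact: pivot_mono | exact: pivot_n |].
  split=> //; first by rewrite pivotE.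
  move=> b bm; rewrite -[b]/(val (Ordinal bm)) pivotE; apply: contraNneq ag => /val_inj->.
  exact: mem_elt.
apply: (echelon_solve (N := N) (N' := fun r => reduced t u pivot m r a)
  (grid_torus q0 m n) pivot_mono pivot_n (leqnn m)) => // i im.
rewrite -(echelon_reduced (grid_torus q0 m n) pivot_mono pivot_n im (leqnn m)) //.
rewrite -[i]/(val (Ordinal im)) -/(echX (Ordinal im) a).
have := row_plucker q0 hq echX_qmatrix (Ordinal im) Km.
rewrite /K big_setU1 //= setU1K // => /(congr1 (fun z => z * h)).
rewrite mul0r mulrDl -scalerAl -mulrA gh mulr1 mulr_suml => /eqP.
rewrite addr_eq0 => /eqP/(congr1 (fun z => (- q) ^- rk K a *: z)).
rewrite scalerA mulVf // scale1r => ->; rewrite -sumrN scaler_sumr.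
rewrite sum_elt; apply: eq_bigr => s _; rewrite NE.
rewrite pivotE -[echelon _ _ _ _ _ _ _]/(echX (Ordinal im) (elt gamma s)) -scalerAr /co mulNr scaleNr scalerN; congr (- _).
rewrite -scalerAl scalerA -mulrA; congr (_ *: (_ * _)).
suff -> : (a |: val gamma) :\ elt gamma s = a |: val gamma :\ elt gamma s by [].
apply/setP => x; rewrite !inE; have [->|//] := eqVneq x a.
by rewrite andbT; apply: contraNneq ag => ->; exact: mem_elt.
Qed.
End TorusCell.

(** * Words in the boxes of a Young diagram *)

Section PartitionMatrix.
Variables (k : fieldType) (p : k) (a b : nat) (lam : 'I_a -> nat).

(** The relations are required inside the diagram only. The cell generators vanish outside it, and a
    diagonal relation across the boundary would force [Y i l * Y r j = 0]. *)
Definition partition_matrix (A : algType k) (Y : 'I_a -> 'I_b -> A) : Prop :=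
  [/\ forall i (j l : 'I_b), (j < l)%N -> (l < lam i)%N ->
        Y i j * Y i l = p *: (Y i l * Y i j),
      forall (i r : 'I_a) (j : 'I_b), (i < r)%N -> (j < lam r)%N ->
        Y i j * Y r j = p *: (Y r j * Y i j),
      forall (i r : 'I_a) (j l : 'I_b), (i < r)%N -> (j < l)%N ->
        (l < lam i)%N -> (j < lam r)%N -> Y i l * Y r j = Y r j * Y i l &
      forall (i r : 'I_a) (j l : 'I_b), (i < r)%N -> (j < l)%N -> (l < lam r)%N ->
        Y i j * Y r l = Y r l * Y i j + (p - p^-1) *: (Y i l * Y r j)].

Lemma qmatrix_partition_matrix (A : algType k) (Y : 'I_a -> 'I_b -> A) :
  qmatrix p Y -> partition_matrix Y.
Proof.
case=> Yr Yc Ya Yd; split=> *; [exact: Yr | exact: Yc | exact: Ya | exact: Yd].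
Qed.

Lemma pair_partition_matrix (A B : algType k) (Y : 'I_a -> 'I_b -> A) (Z : 'I_a -> 'I_b -> B) :
  partition_matrix Y -> partition_matrix Z ->
  partition_matrix (fun i j => (Y i j, Z i j) : (A * B)%type).
Proof.
case=> Yr Yc Ya Yd [Zr Zc Za Zd]; split=> [i j l jl li|i r j ir jr|i r j l ir jl li jr|i r j l ir jl lr];
  apply: injective_projections => /=; by [exact: Yr | exact: Yc | exact: Ya | exact: Yd
    | exact: Zr | exact: Zc | exact: Za | exact: Zd].
Qed.

Definition box : eqType := ('I_a * 'I_b)%type.

Definition box_le (x y : box) : bool :=
  (x.1 < y.1)%N || ((x.1 == y.1) && (x.2 <= y.2)%N).

Definition inside (w : seq box) : bool := all (fun x : box => x.2 < lam x.1)%N w.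

(** Termination measure of the straightening: replacing (i, j), (r, l) by (i, l), (r, j) lowers it
    by (r - i)(l - j). *)
Definition box_weight (w : seq box) : nat := (\sum_(x <- w) x.1 * x.2)%N.

Definition normal_word (w : seq box) : bool := sorted box_le w && inside w.

Lemma box_le_total : total box_le.
Proof.
move=> x y; rewrite /box_le -!val_eqE /=.
by case: (ltngtP x.1 y.1) => //= _; exact: leq_total.
Qed.

Lemma box_le_trans : transitive box_le.
Proof. by move=> y x z; rewrite /box_le -!val_eqE /=; lia. Qed.

Lemma box_le_anti : antisymmetric box_le.
Proof.
move=> [x1 x2] [y1 y2] H; suff [E1 E2] : (x1 = y1 :> nat) /\ (x2 = y2 :> nat).
  by congr (_, _); exact: val_inj.
by move: H; rewrite /box_le -!val_eqE /=; lia.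
Qed.

Section Words.
Variables (A : algType k) (Y : 'I_a -> 'I_b -> A).

Definition word (w : seq box) : A := \prod_(x <- w) Y x.1 x.2.

Lemma word_cons x w : word (x :: w) = Y x.1 x.2 * word w.
Proof. by rewrite /word big_cons. Qed.

Lemma word_cat v w : word (v ++ w) = word v * word w.
Proof. by rewrite /word big_cat. Qed.

Inductive word_span (P : seq box -> Prop) : A -> Prop :=
| word_span0 : word_span P 0
| word_spanD c w x : P w -> word_span P x -> word_span P (c *: word w + x).

Section WordSpan.
Variable P : seq box -> Prop.

Lemma word_span_add x y : word_span P x -> word_span P y -> word_span P (x + y).
Proof.
elim=> [|c w z Pw _ IH] Py; first by rewrite add0r.
by rewrite -addrA; apply: word_spanD => //; exact: IH.
Qed.

Lemma word_span_scale c x : word_span P x -> word_span P (c *: x).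
Proof.
elim=> [|d w z Pw _ IH]; first by rewrite scaler0; exact: word_span0.
by rewrite scalerDr scalerA; exact: word_spanD.
Qed.

Lemma word_span_word w : P w -> word_span P (word w).
Proof.
by move=> Pw; rewrite -[word w]scale1r -[_ *: _]addr0; apply: word_spanD => //; exact: word_span0.
Qed.

Lemma word_span_sub (Q : seq box -> Prop) x :
  (forall w, Q w -> word_span P (word w)) -> word_span Q x -> word_span P x.
Proof.
move=> QP; elim=> [|c w z Qw _ IH]; first exact: word_span0.
by apply: word_span_add => //; apply: word_span_scale; exact: QP.
Qed.

Lemma word_span_mul (Q R : seq box -> Prop) x y :
  (forall v w, Q v -> R w -> P (v ++ w)) ->
  word_span Q x -> word_span R y -> word_span P (x * y).
Proof.
move=> QR Qx Ry; elim: Qx => [|c v z Qv _ IH]; first by rewrite mul0r; exact: word_span0.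
rewrite mulrDl; apply: word_span_add => //; rewrite -scalerAl; apply: word_span_scale.
elim: Ry => [|d w u Rw _ IHw]; first by rewrite mulr0; exact: word_span0.
rewrite mulrDr; apply: word_span_add => //; rewrite -scalerAr -word_cat.
by apply: word_span_scale; apply: word_span_word; exact: QR.
Qed.

(** Merges repeated words, since [words_independent] speaks of families without duplicates. *)
Lemma word_span_sum x : word_span P x ->
  exists (s : seq (seq box)) (c : seq box -> k),
    [/\ uniq s, forall w, w \in s -> P w & x = \sum_(w <- s) c w *: word w].
Proof.
elim=> [|d v z Pv _ [s [c [us sP ->]]]].
  by exists [::], (fun=> 0); split; rewrite ?big_nil.
have [vs|vs] := boolP (v \in s).
  exists s, (fun w => if w == v then c w + d else c w); split=> //.
  rewrite (bigD1_seq v) //= [RHS](bigD1_seq v) //= eqxx scalerDl -addrA addrCA.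
  by do 2!congr (_ + _); apply: eq_bigr => w /negbTE->.
exists (v :: s), (fun w => if w == v then d else c w); split=> [|w|].
- by rewrite /= vs.
- by rewrite in_cons => /predU1P[->|/sP].
rewrite big_cons eqxx; congr (_ + _); rewrite !big_seq; apply: eq_bigr => w ws.
by case: eqP vs => // <-; rewrite ws.
Qed.
End WordSpan.

Definition lighter (e : nat) (w : seq box) : Prop := inside w /\ (box_weight w < e)%N.

Hypothesis p0 : p != 0.
Hypothesis lam_anti : {homo lam : i i' / (i <= i')%N >-> (i' <= i)%N}.
Hypothesis YP : partition_matrix Y.

(** Only the diagonal relation produces a second word. Its boxes (i, l) and (r, j) are inside
    because [l < lam r] and [lam] is weakly decreasing. *)
Lemma word_swap (x y : box) : inside [:: x; y] -> exists c,
  word_span (lighter (box_weight [:: x; y])) (word [:: x; y] - c *: word [:: y; x]).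
Proof.
have [Yr Yc Ya Yd] := YP.
have E (u v : box) : word [:: u; v] = Y u.1 u.2 * Y v.1 v.2.
  by rewrite /word !big_cons big_nil mulr1.
have trivial (u v : box) c : word [:: u; v] = c *: word [:: v; u] ->
    exists d, word_span (lighter (box_weight [:: u; v])) (word [:: u; v] - d *: word [:: v; u]).
  by move=> ->; exists c; rewrite subrr; exact: word_span0.
have inv (u v : box) c : c != 0 -> word [:: u; v] = c *: word [:: v; u] ->
    word [:: v; u] = c^-1 *: word [:: u; v].
  by move=> c0 ->; rewrite scalerA mulVf // scale1r.
have corr (i r : 'I_a) (j l : 'I_b) (e : k) (u v : box) : (i < r)%N -> (j < l)%N -> (l < lam r)%N ->
    perm_eq [:: u; v] [:: (i, j); (r, l)] ->
    word [:: u; v] = 1 *: word [:: v; u] + e *: word [:: (i, l); (r, j)] ->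
    exists d, word_span (lighter (box_weight [:: u; v])) (word [:: u; v] - d *: word [:: v; u]).
  move=> ir jl lr uv ->; exists 1; rewrite addrC addrA addNr add0r; apply: word_span_scale.
  apply: word_span_word; split.
    by rewrite /inside /= (leq_trans lr (lam_anti (ltnW ir))) (ltn_trans jl lr).
  by rewrite {2}/box_weight (perm_big _ uv) /= /box_weight !big_cons !big_nil /=; nia.
case: x y => [i j] [r l]; rewrite /inside /= andbT => /andP[ji lr].
case: (ltngtP i r) => [ir|ri|/val_inj E1].
- case: (ltngtP j l) => [jl|lj|/val_inj E2].
  + apply: (corr i r j l (p - p^-1)) => //.
    by rewrite !E scale1r /= (Yd i r j l).
  + by apply: (trivial _ _ 1); rewrite !E scale1r; exact: Ya.
  + by subst l; apply: (trivial _ _ p); rewrite !E /= Yc.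
- case: (ltngtP j l) => [jl|lj|/val_inj E2].
  + by apply: (trivial _ _ 1); rewrite !E scale1r; exact/esym/Ya.
  + apply: (corr r i l j (- (p - p^-1))) => //; first by rewrite perm_sym (perm_catC [:: _]).
    by rewrite !E scale1r /= (Yd r i l j) // scaleNr addrK.
  + by subst l; apply: (trivial _ _ p^-1); apply: inv => //; rewrite !E /= Yc.
- subst r; case: (ltngtP j l) => [jl|lj|/val_inj E2].
  + by apply: (trivial _ _ p); rewrite !E /= Yr.
  + by apply: (trivial _ _ p^-1); apply: inv => //; rewrite !E /= Yr.
  + by subst l; apply: (trivial _ _ 1); rewrite scale1r.
Qed.

Lemma box_weight_cat v w : box_weight (v ++ w) = (box_weight v + box_weight w)%N.
Proof. by rewrite /box_weight big_cat. Qed.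

Lemma inside_cat v w : inside (v ++ w) = inside v && inside w.
Proof. exact: all_cat. Qed.

Lemma word_context c v w s t e :
  inside s -> inside t ->
  word_span (lighter e) (word v - c *: word w) ->
  word_span (lighter (box_weight s + e + box_weight t)%N)
    (word (s ++ v ++ t) - c *: word (s ++ w ++ t)).
Proof.
move=> si ti H; rewrite !word_cat.
have -> : word s * (word v * word t) - c *: (word s * (word w * word t)) =
    word s * (word v - c *: word w) * word t.
  by rewrite mulrBr mulrBl -scalerAr -scalerAl !mulrA.
apply: (@word_span_mul _ (lighter (box_weight s + e)) (eq t)) => [v' _ [v'i v'e] <-|
  |]; last exact: word_span_word.
  by split; rewrite ?inside_cat ?v'i // box_weight_cat ltn_add2r.
apply: (@word_span_mul _ (eq s) (lighter e)) => [_ v' <- [v'i v'e]| |//].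
  by split; rewrite ?inside_cat ?si // box_weight_cat ltn_add2l.
exact: word_span_word.
Qed.

Lemma word_congr_trans c d u v w e :
  word_span (lighter e) (word u - c *: word v) ->
  word_span (lighter e) (word v - d *: word w) ->
  word_span (lighter e) (word u - (c * d) *: word w).
Proof.
move=> uv vw.
have -> : word u - (c * d) *: word w =
    (word u - c *: word v) + c *: (word v - d *: word w).
  by rewrite scalerBr scalerA addrA subrK.
by apply: word_span_add => //; exact: word_span_scale.
Qed.

Lemma word_move x v t : inside (x :: v ++ t) -> exists c,
  word_span (lighter (box_weight (x :: v ++ t)))
    (word (x :: v ++ t) - c *: word (v ++ x :: t)).
Proof.
elim: v => [|y v IH] xvt.
  by exists 1; rewrite scale1r subrr; exact: word_span0.
move: (xvt); rewrite -[_ :: _]/([:: x; y] ++ (v ++ t)) inside_cat => /andP[xy vt].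
have [c cP] := word_swap xy.
have xvt' : inside (x :: v ++ t) by move: xy vt; rewrite /inside /= => /and3P[-> _ _] ->.
have [d dP] := IH xvt'.
exists (c * d); apply: word_congr_trans.
  have := @word_context _ _ _ [::] _ _ isT vt cP.
  rewrite /=; congr word_span; congr lighter.
  by rewrite /box_weight !big_cons !big_nil; lia.
have yi : inside [:: y] by move: xy; rewrite /inside /= => /and3P[_ ->].
have := @word_context _ _ _ [:: y] [::] _ yi isT dP.
rewrite /= !cats0; congr word_span; congr lighter.
by rewrite /box_weight !big_cons !big_nil; lia.
Qed.

Lemma word_perm v w : inside v -> perm_eq v w -> exists c,
  word_span (lighter (box_weight v)) (word v - c *: word w).
Proof.
elim: v w => [|x v IH] w.
  by move=> _; rewrite perm_sym => /perm_nilP->; exists 1; rewrite scale1r subrr; exact: word_span0.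
move=> xv vw; have xw : x \in w by rewrite -(perm_mem vw) mem_head.
case/splitPr: w / xw vw => s t vw.
have vst : perm_eq v (s ++ t).
  by rewrite -(perm_cons x); apply: perm_trans vw _; exact: permEl (perm_catCA s [:: x] t).
have [xi vi] : inside [:: x] /\ inside v by move: xv; rewrite /inside /= => /andP[-> ->].
have [c cP] := IH _ vi vst.
have xst : inside (x :: s ++ t) by move: xv; rewrite /inside /= (perm_all _ vst).
have [d dP] := word_move xst.
exists (c * d); apply: word_congr_trans.
  have := @word_context _ _ _ [:: x] [::] _ xi isT cP.
  rewrite /= !cats0; congr word_span; congr lighter.
  by rewrite /box_weight !big_cons !big_nil !addn0.
by move: dP; rewrite /box_weight !big_cons (perm_big _ vst).
Qed.

(** Sorting a word costs a scalar and lighter words, which are normalized by induction on the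
    weight. *)
Lemma word_span_normal w : inside w -> word_span (fun v => normal_word v) (word w).
Proof.
move: {2}(box_weight w).+1 (ltnSn (box_weight w)) => e; elim: e w => // e IH w we wi.
have ws : perm_eq w (sort box_le w) by rewrite perm_sym perm_sort.
have [c cP] := word_perm wi ws.
rewrite -[word w](subrK (c *: word (sort box_le w))); apply: word_span_add.
  apply: word_span_sub cP => v [vi vw]; apply: IH => //.
  exact: leq_trans vw _.
apply: word_span_scale; apply: word_span_word.
rewrite /normal_word (sort_sorted box_le_total) /=.
by rewrite /inside -(perm_all _ ws).
Qed.

Definition is_entry (y : A) : Prop := exists i (j : 'I_b), (j < lam i)%N /\ y = Y i j.

Lemma gen_word_span z : in_gen is_entry z -> word_span (fun v => normal_word v) z.
Proof.
move=> zG; apply: (@word_span_sub _ (fun v => inside v)); first exact: word_span_normal.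
elim: zG => [x [i [j [ji ->]]]||x y _ IHx _ IHy|c x y _ IHx _ IHy].
- have -> : Y i j = word [:: (i, j) : box] by rewrite word_cons /word big_nil mulr1.
  by apply: word_span_word; rewrite /inside /= ji.
- have -> : 1 = word [::] by rewrite /word big_nil.
  exact: word_span_word.
- apply: word_span_mul IHx IHy => v w vi wi.
  by rewrite inside_cat vi.
- by apply: word_span_add => //; exact: word_span_scale.
Qed.

Definition words_independent : Prop := forall (s : seq (seq box)) (c : seq box -> k),
  uniq s -> (forall w, w \in s -> normal_word w) -> \sum_(w <- s) c w *: word w = 0 ->
  forall w, w \in s -> c w = 0.
End Words.

Lemma word_morph (A B : algType k) (Y : 'I_a -> 'I_b -> A) (f : {lrmorphism A -> B}) w :
  f (word Y w) = word (fun i j => f (Y i j)) w.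
Proof. by rewrite /word rmorph_prod. Qed.

Lemma words_independent_morph (A B : algType k) (Y : 'I_a -> 'I_b -> A) (Z : 'I_a -> 'I_b -> B)
    (f : {lrmorphism A -> B}) :
    (forall i j, f (Y i j) = Z i j) -> words_independent Z -> words_independent Y.
Proof.
move=> fY indZ s c us sN /(congr1 f) E; apply: indZ => //.
rewrite -[RHS](raddf0 f) -[RHS]E linear_sum; apply: eq_bigr => w _.
rewrite linearZ /= word_morph; congr (_ *: _); apply: eq_bigr => x _; exact/esym/fY.
Qed.
End PartitionMatrix.

(** * The generators of the cell *)

Section Columns.
Variables m n : nat.
Variable gamma : Pi m n.

Lemma card_complement : #|~: val gamma| == (n - m)%N.
Proof. by rewrite cardsCs setCK card_ord (eqP (valP gamma)). Qed.

Definition complement : Pi (n - m) n :=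
  exist (fun S : {set 'I_n} => #|S| == (n - m)%N) _ card_complement.

(* The nonpivot columns, in decreasing order. *)
Definition free_col (j : 'I_(n - m)) : 'I_n := elt complement (rev_ord j).

Definition cell_shape (i : 'I_m) : nat := #|[set j | (elt gamma i < free_col j)%N]|.

Lemma free_col_notin j : free_col j \notin val gamma.
Proof. by have := mem_elt complement (rev_ord j); rewrite /= inE. Qed.

Lemma free_colP (a : 'I_n) : a \notin val gamma -> exists j, a = free_col j.
Proof.
move=> ag; have [|r ->] := @eltP _ _ complement a; first by rewrite /= inE.
by exists (rev_ord r); rewrite /free_col rev_ordK.
Qed.

Lemma free_col_lt (j l : 'I_(n - m)) : (j < l)%N -> (free_col l < free_col j)%N.
Proof.
move=> jl; apply: elt_ltn => /=; have := ltn_ord l; have := ltn_ord j; lia.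
Qed.

Lemma free_col_inj : injective free_col.
Proof. by move=> j l /elt_inj/rev_ord_inj. Qed.

(** The free columns decrease with [j], so those to the right of a given pivot form an initial
    segment, whose length is the row length of the diagram. *)
Lemma cell_shapeP i (j : 'I_(n - m)) : (j < cell_shape i)%N = (elt gamma i < free_col j)%N.
Proof.
have mono (l l' : 'I_(n - m)) : (l <= l')%N -> (free_col l' <= free_col l)%N.
  by rewrite leq_eqVlt => /predU1P[/val_inj->//|/free_col_lt/ltnW].
have [ij|ji] := ltnP (elt gamma i) (free_col j).
  rewrite -(@card_ord_lt (n - m) j.+1) //; apply/subset_leq_card/subsetP => l.
  by rewrite !inE ltnS => /mono; exact: leq_trans.
apply/negbTE; rewrite -leqNgt -(@card_ord_lt (n - m) j) ?(ltnW (ltn_ord j)) //.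
apply/subset_leq_card/subsetP => l; rewrite !inE; rewrite !ltnNge; apply: contra.
by move/mono => lj; exact: leq_trans ji.
Qed.

Lemma cell_shape_partition : is_partition (n - m) cell_shape.
Proof.
split=> [i|i i' ii']; first by rewrite -[X in (_ <= X)%N]card_ord max_card.
apply/subset_leq_card/subsetP => j; rewrite !inE; exact: leq_ltn_trans (leq_elt _ ii').
Qed.
End Columns.

Section CellMatrix.
Variables (k : fieldType) (q : k).
Hypotheses (q0 : q != 0) (hq : forall l : nat, (0 < l)%N -> q ^+ l != 1).
Variables (m n : nat) (gamma : Pi m n) (A : algType k) (br : {set 'I_n} -> A) (h : A).
Hypothesis brP : plucker_axiom q m br.
Hypotheses (gh : br (val gamma) * h = 1) (hg : h * br (val gamma) = 1).
Hypothesis br0 : forall c a, c \in val gamma -> a \notin val gamma -> (a < c)%N ->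
  br (a |: val gamma :\ c) = 0.

Definition cell_matrix (i : 'I_m) (j : 'I_(n - m)) : A :=
  cellgen br (val gamma) h (elt gamma i) (free_col gamma j).

(** Numbering the free columns backwards reverses the row relations, and [elt gamma i] with the
    smaller [i] now comes first in a column; this is why the parameter becomes [q^-1]. *)
Lemma cell_matrix_partition : partition_matrix q^-1 (cell_shape gamma) cell_matrix.
Proof.
have gm := eqP (valP gamma); have out := free_col_notin gamma.
have same_pivot := cellgen_same_pivot q0 brP gm gh hg br0.
have same_col := cellgen_same_column q0 brP gm gh hg br0.
have antidiag := cellgen_antidiagonal q0 hq brP gm gh hg br0.
have diag := cellgen_diagonal q0 hq brP gm gh hg br0.
split=> [i j l jl li|i r j ir jr|i r j l ir jl li jr|i r j l ir jl lr].
- rewrite /cell_matrix [cellgen _ _ _ _ (free_col _ l) * _]same_pivot ?mem_elt ?free_col_lt //.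
  by rewrite scalerA mulVf // scale1r.
- rewrite /cell_matrix (same_col (elt gamma i)) ?mem_elt ?elt_ltn //.
  by rewrite scalerA mulVf // scale1r.
- by apply: antidiag; rewrite ?mem_elt ?free_col_lt ?(elt_ltn gamma) -?cell_shapeP.
- have li : (l < cell_shape gamma i)%N.
    by rewrite cell_shapeP; apply: ltn_trans (elt_ltn gamma ir) _; rewrite -cell_shapeP.
  have jr : (j < cell_shape gamma r)%N by exact: ltn_trans lr.
  have E1 : cell_matrix i l * cell_matrix r j = cell_matrix r j * cell_matrix i l.
    by apply: antidiag; rewrite ?mem_elt ?free_col_lt ?(elt_ltn gamma) -?cell_shapeP.
  have E2 : cell_matrix r l * cell_matrix i j =
      cell_matrix i j * cell_matrix r l + (q - q^-1) *: (cell_matrix r j * cell_matrix i l).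
    by apply: diag; rewrite ?mem_elt ?free_col_lt ?(elt_ltn gamma) -?cell_shapeP.
  by rewrite E1 E2 invrK; lin_coefs k; ring.
Qed.
End CellMatrix.

Section TorusWords.
Variables (k : fieldType) (q : k).
Hypotheses (q0 : q != 0) (hq : forall l : nat, (0 < l)%N -> q ^+ l != 1).
Variables (m n : nat) (gamma : Pi m n) (h : operator k (gridZ m n)).

Local Notation br := (fun S : {set 'I_n} => coldet q (echX q gamma) setT (enum S)).

Hypotheses (gh : br (val gamma) * h = 1) (hg : h * br (val gamma) = 1).

Local Notation piv := (pivot gamma).
Local Notation E := (red_exp m n piv m).

Definition word_exp (w : seq (box m (n - m))) : gridZ m n :=
  \sum_(x <- w) E x.1 (free_col gamma x.2).

Definition col_count (w : seq (box m (n - m))) (r c : nat) : nat :=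
  count (fun x : box m (n - m) => (val x.1 == r) && (val (free_col gamma x.2) == c)) w.

Lemma word_expE w y :
  word_exp w y = \sum_(r < m) \sum_(0 <= c < n) (col_count w r c)%:R * E r c y.
Proof.
rewrite /word_exp; elim: w => [|x w IH].
  rewrite big_nil ffunE big1 // => r _; rewrite big1 // => c _.
  by rewrite mul0r.
rewrite big_cons ffunE IH.
have -> : E x.1 (free_col gamma x.2) y = \sum_(r < m) \sum_(0 <= c < n)
    ((val x.1 == r) && (val (free_col gamma x.2) == c))%:R * E r c y.
  rewrite (bigD1 x.1) //= [X in _ + X]big1 ?addr0 => [|r rx]; last first.
    by rewrite big1 // => c _; rewrite val_eqE eq_sym (negbTE rx) mul0r.
  rewrite (bigD1_seq (val (free_col gamma x.2))) ?iota_uniq ?mem_index_iota //=.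
  rewrite !eqxx mul1r big1 ?addr0 // => c cx.
  by rewrite eq_sym (negbTE cx) andbF mul0r.
rewrite -big_split; apply: eq_bigr => r _; rewrite -big_split; apply: eq_bigr => c _ /=.
by rewrite /col_count /= natrD mulrDl.
Qed.

Lemma inside_nonpivot w r c : inside (cell_shape gamma) w -> ~ nonpivot n piv m r c ->
  col_count w r c = 0%N.
Proof.
move=> /allP win np; apply/eqP; rewrite -leqn0 leqNgt -has_count; apply/hasPn => x xw.
apply/negP => /andP[/eqP xr /eqP xc]; apply: np; rewrite -{}xr -{}xc.
have := win x xw; rewrite cell_shapeP => lt.
have lt' : (piv (val x.1) < free_col gamma x.2)%N by rewrite (pivotE gamma x.1).
split; [exact: ltn_ord | exact: lt' | exact: ltn_ord | move=> b bm].
rewrite -[b]/(val (Ordinal bm)) pivotE; apply: contraNneq (free_col_notin gamma x.2).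
by move=> /val_inj->; exact: mem_elt.
Qed.

(** By independence of the [red_exp], the exponent determines how often each box occurs, and a
    sorted word is determined by these multiplicities. *)
Lemma word_exp_inj w w' : normal_word (cell_shape gamma) w -> normal_word (cell_shape gamma) w' ->
  word_exp w = word_exp w' -> w = w'.
Proof.
move=> /andP[ws wi] /andP[w's w'i] ww'.
apply: (sorted_eq (@box_le_trans _ _) (@box_le_anti _ _) ws w's).
have f0 r c : (col_count w r c)%:R - (col_count w' r c)%:R = 0 :> int.
  apply: (@red_exp_independent m n piv (@pivot_mono _ _ gamma) (@pivot_n _ _ gamma) m
    (fun r c => (col_count w r c)%:R - (col_count w' r c)%:R) (leqnn m)).
  - by move=> {}r {}c np; rewrite !inside_nonpivot // subrr.
  - move=> y; under eq_bigr => {}r _.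
      under eq_bigr => {}c _ do rewrite mulrBl.
      rewrite sumrB; over.
    by rewrite sumrB /= -!word_expE ww' subrr.
apply/allP => x _ /=.
have cnt v : count_mem x v = col_count v x.1 (free_col gamma x.2).
  apply: eq_count => y /=; rewrite !val_eqE (inj_eq (@free_col_inj _ _ gamma)).
  by case: x y => [x1 x2] [y1 y2].
rewrite !cnt; have /eqP := f0 x.1 (free_col gamma x.2).
by rewrite subr_eq0 eqr_nat.
Qed.

Lemma torus_words_independent :
  words_independent (cell_shape gamma) (cell_matrix gamma br h).
Proof.
move=> s c us sN; apply: (lead_independent (@grid_formDr m n) (wt := @weight m n) (e := word_exp)) => //.
- move=> w /sN/andP[_]; rewrite /word_exp; elim: w => [_|x w IH].
    rewrite /word !big_nil -(@mono0 _ q _ (@grid_form m n)); last exact: grid_formDl.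
    exact: lead_mono.
  case/andP => xi /IH; rewrite word_cons big_cons.
  apply: (leadM q0 (@grid_formDl m n) (@grid_formDr m n) (@weightD m n)).
  by apply: lead_cellgen => //; [exact: free_col_notin | rewrite -cell_shapeP].
- by move=> w w' /sN wN /sN w'N; exact: word_exp_inj.
Qed.
End TorusWords.

(** * The isomorphism *)

Lemma in_gen_morph (k : fieldType) (A B : algType k) (f : {lrmorphism A -> B})
    (P : A -> Prop) (Q : B -> Prop) :
  (forall x, P x -> in_gen Q (f x)) -> forall x, in_gen P x -> in_gen Q (f x).
Proof.
move=> PQ x; elim=> [y /PQ//||y z _ IHy _ IHz|c y z _ IHy _ IHz].
- by rewrite rmorph1; exact: in_gen1.
- by rewrite rmorphM; exact: in_genM.
- by rewrite linearP; exact: in_gen_lin.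
Qed.

Lemma in_gen_sub (k : fieldType) (A : algType k) (P Q : A -> Prop) :
  (forall x, P x -> in_gen Q x) -> forall x, in_gen P x -> in_gen Q x.
Proof. exact: (@in_gen_morph _ _ _ idfun). Qed.

Lemma in_gen0 (k : fieldType) (A : algType k) (P : A -> Prop) : in_gen P 0.
Proof. by rewrite -(addNr 1) -scaleN1r; apply: in_gen_lin; exact: in_gen1. Qed.

Lemma plucker_axiom_morph (k : fieldType) (A B : algType k) (f : {lrmorphism A -> B})
    (q : k) m n (br : {set 'I_n} -> A) :
  plucker_axiom q m br -> plucker_axiom q m (f \o br).
Proof.
move=> brP J K Jm Km; have := congr1 f (brP J K Jm Km); rewrite raddf0 linear_sum => E.
by rewrite -[RHS]E; apply: eq_bigr => c _; rewrite linearZ /= rmorphM.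
Qed.

(** * Homogeneous elements of the localization *)

Section LocalDegree.
Variables (k : fieldType) (A : algType k) (q : k) (q0 : q != 0) (P : A -> Prop) (g h : A).
Hypotheses (gh : g * h = 1) (hg : h * g = 1).
Hypothesis gP : forall x, P x -> g * x = q *: (x * g).

(** Conjugation by [g] rescales the generators, hence preserves the algebra they generate; powers of
    [g] and [h] can thus be moved to the right. *)
Let conj_g x : in_gen P x -> exists2 y, in_gen P y & g * x = y * g.
Proof.
elim=> [y Py||y z _ [y' y'P Ey] _ [z' z'P Ez]|c y z _ [y' y'P Ey] _ [z' z'P Ez]].
- exists (q *: y + 0); first by apply: in_gen_lin; [exact: in_gen_gen | exact: in_gen0].
  by rewrite addr0 -scalerAl gP.
- by exists 1; [exact: in_gen1 | rewrite mulr1 mul1r].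
- by exists (y' * z'); [exact: in_genM | rewrite mulrA Ey -mulrA Ez mulrA].
- exists (c *: y' + z'); first exact: in_gen_lin.
  by rewrite mulrDr mulrDl -scalerAr Ey Ez scalerAl.
Qed.

Let conj_h x : in_gen P x -> exists2 y, in_gen P y & h * x = y * h.
Proof.
elim=> [y Py||y z _ [y' y'P Ey] _ [z' z'P Ez]|c y z _ [y' y'P Ey] _ [z' z'P Ez]].
- exists (q^-1 *: y + 0); first by apply: in_gen_lin; [exact: in_gen_gen | exact: in_gen0].
  have E : y * g = q^-1 *: (g * y) by rewrite gP // scalerA mulVf // scale1r.
  rewrite addr0 -[LHS]mulr1 -gh mulrA -(mulrA h y g) E -scalerAr mulrA hg mul1r.
  by [].
- by exists 1; [exact: in_gen1 | rewrite mulr1 mul1r].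
- by exists (y' * z'); [exact: in_genM | rewrite mulrA Ey -mulrA Ez mulrA].
- exists (c *: y' + z'); first exact: in_gen_lin.
  by rewrite mulrDr mulrDl -scalerAr Ey Ez scalerAl.
Qed.

(** Keeping both exponents, without reducing to one power, lets two elements of equal degree be
    brought to the same power product by padding with [ghD] and then added. *)
Definition local_degree (d : int) (x : A) : Prop := exists a b z,
  [/\ d = a%:Z - b%:Z, in_gen P z & x = z * (g ^+ a * h ^+ b)].

Let gh_comm : GRing.comm g h. Proof. by rewrite /GRing.comm gh hg. Qed.

Let ghX a : g ^+ a * h ^+ a = 1.
Proof. by rewrite -(exprMn_comm _ gh_comm) gh expr1n. Qed.

Let ghD a b c : g ^+ a * h ^+ b = g ^+ (a + c) * h ^+ (c + b).
Proof. by rewrite !exprD -mulrA (mulrA (g ^+ c)) ghX mul1r. Qed.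

Let conj_ghX a b x : in_gen P x ->
  exists2 y, in_gen P y & (g ^+ a * h ^+ b) * x = y * (g ^+ a * h ^+ b).
Proof.
move=> xP.
have [y yP Ey] : exists2 y, in_gen P y & h ^+ b * x = y * h ^+ b.
  elim: b x xP => [|b IH] x xP; first by exists x; rewrite ?mul1r ?mulr1.
  have [y /conj_h[z zP Ez] Ey] := IH x xP; exists z => //.
  by rewrite exprS -mulrA Ey mulrA Ez mulrA.
have [z zP Ez] : exists2 z, in_gen P z & g ^+ a * y = z * g ^+ a.
  elim: a {x xP Ey} y yP => [|a IH] y yP; first by exists y; rewrite ?mul1r ?mulr1.
  have [z /conj_g[u uP Eu] Ez] := IH y yP; exists u => //.
  by rewrite exprS -mulrA Ez mulrA Eu mulrA.
by exists z => //; rewrite -mulrA Ey mulrA Ez mulrA.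
Qed.

Lemma local_degree_gen d x : in_gen P x -> d = 0 -> local_degree d x.
Proof. by move=> xP ->; exists 0%N, 0%N, x; rewrite subrr mul1r mulr1. Qed.

Lemma local_degree0 d : local_degree d 0.
Proof.
have [a [b ->]] : exists a b : nat, d = a%:Z - b%:Z.
  by case: d => a; [exists a, 0%N | exists 0%N, a.+1]; rewrite ?NegzE ?subr0 ?sub0r.
by exists a, b, 0; rewrite mul0r; split=> //; exact: in_gen0.
Qed.

Lemma local_degreeM d e x y : local_degree d x -> local_degree e y -> local_degree (d + e) (x * y).
Proof.
move=> [a [b [z [-> zP ->]]]] [a' [b' [z' [-> z'P ->]]]].
have [w wP Ew] := conj_ghX a b z'P; exists (a + a')%N, (b + b')%N, (z * w); split.
- by rewrite !PoszD; ring.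
- exact: in_genM.
have -> : g ^+ (a + a') * h ^+ (b + b') = (g ^+ a * h ^+ b) * (g ^+ a' * h ^+ b').
  rewrite !exprD -!mulrA; congr (_ * _); rewrite !mulrA; congr (_ * _).
  by apply: commrX; apply: commr_sym; apply: commrX; exact: commr_sym.
move: Ew; set u := g ^+ a * h ^+ b; set v := g ^+ a' * h ^+ b' => Ew.
by rewrite mulrA -(mulrA z u z') Ew !mulrA.
Qed.

Lemma local_degree_lin d c x y : local_degree d x -> local_degree d y ->
  local_degree d (c *: x + y).
Proof.
move=> [a [b [z [-> zP ->]]]] [a' [b' [z' [dE z'P ->]]]].
exists (a + b')%N, (b' + b)%N, (c *: z + z'); split; first by rewrite !PoszD; ring.
  exact: in_gen_lin.
rewrite mulrDl -scalerAl (ghD a b b') (ghD a' b' b).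
have -> : (a' + b = a + b')%N by move: dE; lia.
by rewrite (addnC b b').
Qed.

Lemma local_degree_inv : local_degree (-1) h.
Proof. by exists 0%N, 1%N, 1; split; [| exact: in_gen1 | rewrite !mul1r]. Qed.

Lemma local_degree1 x : in_gen P (x * h) -> local_degree 1 x.
Proof. by move=> xh; exists 1%N, 0%N, (x * h); rewrite mulr1 -mulrA hg mulr1. Qed.

Lemma local_degree0_gen x : local_degree 0 x -> in_gen P x.
Proof.
move=> [a [b [z [ab zP ->]]]]; have -> : b = a by move: ab; lia.
by rewrite ghX mulr1.
Qed.
End LocalDegree.

(** * Isomorphisms given by their graphs *)

Section GraphIsomorphism.
Variables (k : fieldType) (A B : algType k) (R : A -> B -> Prop).
Hypotheses (R1 : R 1 1) (RM : forall x y x' y', R x y -> R x' y' -> R (x * x') (y * y')).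
Hypothesis R_lin : forall c x y x' y', R x y -> R x' y' -> R (c *: x + x') (c *: y + y').
Hypotheses (Rl : forall x, exists y, R x y) (Rr : forall y, exists x, R x y).
Hypotheses (R0l : forall y, R 0 y -> y = 0) (R0r : forall x, R x 0 -> x = 0).

Let R_fun x y y' : R x y -> R x y' -> y = y'.
Proof.
move=> xy xy'; apply/eqP; rewrite -subr_eq0; apply/eqP/R0l.
by have := R_lin (-1) xy' xy; rewrite !scaleN1r addNr addrC.
Qed.

Let R_inj x x' y : R x y -> R x' y -> x = x'.
Proof.
move=> xy x'y; apply/eqP; rewrite -subr_eq0; apply/eqP/R0r.
by have := R_lin (-1) x'y xy; rewrite !scaleN1r addNr addrC.
Qed.

Definition graph_map (x : A) : B := projT1 (cid (Rl x)).

Let graph_mapP x : R x (graph_map x). Proof. exact: projT2 (cid (Rl x)). Qed.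

Fact graph_map_linear : linear graph_map.
Proof. by move=> c x y; apply: R_fun (graph_mapP _) _; exact: R_lin. Qed.

Fact graph_map_monoid_morphism : monoid_morphism graph_map.
Proof.
by split=> [|x y]; apply: R_fun (graph_mapP _) _; [exact: R1 | exact: RM].
Qed.

HB.instance Definition _ := GRing.isLinear.Build k A B *:%R graph_map graph_map_linear.
HB.instance Definition _ := GRing.isMonoidMorphism.Build A B graph_map graph_map_monoid_morphism.

Lemma graph_isomorphic : alg_isomorphic A B.
Proof.
exists graph_map; exists (fun y => projT1 (cid (Rr y))) => [x|y].
  by apply: R_inj (graph_mapP x); exact: projT2 (cid (Rr _)).
by apply: R_fun (graph_mapP _) _; exact: projT2 (cid (Rr _)).
Qed.
End GraphIsomorphism.

Section SchubertCell.
Variables (k : fieldType) (q : k).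
Hypotheses (q0 : q != 0) (hq : forall l : nat, (0 < l)%N -> q ^+ l != 1).
Variables (m n : nat) (gamma : Pi m n).

Local Notation gm := (val gamma).

(** The value 0 on sets of the wrong size is a filler; [plucker_axiom] evaluates the function on
    [m]-element sets only. *)
Definition grass_br (S : {set 'I_n}) : qgrass q m n :=
  if (insub S : option {I : {set 'I_n} | #|I| == m}) is Some J then plucker q (J : Pi m n) else 0.

Lemma grass_br_val (I : Pi m n) : grass_br (val I) = plucker q I.
Proof. by rewrite /grass_br valK. Qed.

Lemma PiP (S : {set 'I_n}) : #|S| = m -> exists I : Pi m n, S = val I.
Proof.
by move=> /eqP Sm; exists (exist (fun S : {set 'I_n} => #|S| == m) S Sm).
Qed.

Lemma grass_br_coldet (S : {set 'I_n}) : #|S| = m ->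
  subalg_val (grass_br S) = coldet q (@qmx_x k q m n) setT (enum S).
Proof. by move=> /PiP[I ->]; rewrite grass_br_val /= qminorE. Qed.

Lemma grass_br_plucker : plucker_axiom q m grass_br.
Proof.
move=> J K Jm Km; apply: val_inj.
rewrite [LHS](linear_sum (@subalg_val _ _ _)) [RHS](raddf0 (@subalg_val _ _ _)).
rewrite -[RHS](plucker_relation q0 hq (qmx_x_qmatrix q m n) J Km); apply: eq_bigr => c.
rewrite inE => /andP[cJ cK].
rewrite [LHS](linearZ_LR (@subalg_val _ _ _)); congr (_ *: _).
rewrite [LHS](rmorphM (@subalg_val _ _ _)) /= !grass_br_coldet //.
  by apply/eqP; rewrite -eqSS -Km (cardsD1 c K) cK.
by rewrite cardsU1 cJ.
Qed.

Definition schubert_in : qgrass q m n -> schubert_loc q gamma :=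
  loc_in (schubert_loc_proper q gamma) \o quot_pi (schubert_proper q gamma).

HB.instance Definition _ := GRing.LRMorphism.on schubert_in.

Definition loc_br (S : {set 'I_n}) : schubert_loc q gamma := schubert_in (grass_br S).

Local Notation h := (loc_inv (schubert_loc_proper q gamma)).

Lemma loc_br_val (I : Pi m n) :
  loc_br (val I) = loc_in (schubert_loc_proper q gamma) (schubert_plucker q gamma I).
Proof. by rewrite /loc_br grass_br_val. Qed.

Lemma loc_br_plucker : plucker_axiom q m loc_br.
Proof. exact: (plucker_axiom_morph schubert_in grass_br_plucker). Qed.

Lemma loc_br_invr : loc_br gm * h = 1.
Proof. by rewrite loc_br_val loc_inVr. Qed.

Lemma loc_br_invl : h * loc_br gm = 1.
Proof. by rewrite loc_br_val loc_inVl. Qed.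

Lemma loc_br_left c a : c \in gm -> a \notin gm -> (a < c)%N -> loc_br (a |: gm :\ c) = 0.
Proof.
move=> cg ag ac; have [I E] := PiP (eqP (exchange_card cg ag)).
rewrite /loc_br E grass_br_val /schubert_in /= -[RHS](raddf0 (loc_in (schubert_loc_proper q gamma))).
congr (loc_in _ _); rewrite -[RHS](raddf0 (quot_pi (schubert_proper q gamma))).
apply: quot_pi_eq; rewrite subr0; exists I => //.
exact: st_le_exchange cg ag ac (esym E).
Qed.

Local Notation Y := (cell_matrix gamma loc_br h).

Lemma schubert_cell_partition : partition_matrix q^-1 (cell_shape gamma) Y.
Proof.
exact: (cell_matrix_partition q0 hq loc_br_plucker loc_br_invr loc_br_invl loc_br_left).
Qed.

(** The echelon matrix kills the minors not above [gamma] and makes the minor [gamma] invertible, so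
    it yields a morphism from the localization to the torus, where independence is known. *)
Lemma schubert_words_independent : words_independent (cell_shape gamma) Y.
Proof.
have [h' [gh' hg']] := br_echX_inv q0 gamma.
pose f : {lrmorphism _ -> _} :=
  schubert_loc_map (echX_qmatrix q0 gamma) (@br_echX0 _ q _ _ gamma) gh' hg'.
have f_br (S : {set 'I_n}) : #|S| = m -> f (loc_br S) = coldet q (echX q gamma) setT (enum S).
  move=> /PiP[I ->]; rewrite loc_br_val; apply: etrans (schubert_loc_map_in _ _ _ _ _) _.
  exact: schubert_map_plucker.
apply: (@words_independent_morph _ _ _ _ _ _ _ _ f _ (torus_words_independent q0 hq gh')).
move=> i j; apply: etrans (rmorphM f _ _) _; congr (_ * _).
  by apply/f_br/eqP/exchange_card; [exact: mem_elt | exact: free_col_notin].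
exact: schubert_loc_map_inv.
Qed.

(** [in_degree] is the least family closed under the grading rules, so it suffices that
    [local_degree] obeys them; a single Pluecker coordinate is covered by [br_cell]. *)
Lemma degree_local_degree d x : in_degree (@schubert_gens k q m n gamma) d x ->
  local_degree (is_cellgen loc_br gm h) (loc_br gm) h d
    (loc_in (schubert_loc_proper q gamma) x).
Proof.
have gP x' : is_cellgen loc_br gm h x' -> loc_br gm * x' = q *: (x' * loc_br gm).
  case=> c [a [cg ag ->]].
  exact: (gam_cellgen q0 loc_br_plucker (eqP (valP gamma)) loc_br_invr loc_br_invl loc_br_left).
elim=> [e y [-> [I ->]]|e||e e' y z _ IHy _ IHz|e c y z _ IHy _ IHz].
- apply: (local_degree1 loc_br_invl); rewrite -loc_br_val.
  exact: (proj2 (br_cell q0 loc_br_plucker (eqP (valP gamma)) loc_br_invr loc_br_invl loc_br_left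
    (eqP (valP I)))).
- rewrite raddf0; exact: local_degree0.
- rewrite rmorph1; apply: local_degree_gen => //; exact: in_gen1.
- rewrite rmorphM; exact: (local_degreeM q0 loc_br_invr loc_br_invl gP).
- rewrite linearP; exact: (local_degree_lin q0 loc_br_invr loc_br_invl).
Qed.

(** In degree 0 the powers of [gamma] and its inverse cancel, leaving the algebra of all cell
    generators. Those whose free column lies left of the pivot vanish, which leaves the boxes of the
    diagram. *)
Lemma cell_degree0 x : in_degree (@schubert_loc_gens k q m n gamma) 0 x ->
  in_gen (is_entry (cell_shape gamma) Y) x.
Proof.
have gP x' : is_cellgen loc_br gm h x' -> loc_br gm * x' = q *: (x' * loc_br gm).
  case=> c [a [cg ag ->]].
  exact: (gam_cellgen q0 loc_br_plucker (eqP (valP gamma)) loc_br_invr loc_br_invl loc_br_left).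
move=> x0; apply: (@in_gen_sub _ _ (is_cellgen loc_br gm h)) => [y [c [a [cg ag ->]]]|].
  have [r cE] := eltP cg; have [j aE] := free_colP ag; rewrite {}cE {}aE in cg ag *.
  case: (ltngtP (elt gamma r) (free_col gamma j)) => [lt|gt|/val_inj E].
  - by apply: in_gen_gen; exists r, j; rewrite cell_shapeP.
  - by rewrite /cellgen loc_br_left // mul0r; exact: in_gen0.
  - by rewrite E (negbTE ag) in cg.
apply: (local_degree0_gen q0 loc_br_invr loc_br_invl).
elim: x0 => [e y [[z zd ->]|[-> ->]]|e||e e' y z _ IHy _ IHz|e c y z _ IHy _ IHz].
- exact: degree_local_degree.
- exact: local_degree_inv.
- exact: local_degree0.
- apply: local_degree_gen => //; exact: in_gen1.
- exact: (local_degreeM q0 loc_br_invr loc_br_invl gP).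
- exact: (local_degree_lin q0 loc_br_invr loc_br_invl).
Qed.

Lemma cell_matrix_degree0 i j : in_degree (@schubert_loc_gens k q m n gamma) 0 (Y i j).
Proof.
have [I E] := PiP (eqP (exchange_card (mem_elt gamma i) (free_col_notin gamma j))).
rewrite /cell_matrix /cellgen E loc_br_val.
apply: (@in_degreeM _ _ _ 1 (-1)); apply: in_degree_gen; last by right.
by left; exists (schubert_plucker q gamma I) => //; apply: in_degree_gen; split=> //; exists I.
Qed.
End SchubertCell.

(** * Independence of sorted words in quantum matrices *)

Section QuantumMatrixBasis.
Variables (k : fieldType) (q : k).
Hypotheses (q0 : q != 0) (hq : forall l : nat, (0 < l)%N -> q ^+ l != 1).
Variables (m n : nat) (mn : (m <= n)%N).

Lemma initial_card : #|[set i : 'I_n | (i < m)%N]| == m.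
Proof. by rewrite card_ord_lt. Qed.

Definition initial : Pi m n := exist (fun S : {set 'I_n} => #|S| == m) _ initial_card.

Lemma initial_shape i (j : 'I_(n - m)) : (j < cell_shape initial i)%N.
Proof.
rewrite cell_shapeP; have := free_col_notin initial j; rewrite /= inE -leqNgt.
by apply: leq_trans; have := mem_elt initial i; rewrite /= inE.
Qed.

(* Taking [gamma] minimal, the torus representation of the cell of [gamma] is
   one of the whole algebra of quantum matrices. *)
Lemma qmx_words_independent (lam : 'I_m -> nat) :
  words_independent lam (@qmx_x k q^-1 m (n - m)).
Proof.
have [h' [gh' hg']] := br_echX_inv q0 initial.
have YP := cell_matrix_partition q0 hq (br_echX_plucker q0 hq initial) gh' hg'
  (@br_echX_left _ q _ _ initial).
set Y := cell_matrix _ _ _ in YP.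
have YQ : qmatrix q^-1 Y.
  case: YP => Yr Yc Ya Yd; split=> *; [exact: Yr (initial_shape _ _) | apply: Yc | apply: Ya | apply: Yd];
    by rewrite ?initial_shape.
have indep : words_independent (cell_shape initial) (@qmx_x k q^-1 m (n - m)).
  apply: (@words_independent_morph _ _ _ _ _ _ _ _ (qmx_map YQ) _ (torus_words_independent q0 hq gh')).
  by move=> i j; rewrite /= qmx_map_x.
move=> s c us sN; apply: indep => // w /sN/andP[ws _]; rewrite /normal_word ws.
by apply/allP => x _; exact: initial_shape.
Qed.
End QuantumMatrixBasis.

Theorem theorem3p8 (k : fieldType) (q : k) (hq0 : q != 0)
  (hq : forall l : nat, (0 < l)%N -> q ^+ l != 1)
  (m n : nat) (hm : (0 < m)%N) (hn : (0 < n)%N) (hmn : (m <= n)%N)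
  (gamma : Pi m n) :
  exists lam : 'I_m -> nat,
    is_partition (n - m) lam /\
    alg_isomorphic (schubert_cell q gamma)
                   (partition_subalg q^-1 (n - m) lam).
Proof.
exists (cell_shape gamma); split; first exact: cell_shape_partition.
have [_ lam_anti] := cell_shape_partition gamma.
set lam := cell_shape gamma in lam_anti *.
pose A : algType k := schubert_loc q gamma.
pose B : algType k := qmx q^-1 m (n - m).
pose Y : 'I_m -> 'I_(n - m) -> A := cell_matrix gamma (loc_br q gamma) (loc_inv (schubert_loc_proper q gamma)).
pose X : 'I_m -> 'I_(n - m) -> B := @qmx_x k q^-1 m (n - m).
pose Z i j : (A * B)%type := (Y i j, X i j).
have p0 : q^-1 != 0 by rewrite invr_eq0.
have ZP : partition_matrix q^-1 lam Z.
  apply: pair_partition_matrix; first exact: schubert_cell_partition.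
  exact/qmatrix_partition_matrix/qmx_x_qmatrix.
have indY : words_independent lam Y by exact: schubert_words_independent.
have indX : words_independent lam X by exact: qmx_words_independent.
(* The graph of the future isomorphism: the subalgebra of [A * B] generated by the pairs (Y i j, X i
   j) with (i, j) in the diagram. *)
pose R (x : A) (y : B) := in_gen (is_entry lam Z) ((x, y) : (A * B)%type).
have RE x y : R x y -> exists (s : seq (seq (box m (n - m)))) (c : _ -> k),
    [/\ uniq s, forall w, w \in s -> normal_word lam w,
        x = \sum_(w <- s) c w *: word Y w & y = \sum_(w <- s) c w *: word X w].
  move=> /(gen_word_span p0 lam_anti ZP)/word_span_sum[s [c [us sN E]]].
  exists s, c; split=> //.
    rewrite -[LHS]/(fst (x, y)) E (linear_sum (@fst A B)); apply: eq_bigr => w _.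
    by apply: etrans (linearZ_LR (@fst A B) _ _) _; congr (_ *: _); exact: word_morph.
  rewrite -[LHS]/(snd (x, y)) E (linear_sum (@snd A B)); apply: eq_bigr => w _.
  by apply: etrans (linearZ_LR (@snd A B) _ _) _; congr (_ *: _); exact: word_morph.
(* Both components of an element of [R] are the same combination of normal words; if one component
   is zero, independence on that side kills every coefficient, hence the other component. *)
have R0l y : R 0 y -> y = 0.
  move=> /RE[s [c [us sN E ->]]]; rewrite big1_seq // => w /andP[_ ws].
  by rewrite (indY s c us sN (esym E) w ws) scale0r.
have R0r x : R x 0 -> x = 0.
  move=> /RE[s [c [us sN -> E]]]; rewrite big1_seq // => w /andP[_ ws].
  by rewrite (indX s c us sN (esym E) w ws) scale0r.
have Rl x : in_gen (is_entry lam Y) x -> exists y, R x y.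
  elim=> [_ [i [j [ji ->]]]||x1 x2 _ [y1 R1] _ [y2 R2]|c x1 x2 _ [y1 R1] _ [y2 R2]].
  - by exists (X i j); apply: in_gen_gen; exists i, j.
  - exists 1; exact: in_gen1.
  - exists (y1 * y2); exact: in_genM R1 R2.
  - exists (c *: y1 + y2); exact: in_gen_lin R1 R2.
have Rr y : in_gen (is_entry lam X) y -> exists x, R x y.
  elim=> [_ [i [j [ji ->]]]||y1 y2 _ [x1 R1] _ [x2 R2]|c y1 y2 _ [x1 R1] _ [x2 R2]].
  - by exists (Y i j); apply: in_gen_gen; exists i, j.
  - exists 1; exact: in_gen1.
  - exists (x1 * x2); exact: in_genM R1 R2.
  - exists (c *: x1 + x2); exact: in_gen_lin R1 R2.
(* [R] lives in the ambient algebras; this fact and the next one place its components in the two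
   subalgebras to be compared. *)
have Rgen x y : R x y -> y \in gen_subalg (is_entry lam X).
  move=> xy; apply/asboolP; apply: (in_gen_morph (f := @snd A B) _ xy) => _ [i [j [ji ->]]].
  by apply: in_gen_gen; exists i, j.
have Rdeg x y : R x y -> x \in degree0 (@schubert_loc_gens k q m n gamma).
  move=> xy; have : in_gen (fun z => z \in degree0 (@schubert_loc_gens k q m n gamma)) x.
    apply: (in_gen_morph (f := @fst A B) _ xy) => _ [i [j [ji ->]]].
    by apply: in_gen_gen; apply/asboolP; exact: cell_matrix_degree0.
  elim=> [//||x1 x2 _ IH1 _ IH2|c x1 x2 _ IH1 _ IH2].
  - exact: rpred1.
  - exact: rpredM.
  - by apply: rpredD => //; exact: rpredZ.
apply: (@graph_isomorphic k (schubert_cell q gamma) (partition_subalg q^-1 (n - m) lam)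
  (fun u v => R (subalg_val u) (subalg_val v))).
- exact: in_gen1.
- move=> x y x' y' xy xy'; exact: in_genM xy xy'.
- move=> c x y x' y' xy xy'; exact: in_gen_lin xy xy'.
- move=> u; have /asboolP/(cell_degree0 hq0 hq)/Rl[y uy] := subalg_valP u.
  by exists (Subalgebra (Rgen _ _ uy)).
- move=> v; have /asboolP/Rr[x xv] := subalg_valP v.
  by exists (Subalgebra (Rdeg _ _ xv)).
- by move=> v v0; apply: val_inj; exact: R0l.
- by move=> u u0; apply: val_inj; exact: R0r.
Qed.
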